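(* Let $B=\Bbbk\langle a,b,c\mid a^2,\,b^2,\,c^2,\,ab+bc+ca,\,ba+cb+ac\rangle$ be the 12-dimensional Fomin-Kirillov algebra and let $E(B)=\bigoplus_{n\ge 0}\operatorname{Ext}^n_B(\Bbbk,\Bbbk)$ be its cohomology (Yoneda) ring. Let $S$ be the braided symmetric algebra $$S=\Bbbk\langle \mathsf a,\mathsf b,\mathsf c\rangle/(xy-zx \mid (x,y,z)\text{ a permutation of }(\mathsf a,\mathsf b,\mathsf c)),$$ graded by $\deg\mathsf a=\deg\mathsf b=\deg\mathsf c=1$. Then the graded algebra $E(B)$ is isomorphic to the polynomial ring $S[X]$ (with $X$ a central indeterminate), where the grading on $S[X]$ is taken so that $\deg X=4$.
   Context: $\Bbbk$ is a field of characteristic zero. $B$ is a connected $\mathbb N$-graded algebra with $a,b,c$ in degree 1, and $\Bbbk$ is the trivial $B$-module $B/B_+$, where $B_+=\bigoplus_{n>0}B_n$. The ring structure of $E(B)$ is the Yoneda product: $E(B)$ is the cohomology of the differential graded algebra $\Omega^n=\operatorname{Hom}_\Bbbk(B_+^{\otimes n},\Bbbk)$ with $\delta(f)(\lambda_0,\dots,\lambda_n)=\sum_{i=0}^{n-1}(-1)^{i+1}f(\lambda_0,\dots,\lambda_i\lambda_{i+1},\dots,\lambda_n)$ and product $(fg)(\lambda_1,\dots,\lambda_{n+m})=f(\lambda_1,\dots,\lambda_n)g(\lambda_{n+1},\dots,\lambda_{n+m})$. The grading of $E(B)$ is the cohomological one. *)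

(* Defs.v *)
From HB Require Import structures.
From mathcomp Require Import all_boot all_order all_algebra perm.
From mathcomp Require Import boolp functions.
From mathcomp Require Import finmap monalg generic_quotient.

Set Implicit Arguments.
Unset Strict Implicit.
Unset Printing Implicit Defensive.

Import GRing.Theory.
Local Open Scope ring_scope.
Local Open Scope quotient_scope.

(* MathComp's ring quotients are restricted to commutative rings, and its     *)
(* ideal structures are one-sided; two-sided ideals are proper here, so that  *)
(* the quotient is an nzRingType.                                             *)

Definition two_sided_ideal_closed (k : nzRingType) (A : algType k)
    (S : {pred A}) : Prop :=
  [/\ 1 \notin S, zmod_closed S,
      forall a, {in S, forall u, a * u \in S}
    & forall a, {in S, forall u, u * a \in S}].

Record twoSidedIdeal (k : nzRingType) (A : algType k) := TwoSidedIdeal {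
  ideal_pred :> {pred A};
  two_sided_idealP : two_sided_ideal_closed ideal_pred
}.

Section TwoSidedIdealTheory.
Variables (k : nzRingType) (A : algType k) (I : twoSidedIdeal A).

Lemma ideal1 : 1 \notin I.
Proof. by case: (two_sided_idealP I). Qed.

Lemma idealMr (a u : A) : u \in I -> a * u \in I.
Proof. by case: (two_sided_idealP I) => _ _ Il _; apply: Il. Qed.

Lemma idealMl (a u : A) : u \in I -> u * a \in I.
Proof. by case: (two_sided_idealP I) => _ _ _ Ir; apply: Ir. Qed.

Fact ideal_zmod_closed : zmod_closed I.
Proof. by case: (two_sided_idealP I). Qed.

Fact ideal_scaler_closed : GRing.scaler_closed I.
Proof. by move=> c u Iu; rewrite -[u]mul1r scalerAl; apply: idealMr. Qed.

HB.instance Definition _ :=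
  GRing.isZmodClosed.Build A (ideal_pred I) ideal_zmod_closed.
HB.instance Definition _ :=
  GRing.isScaleClosed.Build k A (ideal_pred I) ideal_scaler_closed.

End TwoSidedIdealTheory.

Definition alg_quot (k : nzRingType) (A : algType k) (I : twoSidedIdeal A) :=
  Quotient.quot (ideal_pred I).

Section AlgQuotient.
Variables (k : nzRingType) (A : algType k) (I : twoSidedIdeal A).
Local Notation Q := (alg_quot I).

HB.instance Definition _ := GRing.Zmodule.on Q.
HB.instance Definition _ : EqQuotient A (Quotient.equiv (ideal_pred I)) Q :=
  EqQuotient.on Q.

Definition aq_pi (x : A) : Q := \pi_Q x.

Lemma aq_piP (x y : A) : aq_pi x = aq_pi y <-> x - y \in I.
Proof.
by rewrite (Quotient.idealrBE (ideal_pred I)); split=> [h|/eqP//]; apply/eqP.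
Qed.

Lemma aq_reprK (q : Q) : aq_pi (repr q) = q.
Proof. exact: reprK. Qed.

Lemma aq_piD (x y : A) : aq_pi (x + y) = aq_pi x + aq_pi y.
Proof. by rewrite /aq_pi [LHS](Quotient.pi_add (ideal_pred I)). Qed.

Definition aq_one : Q := aq_pi 1.
Definition aq_mul (x y : Q) : Q := aq_pi (repr x * repr y).
Definition aq_scale (c : k) (x : Q) : Q := aq_pi (c *: repr x).

Lemma aq_piM (x y : A) : aq_pi (x * y) = aq_mul (aq_pi x) (aq_pi y).
Proof.
apply/aq_piP; set x' := repr _; set y' := repr _.
have Ix : x - x' \in I by apply/aq_piP; rewrite aq_reprK.
have Iy : y - y' \in I by apply/aq_piP; rewrite aq_reprK.
have -> : x * y - x' * y' = (x - x') * y + x' * (y - y').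
  by rewrite mulrBl mulrBr addrA subrK.
apply: rpredD; [exact: idealMl | exact: idealMr].
Qed.

Lemma aq_piZ (c : k) (x : A) : aq_pi (c *: x) = aq_scale c (aq_pi x).
Proof.
apply/aq_piP; rewrite -scalerBr rpredZ //.
by apply/aq_piP; rewrite aq_reprK.
Qed.

Fact aq_mulA : associative aq_mul.
Proof.
move=> x y z; rewrite -[x]aq_reprK -[y]aq_reprK -[z]aq_reprK.
by rewrite -!aq_piM mulrA.
Qed.

Fact aq_mul1l : left_id aq_one aq_mul.
Proof. by move=> x; rewrite -[x]aq_reprK -aq_piM mul1r. Qed.

Fact aq_mul1r : right_id aq_one aq_mul.
Proof. by move=> x; rewrite -[x]aq_reprK -aq_piM mulr1. Qed.

Fact aq_mulDl : left_distributive aq_mul +%R.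
Proof.
move=> x y z; rewrite -[x]aq_reprK -[y]aq_reprK -[z]aq_reprK.
by rewrite -aq_piD -!aq_piM -aq_piD mulrDl.
Qed.

Fact aq_mulDr : right_distributive aq_mul +%R.
Proof.
move=> x y z; rewrite -[x]aq_reprK -[y]aq_reprK -[z]aq_reprK.
by rewrite -aq_piD -!aq_piM -aq_piD mulrDr.
Qed.

Fact aq_pi0 : aq_pi 0 = 0.
Proof. by apply: (addrI (aq_pi 0)); rewrite -aq_piD !addr0. Qed.

Fact aq_one_neq0 : aq_one != 0.
Proof.
apply/eqP; rewrite /aq_one -aq_pi0 => /aq_piP.
by rewrite subr0 (negPf (ideal1 I)).
Qed.

HB.instance Definition _ := GRing.Zmodule_isNzRing.Build Q
  aq_mulA aq_mul1l aq_mul1r aq_mulDl aq_mulDr aq_one_neq0.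

Fact aq_scaleA (a b : k) (x : Q) :
  aq_scale a (aq_scale b x) = aq_scale (a * b) x.
Proof. by rewrite -[x]aq_reprK -!aq_piZ scalerA. Qed.

Fact aq_scale1 : left_id 1 aq_scale.
Proof. by move=> x; rewrite -[x]aq_reprK -aq_piZ scale1r. Qed.

Fact aq_scaleDr : right_distributive aq_scale +%R.
Proof.
move=> c x y; rewrite -[x]aq_reprK -[y]aq_reprK.
by rewrite -aq_piD -!aq_piZ -aq_piD scalerDr.
Qed.

Fact aq_scaleDl (x : Q) : {morph aq_scale^~ x : a b / a + b}.
Proof.
by move=> a b; rewrite -[x]aq_reprK -!aq_piZ -aq_piD scalerDl.
Qed.

HB.instance Definition _ := GRing.Zmodule_isLmodule.Build k Q
  aq_scaleA aq_scale1 aq_scaleDr aq_scaleDl.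

Fact aq_scaleAl (c : k) (x y : Q) : c *: (x * y) = (c *: x) * y.
Proof.
rewrite -[x]aq_reprK -[y]aq_reprK.
by rewrite -[LHS]/(aq_scale c (aq_mul _ _)) -[RHS]/(aq_mul (aq_scale c _) _)
  -aq_piZ -!aq_piM -aq_piZ scalerAl.
Qed.

HB.instance Definition _ := GRing.Lmodule_isLalgebra.Build k Q aq_scaleAl.

Fact aq_scaleAr (c : k) (x y : Q) : c *: (x * y) = x * (c *: y).
Proof.
rewrite -[x]aq_reprK -[y]aq_reprK.
by rewrite -[LHS]/(aq_scale c (aq_mul _ _)) -[RHS]/(aq_mul _ (aq_scale c _))
  -aq_piZ -!aq_piM -aq_piZ scalerAr.
Qed.

HB.instance Definition _ := GRing.Lalgebra_isAlgebra.Build k Q aq_scaleAr.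

Fact aq_pi_zmod_morphism : zmod_morphism aq_pi.
Proof. by move=> x y; rewrite -[LHS]addr0 -(subrr (aq_pi y)) addrA -aq_piD subrK. Qed.

HB.instance Definition _ :=
  GRing.isZmodMorphism.Build A Q aq_pi aq_pi_zmod_morphism.
HB.instance Definition _ :=
  GRing.isMonoidMorphism.Build A Q aq_pi (conj erefl aq_piM).
HB.instance Definition _ := GRing.isScalable.Build k A Q *:%R aq_pi aq_piZ.

End AlgQuotient.

(* The free associative algebra k<x_0, ..., x_(n-1)> has the words on 'I_n as *)
(* a basis; multinomials provides no algType for {malg _} over a              *)
(* noncommutative monoid.                                                     *)
Definition free_alg (k : fieldType) (n : nat) := {malg k[{fmonom 'I_n}]}.

Section FreeAlgebra.
Variables (k : fieldType) (n : nat).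
Local Notation F := (free_alg k n).

HB.instance Definition _ := GRing.Lalgebra.on F.

Fact free_alg_scaleAr (c : k) (x y : F) : c *: (x * y) = x * (c *: y).
Proof.
apply/malgP => m; rewrite mcoeffZ.
rewrite (mcoeffMlw _ (fsubset_refl _) (fsubset_refl _)).
rewrite (mcoeffMlw _ (fsubset_refl _) (msuppZ_le c y)).
rewrite mulr_sumr; apply: eq_bigr => m1 _.
rewrite mulr_sumr; apply: eq_bigr => m2 _.
by rewrite mulrnAr mcoeffZ mulrCA.
Qed.

HB.instance Definition _ := GRing.Lalgebra_isAlgebra.Build k F free_alg_scaleAr.

Definition free_var (i : 'I_n) : F := << fmu i >>.

Definition word_homog (d : nat) (u : F) : Prop :=
  forall m : {fmonom 'I_n}, u@_m != 0 -> fdeg m = d.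

Definition free_aug : {pred F} := fun u => u@_(@mone {fmonom 'I_n}) == 0.

Fact free_aug_two_sided : two_sided_ideal_closed free_aug.
Proof.
rewrite /free_aug; split.
- by rewrite unfold_in rmorph1 oner_eq0.
- split=> [|x y]; rewrite !unfold_in ?raddf0 // => /eqP x0 /eqP y0.
  by rewrite raddfB /= x0 y0 subrr.
- by move=> a u; rewrite !unfold_in rmorphM /= => /eqP->; rewrite mulr0.
- by move=> a u; rewrite !unfold_in rmorphM /= => /eqP->; rewrite mul0r.
Qed.

Definition free_aug_ideal := TwoSidedIdeal free_aug_two_sided.

Fact free_var_aug (i : 'I_n) : free_var i \in free_aug_ideal.
Proof. by rewrite unfold_in /= /free_aug mcoeffU1 -fdeg_eq0 fdegU. Qed.

End FreeAlgebra.

(* Relators without constant term, so that the presented algebra is nonzero   *)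
(* and augmented.                                                             *)
Record relators (k : fieldType) (n : nat) := Relators {
  relator_seq :> seq (free_alg k n);
  relator_aug : all [in free_aug_ideal k n] relator_seq
}.

Section Presentation.
Variables (k : fieldType) (n : nat) (P : relators k n).
Local Notation F := (free_alg k n).

Definition gen_ideal : {pred F} :=
  fun x => `[< forall J : twoSidedIdeal F, {subset (P : seq F) <= J} -> x \in J >].

Fact gen_ideal_aug : {subset gen_ideal <= free_aug_ideal k n}.
Proof. by move=> x /asboolP; apply; apply/allP/relator_aug. Qed.

Fact gen_ideal_two_sided : two_sided_ideal_closed gen_ideal.
Proof.
split.
- by apply/negP => /gen_ideal_aug; apply/negP/ideal1.
- split=> [|x y /asboolP Jx /asboolP Jy]; apply/asboolP => J PJ.
    exact: rpred0.
  by apply: rpredB; [exact: Jx | exact: Jy].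
- by move=> a u /asboolP Ju; apply/asboolP => J PJ; apply/idealMr/Ju.
- by move=> a u /asboolP Ju; apply/asboolP => J PJ; apply/idealMl/Ju.
Qed.

Definition relator_ideal := TwoSidedIdeal gen_ideal_two_sided.

Definition presented := alg_quot relator_ideal.

HB.instance Definition _ := GRing.Algebra.on presented.

(* The component of degree d for the grading with all generators in degree 1  *)
(* (a grading when the relators are homogeneous).                             *)
Definition pres_homog (d : nat) (x : presented) : Prop :=
  exists2 u : F, word_homog d u & aq_pi relator_ideal u = x.

(* The sum of the components of positive degree: elements represented by a    *)
(* noncommutative polynomial without constant term.                           *)
Definition pres_aug : {pred presented} :=
  fun x => `[< exists2 u : F, u \in free_aug_ideal k n
                 & aq_pi relator_ideal u = x >].

Fact pres_aug_two_sided : two_sided_ideal_closed pres_aug.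
Proof.
split.
- apply/negP => /asboolP[u u0 /(aq_piP relator_ideal) u1].
  have /negP := ideal1 (free_aug_ideal k n); apply.
  rewrite -[1](subKr u); apply: rpredB => //.
  exact: gen_ideal_aug.
- split=> [|x y /asboolP[u u0 <-] /asboolP[v v0 <-]]; apply/asboolP.
    by exists 0; [exact: rpred0 | rewrite raddf0].
  by exists (u - v); [exact: rpredB | rewrite raddfB].
- move=> a x /asboolP[u u0 <-]; apply/asboolP.
  exists (repr a * u); first exact: idealMr.
  by rewrite rmorphM /= aq_reprK.
- move=> a x /asboolP[u u0 <-]; apply/asboolP.
  exists (u * repr a); first exact: idealMl.
  by rewrite rmorphM /= aq_reprK.
Qed.

Definition pres_aug_ideal := TwoSidedIdeal pres_aug_two_sided.

End Presentation.

Section Cobar.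
Variables (k : fieldType) (A : algType k) (I : twoSidedIdeal A).

Record ideal_type := IdealElt { ideal_val : A; _ : ideal_val \in I }.

HB.instance Definition _ := [isSub for ideal_val].
HB.instance Definition _ := [Choice of ideal_type by <:].
HB.instance Definition _ := [SubChoice_isSubLmodule of ideal_type by <:].

Local Notation V := ideal_type.

Fact ideal_mul_subproof (x y : V) : ideal_val x * ideal_val y \in I.
Proof. by apply: idealMr; case: y. Qed.

Definition ideal_mul (x y : V) : V := IdealElt (ideal_mul_subproof x y).

(* An element of the direct sum over n of Hom(I^(x)n, k) is encoded as a      *)
(* function of a list of elements of I: its restriction to lists of size n is *)
(* multilinear, i.e. its component in Hom(I^(x)n, k), and almost all of these *)
(* components vanish.                                                         *)
Definition multilinear_on_lists (f : seq V -> k^o) : Prop :=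
  forall (s1 s2 : seq V) (c : k) (x y : V),
    f (s1 ++ (c *: x + y) :: s2) = c *: f (s1 ++ x :: s2) + f (s1 ++ y :: s2).

Definition bounded_degree (f : seq V -> k^o) : Prop :=
  exists N : nat, forall s : seq V, (N < size s)%N -> f s = 0.

Definition is_cochain : {pred seq V -> k^o} :=
  fun f => `[< multilinear_on_lists f /\ bounded_degree f >].

Definition conv (f g : seq V -> k^o) : seq V -> k^o :=
  fun s => \sum_(i < (size s).+1) (f (take i s) : k) * g (drop i s).

Definition conv_one : seq V -> k^o := fun s => (nilp s)%:R.

(* (x_0, ..., x_m) |-> (x_0, ..., x_i x_(i+1), ..., x_m) *)
Definition merge_at (i : nat) (s : seq V) : seq V :=
  take i s ++ ideal_mul (nth 0 s i) (nth 0 s i.+1) :: drop i.+2 s.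

Definition cobar_diff (f : seq V -> k^o) : seq V -> k^o :=
  fun s => \sum_(i < (size s).-1) (-1) ^+ i.+1 * (f (merge_at i s) : k).

Definition parity_twist (f : seq V -> k^o) : seq V -> k^o :=
  fun s => (-1) ^+ size s * (f s : k).

Local Notation sh x f := (fun t => f (x :: t)).

Fact conv_nil f g : conv f g [::] = (f [::] : k) * g [::].
Proof. by rewrite /conv big_ord1. Qed.

Fact conv_cons f g x s :
  conv f g (x :: s) = (f [::] : k) * g (x :: s) + conv (sh x f) g s.
Proof. by rewrite /conv /= big_ord_recl /=. Qed.

Fact convDl f1 f2 g s : conv (f1 + f2) g s = conv f1 g s + conv f2 g s.
Proof. by rewrite /conv -big_split; apply: eq_bigr => i _; rewrite /= mulrDl. Qed.

Fact convDr f g1 g2 s : conv f (g1 + g2) s = conv f g1 s + conv f g2 s.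
Proof. by rewrite /conv -big_split; apply: eq_bigr => i _; rewrite /= mulrDr. Qed.

Fact convZl (c : k) f g s : conv (c *: f) g s = c * (conv f g s : k).
Proof. by rewrite /conv mulr_sumr; apply: eq_bigr => i _; rewrite -mulrA. Qed.

Fact convZr (c : k) f g s : conv f (c *: g) s = c * (conv f g s : k).
Proof. by rewrite /conv mulr_sumr; apply: eq_bigr => i _; rewrite mulrCA. Qed.

Fact convA f g h : conv f (conv g h) = conv (conv f g) h.
Proof.
apply/funext => s; elim: s f g => [|x s IHs] f g.
  by rewrite !conv_nil mulrA.
rewrite [RHS]conv_cons conv_nil.
have -> : sh x (conv f g) = (f [::] : k) *: sh x g + conv (sh x f) g.
  by apply/funext => t; rewrite conv_cons.
by rewrite convDl convZl -IHs addrA !conv_cons mulrDr mulrA.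
Qed.

Fact conv1l f : conv conv_one f = f.
Proof.
apply/funext => -[|x s]; first by rewrite conv_nil mul1r.
rewrite conv_cons mul1r /conv big1 ?addr0 // => i _; exact: mul0r.
Qed.

Fact conv1r f : conv f conv_one = f.
Proof.
apply/funext => s; elim: s f => [|x s IHs] f; first by rewrite conv_nil mulr1.
by rewrite conv_cons mulr0 add0r IHs.
Qed.

Fact cobar_diff_nil f : cobar_diff f [::] = 0.
Proof. exact: big_ord0. Qed.

Fact cobar_diff1 f x : cobar_diff f [:: x] = 0.
Proof. exact: big_ord0. Qed.

Fact cobar_diff_cons2 f x y s :
  cobar_diff f [:: x, y & s]
  = - f (ideal_mul x y :: s) - cobar_diff (sh x f) (y :: s).
Proof.
rewrite /cobar_diff /= big_ord_recl /= /merge_at /= drop0 mulN1r; congr (_ + _).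
by rewrite -sumrN; apply: eq_bigr => i _; rewrite /= exprS mulN1r mulNr.
Qed.

Fact cobar_diffD f g s : cobar_diff (f + g) s = cobar_diff f s + cobar_diff g s.
Proof. by rewrite /cobar_diff -big_split; apply: eq_bigr => i _; rewrite /= mulrDr. Qed.

Fact cobar_diffZ (c : k) f s : cobar_diff (c *: f) s = c * (cobar_diff f s : k).
Proof. by rewrite /cobar_diff mulr_sumr; apply: eq_bigr => i _; rewrite mulrCA. Qed.

Fact cobar_diff_conv f g s :
  cobar_diff (conv f g) s
  = conv (cobar_diff f) g s + conv (parity_twist f) (cobar_diff g) s.
Proof.
elim: s f => [|x s IHs] f.
  by rewrite cobar_diff_nil !conv_nil !cobar_diff_nil mul0r mulr0 addr0.
case: s IHs => [|y s] IHs.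
  by rewrite !conv_cons !conv_nil /= !cobar_diff1 !cobar_diff_nil
    !mul0r !mulr0 !addr0.
rewrite cobar_diff_cons2 conv_cons.
have -> : sh x (conv f g) = (f [::] : k) *: sh x g + conv (sh x f) g.
  by apply/funext => t; rewrite conv_cons.
rewrite cobar_diffD cobar_diffZ IHs.
rewrite [conv (cobar_diff f) g _]conv_cons cobar_diff_nil mul0r add0r.
rewrite [conv (sh x (cobar_diff f)) g _]conv_cons cobar_diff1 mul0r add0r.
have -> : sh y (sh x (cobar_diff f)) =
    (-1 : k) *: (sh (ideal_mul x y) f + sh y (cobar_diff (sh x f))).
  by apply/funext => t; rewrite cobar_diff_cons2 scaleN1r opprD.
rewrite convZl convDl.
rewrite [conv (cobar_diff (sh x f)) g _]conv_cons cobar_diff_nil mul0r add0r.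
rewrite [conv (parity_twist f) _ _]conv_cons cobar_diff_cons2.
have -> : sh x (parity_twist f) = (-1 : k) *: parity_twist (sh x f).
  by apply/funext => t; rewrite /parity_twist /= exprS -mulrA.
have -> : parity_twist f [::] = f [::] by rewrite /parity_twist mul1r.
rewrite convZl !mulN1r mulrBr mulrN !opprD !addrA.
by rewrite [RHS](ACl (3*1*4*2*5)).
Qed.

Fact parity_twist_conv f g s :
  parity_twist (conv f g) s = conv (parity_twist f) (parity_twist g) s.
Proof.
rewrite /parity_twist /conv mulr_sumr; apply: eq_bigr => i _.
rewrite mulrACA -exprD -size_cat cat_take_drop; congr (_ * _).
Qed.

Fact parity_twistK f : parity_twist (parity_twist f) = f.
Proof.
by apply/funext => s; rewrite /parity_twist mulrA -expr2 sqrr_sign mul1r.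
Qed.

Fact cobar_diff_twist f s :
  cobar_diff (parity_twist f) s = - parity_twist (cobar_diff f) s.
Proof.
rewrite /cobar_diff /parity_twist mulr_sumr -sumrN; apply: eq_bigr => i _.
have lis : (i.+1 < size s)%N by case: (size s) i => [|n] [i /=] //; rewrite ltnS.
have sE : size s = (size (merge_at i s)).+1.
  rewrite /merge_at size_cat /= size_take size_drop (ltn_trans _ lis) //.
  by rewrite addnS -!addSn subnKC.
rewrite [in RHS](_ : (-1) ^+ size s = - (-1) ^+ size (merge_at i s)); last first.
  by rewrite (congr1 (fun n => (-1) ^+ n) sE) exprS mulN1r.
by rewrite mulNr opprK mulrCA.
Qed.

Fact cobar_diffK f s : cobar_diff (cobar_diff f) s = 0.
Proof.
elim: s f => [|x [|y s] IHs] f; rewrite ?cobar_diff_nil ?cobar_diff1 //.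
pose F t := if t is z :: u then f (ideal_mul x z :: u) else 0.
rewrite cobar_diff_cons2.
have -> : sh x (cobar_diff f) = (-1 : k) *: (F + cobar_diff (sh x f)).
  apply/funext => -[|z u].
    rewrite cobar_diff1 -[RHS]/(-1 * (0 + cobar_diff _ [::])).
    by rewrite cobar_diff_nil addr0 mulr0.
  by rewrite cobar_diff_cons2 scaleN1r opprD.
rewrite cobar_diffZ cobar_diffD IHs addr0 mulN1r opprK.
case: s {IHs} => [|z s]; first by rewrite !cobar_diff1 oppr0 addr0.
rewrite !cobar_diff_cons2 /=.
have -> : ideal_mul x (ideal_mul y z) = ideal_mul (ideal_mul x y) z.
  by apply: val_inj; rewrite /= mulrA.
by rewrite addNr.
Qed.

Fact cobar_diff_one s : cobar_diff conv_one s = 0.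
Proof.
rewrite /cobar_diff big1 // => i _.
rewrite /conv_one /merge_at; case: take => [|? ?]; exact: mulr0.
Qed.

Fact multilinear_sh f x :
  multilinear_on_lists f -> multilinear_on_lists (sh x f).
Proof. by move=> fP s1 s2 c y z; rewrite -!cat_cons fP. Qed.

Fact multilinear_sh_lin f (c : k) (x y : V) : multilinear_on_lists f ->
  sh (c *: x + y) f = c *: sh x f + sh y f.
Proof. by move=> fP; apply/funext => s; apply: (fP [::]). Qed.

Fact multilinear_lin f g (c : k) :
  multilinear_on_lists f -> multilinear_on_lists g ->
  multilinear_on_lists (c *: f + g).
Proof.
move=> fP gP s1 s2 d x y.
rewrite -![(c *: f + g) _]/(c *: f _ + g _) fP gP.
by rewrite !scalerDr !scalerA [d * c]mulrC !addrA [X in X + _]addrAC.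
Qed.

Fact multilinear_conv f g :
  multilinear_on_lists f -> multilinear_on_lists g ->
  multilinear_on_lists (conv f g).
Proof.
move=> fP gP s1 s2 c x y; elim: s1 f fP => [|z s1 IHs] f fP /=.
  rewrite !conv_cons multilinear_sh_lin // convDl convZl (gP [::]) /=.
  rewrite mulrDr scalerDr -!addrA; congr (_ + _); first by rewrite mulrCA.
  by rewrite addrCA.
rewrite !conv_cons IHs; last exact: multilinear_sh.
rewrite -!cat_cons gP mulrDr scalerDr -!addrA.
congr (_ + _); first by rewrite mulrCA.
by rewrite addrCA.
Qed.

Fact multilinear_one : multilinear_on_lists conv_one.
Proof.
move=> s1 s2 c x y.
have h z : conv_one (s1 ++ z :: s2) = 0 by rewrite /conv_one; case: s1.
by rewrite !h scaler0 addr0.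
Qed.

Fact ideal_mulPl (c : k) (x y z : V) :
  ideal_mul (c *: x + y) z = c *: ideal_mul x z + ideal_mul y z.
Proof. by apply: val_inj => /=; rewrite mulrDl scalerAl. Qed.

Fact ideal_mulPr (c : k) (x y z : V) :
  ideal_mul z (c *: x + y) = c *: ideal_mul z x + ideal_mul z y.
Proof. by apply: val_inj => /=; rewrite mulrDr scalerAr. Qed.

Fact multilinear_diff f :
  multilinear_on_lists f -> multilinear_on_lists (cobar_diff f).
Proof.
move=> fP s1 s2 c x y; elim: s1 f fP => [|z s1 IHs] f fP /=.
  case: s2 => [|w s2]; first by rewrite !cobar_diff1 scaler0 addr0.
  rewrite !cobar_diff_cons2 multilinear_sh_lin // cobar_diffD cobar_diffZ.
  rewrite ideal_mulPl (fP [::]) /= scalerBr scalerN !opprD -!addrA.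
  by congr (_ + _); rewrite addrCA.
have {}IHs := IHs _ (multilinear_sh z fP).
case: s1 IHs => [|w s1] /= IHs.
  rewrite !cobar_diff_cons2 IHs ideal_mulPr (fP [::]) /=.
  rewrite scalerBr scalerN !opprD -!addrA.
  by congr (_ + _); rewrite addrCA.
rewrite !cobar_diff_cons2 IHs -!cat_cons fP.
rewrite scalerBr scalerN !opprD -!addrA.
by congr (_ + _); rewrite addrCA.
Qed.

Fact multilinear_twist f :
  multilinear_on_lists f -> multilinear_on_lists (parity_twist f).
Proof.
move=> fP s1 s2 c x y; rewrite /parity_twist fP mulrDr !size_cat /=.
by congr (_ + _); rewrite mulrCA.
Qed.

Fact is_cochain_submod : submod_closed is_cochain.
Proof.
split=> [|c f g /asboolP[fP [m fb]] /asboolP[gP [n gb]]]; apply/asboolP; split.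
- by move=> *; rewrite /= scaler0 addr0.
- by exists 0%N.
- exact: multilinear_lin.
- exists (maxn m n) => s; rewrite gtn_max => /andP[ms ns].
  by rewrite -[LHS]/(c *: f s + g s) fb // gb // scaler0 addr0.
Qed.

HB.instance Definition _ :=
  GRing.isSubmodClosed.Build k (seq V -> k^o) is_cochain is_cochain_submod.

Record cochain := Cochain { cochain_val :> seq V -> k^o; _ : cochain_val \in is_cochain }.

HB.instance Definition _ := [isSub for cochain_val].
HB.instance Definition _ := [Choice of cochain by <:].
HB.instance Definition _ := [SubChoice_isSubLmodule of cochain by <:].

Fact cochain_one_subproof : conv_one \in is_cochain.
Proof.
apply/asboolP; split; first exact: multilinear_one.
by exists 0%N => -[].
Qed.

Fact cochain_mul_subproof (f g : cochain) : conv f g \in is_cochain.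
Proof.
case: f g => [f /= /asboolP[fP [m fb]]] [g /= /asboolP[gP [n gb]]].
apply/asboolP; split; first exact: multilinear_conv.
exists (m + n)%N => s mns; rewrite /conv big1 // => i _.
case: (ltnP m i) => im.
  rewrite fb ?mul0r // size_take; case: (ltnP i (size s)) => // _.
  exact: leq_ltn_trans (leq_addr n m) mns.
rewrite gb ?mulr0 // size_drop ltn_subRL.
by apply: leq_ltn_trans mns; rewrite leq_add2r.
Qed.

Fact cochain_diff_subproof (f : cochain) : cobar_diff f \in is_cochain.
Proof.
case: f => [f /= /asboolP[fP [m fb]]].
apply/asboolP; split; first exact: multilinear_diff.
exists m.+1 => s ms; rewrite /cobar_diff big1 // => i _.
rewrite fb ?mulr0 // /merge_at size_cat /= size_take size_drop.
have lis : (i.+1 < size s)%N by case: (size s) i => [|n] [i /=] //; rewrite ltnS.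
rewrite (ltn_trans _ lis) // addnS.
by rewrite -(subnKC lis) addSn ltnS in ms.
Qed.

Fact cochain_twist_subproof (f : cochain) : parity_twist f \in is_cochain.
Proof.
case: f => [f /= /asboolP[fP [m fb]]].
apply/asboolP; split; first exact: multilinear_twist.
by exists m => s ms; rewrite /parity_twist fb // mulr0.
Qed.

Definition cochain_one := Cochain cochain_one_subproof.
Definition cochain_mul (f g : cochain) := Cochain (cochain_mul_subproof f g).
Definition cochain_diff (f : cochain) := Cochain (cochain_diff_subproof f).
Definition cochain_twist (f : cochain) := Cochain (cochain_twist_subproof f).

Fact cochain_mulA : associative cochain_mul.
Proof. by move=> f g h; apply/val_inj/convA. Qed.

Fact cochain_mul1l : left_id cochain_one cochain_mul.
Proof. by move=> f; apply/val_inj/conv1l. Qed.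

Fact cochain_mul1r : right_id cochain_one cochain_mul.
Proof. by move=> f; apply/val_inj/conv1r. Qed.

Fact cochain_mulDl : left_distributive cochain_mul +%R.
Proof. by move=> f g h; apply/val_inj/funext => s; apply: convDl. Qed.

Fact cochain_mulDr : right_distributive cochain_mul +%R.
Proof. by move=> f g h; apply/val_inj/funext => s; apply: convDr. Qed.

Fact cochain_one_neq0 : cochain_one != 0.
Proof.
apply/eqP => /(congr1 val)/(congr1 (fun f => f [::])) /eqP.
by apply/negP/oner_neq0.
Qed.

HB.instance Definition _ := GRing.Zmodule_isNzRing.Build cochain
  cochain_mulA cochain_mul1l cochain_mul1r cochain_mulDl cochain_mulDr
  cochain_one_neq0.

Fact cochain_scaleAl (c : k) (f g : cochain) : c *: (f * g) = (c *: f) * g.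
Proof. by apply/val_inj/funext => s; rewrite /= convZl. Qed.

HB.instance Definition _ :=
  GRing.Lmodule_isLalgebra.Build k cochain cochain_scaleAl.

Fact cochain_scaleAr (c : k) (f g : cochain) : c *: (f * g) = f * (c *: g).
Proof. by apply/val_inj/funext => s; rewrite /= convZr. Qed.

HB.instance Definition _ :=
  GRing.Lalgebra_isAlgebra.Build k cochain cochain_scaleAr.

Fact cochain_diff_linear : linear cochain_diff.
Proof.
move=> c f g; apply/val_inj/funext => s.
by rewrite /= cobar_diffD cobar_diffZ.
Qed.

HB.instance Definition _ :=
  GRing.isLinear.Build k cochain cochain *:%R cochain_diff cochain_diff_linear.

Lemma cochain_diffM (f g : cochain) :
  cochain_diff (f * g) = cochain_diff f * g + cochain_twist f * cochain_diff g.
Proof. by apply/val_inj/funext => s; apply: cobar_diff_conv. Qed.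

Lemma cochain_diff1 : cochain_diff 1 = 0.
Proof. by apply/val_inj/funext => s; apply: cobar_diff_one. Qed.

Lemma cochain_twistK : involutive cochain_twist.
Proof. by move=> f; apply/val_inj/parity_twistK. Qed.

Lemma cochain_diff_twist (f : cochain) :
  cochain_diff (cochain_twist f) = - cochain_twist (cochain_diff f).
Proof. by apply/val_inj/funext => s; apply: cobar_diff_twist. Qed.

Lemma cochain_twist0 : cochain_twist 0 = 0.
Proof. by apply/val_inj/funext => s; apply: mulr0. Qed.

Lemma cochain_diffK (f : cochain) : cochain_diff (cochain_diff f) = 0.
Proof. by apply/val_inj/funext => s; apply: cobar_diffK. Qed.

Definition is_cocycle : {pred cochain} := fun f => cochain_diff f == 0.

Fact is_cocycle_subalg : GRing.subalg_closed is_cocycle.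
Proof.
split=> [|c f g|f g]; rewrite !unfold_in ?cochain_diff1 //.
  by move=> /eqP f0 /eqP g0; rewrite cochain_diff_linear f0 g0 scaler0 addr0.
by move=> /eqP f0 /eqP g0; rewrite cochain_diffM f0 g0 mul0r mulr0 addr0.
Qed.

HB.instance Definition _ :=
  GRing.isSubalgClosed.Build k cochain is_cocycle is_cocycle_subalg.

Record cocycle := Cocycle { cocycle_val :> cochain; _ : cocycle_val \in is_cocycle }.

HB.instance Definition _ := [isSub for cocycle_val].
HB.instance Definition _ := [Choice of cocycle by <:].
HB.instance Definition _ := [SubChoice_isSubAlgebra of cocycle by <:].

Definition is_coboundary : {pred cocycle} :=
  fun z => `[< exists h : cochain, cocycle_val z = cochain_diff h >].

Fact is_coboundary_two_sided : two_sided_ideal_closed is_coboundary.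
Proof.
split.
- apply/negP => /asboolP[h] /(congr1 val)/(congr1 (fun f => f [::])) /= /eqP.
  by rewrite cobar_diff_nil; apply/negP/oner_neq0.
- split=> [|z1 z2 /asboolP[h1 e1] /asboolP[h2 e2]]; apply/asboolP.
    by exists 0; rewrite linear0.
  by exists (h1 - h2); rewrite linearB /= -e1 -e2.
- move=> [a za] u /asboolP[h e]; apply/asboolP; have /eqP a0 := za.
  exists (cochain_twist a * h).
  by rewrite cochain_diffM cochain_diff_twist a0 cochain_twist0 oppr0 mul0r
    add0r cochain_twistK -e.
- move=> [a za] u /asboolP[h e]; apply/asboolP; have /eqP a0 := za.
  by exists (h * a); rewrite cochain_diffM a0 mulr0 addr0 -e.
Qed.

Definition coboundary_ideal := TwoSidedIdeal is_coboundary_two_sided.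

(* When A is the direct sum of k and I, this is Ext_A(k, k) with the Yoneda   *)
(* product, computed by the reduced cobar complex.                            *)
Definition cohomology := alg_quot coboundary_ideal.

HB.instance Definition _ := GRing.Algebra.on cohomology.

Definition cohom_homog (n : nat) (e : cohomology) : Prop :=
  exists2 z : cocycle, (forall s : seq V, size s != n -> z s = 0)
    & aq_pi coboundary_ideal z = e.

End Cobar.

(* p lies in the component of degree n of R[X], for the grading extending the *)
(* one on R and giving degree d to X.                                         *)
Definition poly_homog (R : nzRingType) (homog : nat -> R -> Prop) (d n : nat)
    (p : {poly R}) : Prop :=
  forall i : nat,
    if (d * i <= n)%N then homog (n - d * i)%N p`_i else p`_i = 0.

Section FominKirillov.
Variable k : fieldType.

Local Notation i0 := (@Ordinal 3 0 isT).
Local Notation i1 := (@Ordinal 3 1 isT).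
Local Notation i2 := (@Ordinal 3 2 isT).

Definition fk_relations : seq (free_alg k 3) :=
  let a := free_var k i0 in
  let b := free_var k i1 in
  let c := free_var k i2 in
  [:: a * a; b * b; c * c; a * b + b * c + c * a; b * a + c * b + a * c].

Definition braided_sym_relations : seq (free_alg k 3) :=
  [seq free_var k (s i0) * free_var k (s i1)
       - free_var k (s i2) * free_var k (s i0) | s : 'S_3].

Fact free_varM_aug (i j : 'I_3) :
  free_var k i * free_var k j \in free_aug_ideal k 3.
Proof. by apply: idealMr; apply: free_var_aug. Qed.

Fact fk_relations_aug : all [in free_aug_ideal k 3] fk_relations.
Proof.
have XX := free_varM_aug.
apply/allP => r; rewrite !inE.
do ![case/predU1P=> [->|]]; last move/eqP->; rewrite ?XX //.
  by apply: rpredD => //; apply: rpredD.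
by apply: rpredD => //; apply: rpredD.
Qed.

Fact braided_sym_relations_aug :
  all [in free_aug_ideal k 3] braided_sym_relations.
Proof.
apply/allP => _ /mapP[s _ ->]; apply: rpredB; exact: free_varM_aug.
Qed.

Definition fk_alg := presented (Relators fk_relations_aug).

Definition fk_aug_ideal : twoSidedIdeal fk_alg :=
  pres_aug_ideal (Relators fk_relations_aug).

Definition fk_cohomology := cohomology fk_aug_ideal.

Definition fk_cohom_homog (n : nat) (e : fk_cohomology) : Prop :=
  cohom_homog n e.

Definition braided_sym := presented (Relators braided_sym_relations_aug).

Definition braided_sym_homog (n : nat) (x : braided_sym) : Prop :=
  pres_homog n x.

HB.instance Definition _ := GRing.Algebra.on fk_alg.
HB.instance Definition _ := GRing.Algebra.on fk_cohomology.
HB.instance Definition _ := GRing.Algebra.on braided_sym.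

End FominKirillov.

(* Main.v *)
(* S is the monoid algebra of the rack monoid of the three reflections of S_3,  *)
(* and K = S (x) B^* carries the Koszul differential d. An explicit contracting *)
(* homotopy with coefficients 0, 1, -1 shows that the cohomology of K consists  *)
(* of one line in level 0, spanned by iota, and one line in level 3, spanned by *)
(* omega. In the complex of cobar cochains of B with values in K, with total    *)
(* differential D, omega extends to a cochain Y with D Y = iota X, where X is a *)
(* cocycle of degree 4. Each level of K is a cofree B-module, so the cohomology *)
(* of this total complex is S; descending along the levels of K yields an exact *)
(* sequence 0 -> E(B) -> E(B) -> S -> 0 whose first map is multiplication by X. *)
(* The classes of degree 1 satisfy the relations of S, which splits it, and X   *)
(* commutes with them, so that E(B) = S[X].                                     *)

Require Import Defs.
From HB Require Import structures.
From mathcomp Require Import all_boot all_order all_algebra perm.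
From mathcomp Require Import boolp functions.
From mathcomp Require Import finmap monalg generic_quotient zify.

Set Implicit Arguments.
Unset Strict Implicit.
Unset Printing Implicit Defensive.

Import GRing.Theory.
Local Open Scope ring_scope.

(** * Words in free algebras and evaluation *)

(** Regard the dual of B as a right B-module by (f v)(w) = f(v w), and let K = S (x) B^* carry the
    B-linear differential sending s (x) f to the sum over the generators x of xs (x) f(- x). The
    S-degree is called the level. The proof computes in two ways the total complex of cobar cochains
    of B with values in K, whose differential D is the cobar differential plus the sign-twisted d.

    Along B, each level is a cofree module. Hence every cocycle can be moved to one supported on the
    empty list, with an invariant value ([cofree_reduce]), and the invariants form a copy of S
    ([invariant_words]). The total cohomology is therefore S.

    Along K, an explicit homotopy shows that the d-cohomology is spanned by iota, which is 1 (x)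
    epsilon in level 0, and by omega in level 3 ([fk_kap_htpy]). A staircase of corrections turns
    omega into [yoneda], with D [yoneda] = iota X for a cocycle X of degree 4 ([total_diff_yoneda]).
    Lowering levels step by step ([descent_step]) shows that iota f bounds only if f is, up to a
    coboundary, a multiple of X ([exact_mid]), and that a multiple of [yoneda] can be cohomologous
    to a multiple of iota only if its coefficient is a coboundary ([exact_left]).

    The two computations meet because multiplying a cocycle on the right by a class of degree 1
    amounts, modulo D, to right multiplication by a generator of S ([incl_conv_cochain1]). So the
    map from E(B) to S takes words in these classes to the same words of S ([incl_words]). It is
    onto, its kernel is E(B) X, and surjectivity forces multiplication by X to be injective
    ([mul_yoneda_inj]). A relation of S holds in E(B) modulo X; having degree 2 < 4, it holds
    exactly ([relation_holds]), and S embeds in E(B). The commutator of X with a class of degree 1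
    is represented by a multiple gX in which only the degree 1 part of g matters, and that part is
    computed to be 0 ([yoneda_commute]). Thus E(B) = S + E(B) X is a direct sum with X central and
    regular, and induction on the degree gives S[X] ([graded_polynomial_iso]).

    The finite facts about B and K are identities between sparse integer tables, decided by
    computation and then mapped to the field. *)

Section FreeAlgebraEval.
Variables (k : fieldType) (n : nat).
Local Notation F := (free_alg k n).

Definition word (w : seq 'I_n) : F := \prod_(i <- w) free_var k i.

Lemma word_nil : word [::] = 1.
Proof. exact: big_nil. Qed.

Lemma word_cons i w : word (i :: w) = free_var k i * word w.
Proof. exact: big_cons. Qed.

Lemma word_pair i j : word [:: i; j] = free_var k i * free_var k j.
Proof. by rewrite !word_cons word_nil mulr1. Qed.

Lemma word_monom (w : seq 'I_n) : word w = << FMonom w >>.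
Proof.
elim: w => [|i w IHw]; first by rewrite word_nil -fmoneE.
rewrite word_cons IHw /free_var [LHS]fgmulUU mul1r.
by rewrite [mmul _ _]fmmulE fmuE.
Qed.

Lemma free_alg_words (u : F) : u = \sum_(m <- msupp u) u@_m *: word m.
Proof.
rewrite {1}[u]monalgE; apply: eq_bigr => m _.
apply/malgP => m'; rewrite word_monom fmK mcoeffZ !mcoeffU.
by case: eqP; rewrite ?mulr1 ?mulr0.
Qed.

Lemma mcoeff_word (w : seq 'I_n) m : (word w)@_m = (w == m :> seq 'I_n)%:R.
Proof. by rewrite word_monom mcoeffU1 fmP. Qed.

Lemma word_homog_word (w : seq 'I_n) : word_homog (size w) (word w).
Proof. by move=> m; rewrite mcoeff_word; case: (w =P m :> seq _) => [-> //|_]; rewrite eqxx. Qed.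

Variables (T : algType k) (g : 'I_n -> T).

Definition monom_eval (m : {fmonom 'I_n}) : T := \prod_(i <- m) g i.

Definition free_eval (u : F) : T := mmap (in_alg T) monom_eval u.

Fact monom_eval_mmorphism : mmorphism monom_eval.
Proof.
split=> [x y|]; rewrite /monom_eval; last by rewrite [mone]fmoneE big_nil.
by rewrite [mmul _ _]fmmulE big_cat.
Qed.

HB.instance Definition _ :=
  isMultiplicative.Build _ _ monom_eval monom_eval_mmorphism.

Fact free_eval_zmod : zmod_morphism free_eval.
Proof. exact: raddfB. Qed.
HB.instance Definition _ := GRing.isZmodMorphism.Build F T free_eval free_eval_zmod.

Fact free_eval_monoid : monoid_morphism free_eval.
Proof.
have [fM f1] := @commr_mmap_is_multiplicative _ _ _ (in_alg T) monom_eval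
  (fun g m m' => GRing.comm_alg _ _).
by split.
Qed.
HB.instance Definition _ :=
  GRing.isMonoidMorphism.Build F T free_eval free_eval_monoid.

Fact free_eval_scalable : scalable free_eval.
Proof. by move=> c u; rewrite /free_eval mmapZ /= mulr_algl. Qed.
HB.instance Definition _ :=
  GRing.isScalable.Build k F T *:%R free_eval free_eval_scalable.

Lemma free_eval_var i : free_eval (free_var k i) = g i.
Proof. by rewrite /free_eval mmapU /= scale1r mul1r /monom_eval fmuE big_seq1. Qed.

Lemma free_eval_word (w : seq 'I_n) : free_eval (word w) = \prod_(i <- w) g i.
Proof. by rewrite rmorph_prod; apply: eq_bigr => i _; exact: free_eval_var. Qed.

End FreeAlgebraEval.

Lemma free_alg_ind (k : fieldType) (n : nat) (Q : free_alg k n -> Prop) :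
    (forall w, Q (word k w)) -> Q 0 ->
    (forall c u v, Q u -> Q v -> Q (c *: u + v)) ->
  forall u, Q u.
Proof.
move=> Qw Q0 Ql u; rewrite [u]free_alg_words.
elim: (msupp u : seq _) => [|m r IHr]; first by rewrite big_nil.
by rewrite big_cons; apply: Ql.
Qed.

Section PresentedEval.
Variables (k : fieldType) (n : nat) (P : relators k n) (T : algType k).
Variables (g : 'I_n -> T) (gP : forall r, r \in (P : seq _) -> free_eval g r = 0).
Local Notation pi := (aq_pi (relator_ideal P)).

Lemma free_eval_relator_ideal (u : free_alg k n) :
  u \in relator_ideal P -> free_eval g u = 0.
Proof.
(* The kernel of the evaluation is one of the two-sided ideals over which the relator ideal is an
   intersection. *)
pose J : {pred free_alg k n} := fun u => free_eval g u == 0.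
have JP : two_sided_ideal_closed J.
  split.
  - by rewrite unfold_in /J rmorph1 oner_eq0.
  - split=> [|x y]; rewrite !unfold_in /J ?raddf0 // => /eqP x0 /eqP y0.
    by rewrite raddfB /= x0 y0 subrr.
  - by move=> a x; rewrite !unfold_in /J rmorphM /= => /eqP->; rewrite mulr0.
  - by move=> a x; rewrite !unfold_in /J rmorphM /= => /eqP->; rewrite mul0r.
move=> /asboolP/(_ (TwoSidedIdeal JP)) uJ; apply/eqP/uJ => r rP.
by rewrite unfold_in; apply/eqP/gP.
Qed.

Definition pres_eval of (forall r, r \in (P : seq _) -> free_eval g r = 0) :=
  fun x : presented P => free_eval g (repr x).
Local Notation ev := (pres_eval gP).

Lemma pres_eval_pi (u : free_alg k n) : ev (pi u) = free_eval g u.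
Proof.
apply/eqP; rewrite -subr_eq0 -raddfB /=; apply/eqP/free_eval_relator_ideal.
by apply/aq_piP; rewrite aq_reprK.
Qed.

Fact pres_eval_zmod : zmod_morphism ev.
Proof.
move=> x y; rewrite -[x]aq_reprK -[y]aq_reprK -raddfB !pres_eval_pi.
exact: raddfB.
Qed.
HB.instance Definition _ := GRing.isZmodMorphism.Build (presented P) T ev pres_eval_zmod.

Fact pres_eval_monoid : monoid_morphism ev.
Proof.
split=> [|x y]; first by rewrite -(rmorph1 pi) pres_eval_pi rmorph1.
rewrite -[x]aq_reprK -[y]aq_reprK -rmorphM !pres_eval_pi.
exact: rmorphM.
Qed.
HB.instance Definition _ :=
  GRing.isMonoidMorphism.Build (presented P) T ev pres_eval_monoid.

Fact pres_eval_scalable : scalable ev.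
Proof.
move=> c x; rewrite -[x]aq_reprK -linearZ !pres_eval_pi.
exact: linearZ.
Qed.
HB.instance Definition _ :=
  GRing.isScalable.Build k (presented P) T *:%R ev pres_eval_scalable.

Lemma pi_relator (r : free_alg k n) : r \in (P : seq _) -> pi r = 0.
Proof.
move=> rP; rewrite -(raddf0 pi); apply/aq_piP; rewrite subr0.
by apply/asboolP => J PJ; apply: PJ.
Qed.

End PresentedEval.

Lemma pres_ind (k : fieldType) (n : nat) (P : relators k n)
    (Q : presented P -> Prop) :
    (forall w, Q (aq_pi (relator_ideal P) (word k w))) -> Q 0 ->
    (forall c u v, Q u -> Q v -> Q (c *: u + v)) ->
  forall u, Q u.
Proof.
move=> Qw Q0 Ql x; rewrite -[x]aq_reprK; move: (repr x).
apply: free_alg_ind => // [|c u v Qu Qv]; first by rewrite raddf0.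
by rewrite linearP; apply: Ql.
Qed.

Section LinearExtension.
Variables (k : fieldType) (n : nat) (U : lmodType k) (phi : seq 'I_n -> U).
Local Notation F := (free_alg k n).

Definition lin_ext (u : F) : U := \sum_(m <- msupp u) u@_m *: phi m.

Lemma lin_extEw (E : {fset {fmonom 'I_n}}) (u : F) : fsubset (msupp u) E ->
  lin_ext u = \sum_(m <- E) u@_m *: phi m.
Proof.
move=> uE; rewrite /lin_ext (big_fset_incl _ uE) // => m _ /mcoeff_outdom->.
by rewrite scale0r.
Qed.

Fact lin_ext_linear : linear lin_ext.
Proof.
move=> c u v; pose E := fsetU (msupp u) (msupp v).
rewrite (@lin_extEw E u) ?fsubsetUl // (@lin_extEw E v) ?fsubsetUr //.
rewrite (@lin_extEw E); last first.
  apply: fsubset_trans (msuppD_le _ _) _.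
  by apply: fsetSU; apply: msuppZ_le.
rewrite scaler_sumr -big_split; apply: eq_bigr => m _ /=.
by rewrite mcoeffD mcoeffZ scalerDl scalerA.
Qed.
HB.instance Definition _ := GRing.isLinear.Build k F U *:%R lin_ext lin_ext_linear.

Lemma lin_ext_word (w : seq 'I_n) : lin_ext (word k w) = phi w.
Proof.
rewrite /lin_ext word_monom msuppU1 big_seq_fset1 mcoeffU1 eqxx scale1r.
by [].
Qed.

End LinearExtension.

(** * Cobar cochains with values in a module *)

Section ModuleCochains.
Variables (k : fieldType) (A : algType k) (I : twoSidedIdeal A).
Local Notation V := (ideal_type I).
Local Notation sh x F := (fun t => F (x :: t)).

Section Valued.
Variable U : lmodType k.
Implicit Types (f : seq V -> k^o) (F G : seq V -> U).

Definition multilinear_val F := forall (s1 s2 : seq V) (c : k) (x y : V),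
  F (s1 ++ (c *: x + y) :: s2) = c *: F (s1 ++ x :: s2) + F (s1 ++ y :: s2).

Definition bounded_val F := exists L : nat, forall s, (L < size s)%N -> F s = 0.

Definition twist F : seq V -> U := fun s => (-1) ^+ size s *: F s.

(** This makes module-valued cochains a left module over the cobar algebra; it is the formula of
    [conv] with scalar multiplication. *)
Definition mconv f F : seq V -> U :=
  fun s => \sum_(i < (size s).+1) (f (take i s) : k) *: F (drop i s).

(** The element [n] seen as a cochain of cobar degree 0. *)
Definition pt (n : U) : seq V -> U := fun s => if s is [::] then n else 0.

Lemma mconv_nil f F : mconv f F [::] = (f [::] : k) *: F [::].
Proof. by rewrite /mconv big_ord1. Qed.

Lemma mconv_cons f F x s :
  mconv f F (x :: s) = (f [::] : k) *: F (x :: s) + mconv (sh x f) F s.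
Proof. by rewrite /mconv /= big_ord_recl. Qed.

Lemma mconvDl f g F : mconv (f + g) F = mconv f F + mconv g F.
Proof.
apply/funext => s; rewrite -[RHS]/(mconv f F s + mconv g F s).
elim: s f g F => [|x s IHs] f g F; first by rewrite !mconv_nil scalerDl.
rewrite !mconv_cons -[sh x (f + g)]/(sh x f + sh x g) IHs scalerDl -!addrA.
by congr (_ + _); rewrite addrCA.
Qed.

Lemma mconvZl c f F : mconv (c *: f) F = c *: mconv f F.
Proof.
apply/funext => s; rewrite -[RHS]/(c *: mconv f F s).
elim: s f => [|x s IHs] f; first by rewrite !mconv_nil scalerA.
by rewrite !mconv_cons -[sh x (c *: f)]/(c *: sh x f) IHs scalerDr scalerA.
Qed.

Lemma mconvDr f F G : mconv f (F + G) = mconv f F + mconv f G.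
Proof.
apply/funext => s; rewrite -[RHS]/(mconv f F s + mconv f G s).
elim: s f => [|x s IHs] f; first by rewrite !mconv_nil scalerDr.
rewrite !mconv_cons IHs scalerDr -!addrA.
by congr (_ + _); rewrite addrCA.
Qed.

Lemma mconv_pt f n : mconv f (pt n) = fun s => (f s : k) *: n.
Proof.
apply/funext => s; elim: s f => [|x s IHs] f; first by rewrite mconv_nil.
by rewrite mconv_cons IHs scaler0 add0r.
Qed.

Lemma twistK : involutive twist.
Proof. by move=> F; apply/funext => s; rewrite /twist scalerA -expr2 sqrr_sign scale1r. Qed.

Lemma twist_lin c F G : twist (c *: F + G) = c *: twist F + twist G.
Proof.
apply/funext => s; rewrite -[LHS]/((-1) ^+ size s *: (c *: F s + G s)) scalerDr !scalerA mulrC.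
by rewrite -[RHS]/(c *: twist F s + twist G s) -scalerA.
Qed.

Lemma twist_mconv f F : twist (mconv f F) = mconv (parity_twist f) (twist F).
Proof.
apply/funext => s; rewrite /twist /mconv scaler_sumr; apply: eq_bigr => i _.
rewrite /parity_twist !scalerA mulrAC -exprD -size_cat cat_take_drop.
by congr (_ *: _).
Qed.

Lemma multilinear_val_lin c F G :
  multilinear_val F -> multilinear_val G -> multilinear_val (c *: F + G).
Proof.
move=> FP GP s1 s2 e x y.
rewrite -![(c *: F + G) _]/(c *: F _ + G _) FP GP.
by rewrite !scalerDr !scalerA [e * c]mulrC !addrA [X in X + _]addrAC.
Qed.

Lemma bounded_val_lin c F G :
  bounded_val F -> bounded_val G -> bounded_val (c *: F + G).
Proof.
move=> [m Fb] [n Gb]; exists (maxn m n) => s; rewrite gtn_max => /andP[ms ns].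
by rewrite -[LHS]/(c *: F s + G s) Fb // Gb // scaler0 addr0.
Qed.

Lemma multilinear_val_sh F x : multilinear_val F -> multilinear_val (sh x F).
Proof. by move=> FP s1 s2 c y z; rewrite -!cat_cons FP. Qed.

Lemma multilinear_val_twist F : multilinear_val F -> multilinear_val (twist F).
Proof.
move=> FP s1 s2 c x y; rewrite /twist FP scalerDr !size_cat /=.
by congr (_ + _); rewrite !scalerA mulrC.
Qed.

Lemma bounded_val_twist F : bounded_val F -> bounded_val (twist F).
Proof. by move=> [m Fb]; exists m => s ms; rewrite /twist Fb // scaler0. Qed.

Lemma multilinear_val_mconv f F :
  multilinear_on_lists f -> multilinear_val F -> multilinear_val (mconv f F).
Proof.
move=> fP gP s1 s2 c x y; elim: s1 f fP => [|z s1 IHs] f fP /=.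
  rewrite !mconv_cons multilinear_sh_lin // mconvDl mconvZl (gP [::]) /=.
  rewrite -[(c *: _ + _) s2]/(c *: mconv _ F s2 + mconv _ F s2).
  rewrite !scalerDr -!addrA; congr (_ + _); first by rewrite !scalerA mulrC.
  by rewrite addrCA.
rewrite !mconv_cons IHs; last exact: multilinear_sh.
rewrite -!cat_cons gP !scalerDr -!addrA.
congr (_ + _); first by rewrite !scalerA mulrC.
by rewrite addrCA.
Qed.

Lemma bounded_val_mconv f F :
  bounded_degree f -> bounded_val F -> bounded_val (mconv f F).
Proof.
move=> [m fb] [n Fb]; exists (m + n)%N => s mns; rewrite /mconv big1 // => i _.
case: (ltnP m i) => im.
  rewrite fb ?scale0r // size_take; case: (ltnP i (size s)) => // _.
  exact: leq_ltn_trans (leq_addr n m) mns.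
rewrite Fb ?scaler0 // size_drop ltn_subRL.
by apply: leq_ltn_trans mns; rewrite leq_add2r.
Qed.

Lemma multilinear_val_pt n : multilinear_val (pt n).
Proof. by move=> [|z s1] s2 c x y; rewrite /= scaler0 addr0. Qed.

Lemma bounded_val_pt n : bounded_val (pt n).
Proof. by exists 0%N => -[]. Qed.

End Valued.

Lemma multilinear_val_comp (U W : lmodType k) (h : {linear U -> W}) F :
  multilinear_val F -> multilinear_val (fun s => h (F s)).
Proof. by move=> FP s1 s2 c x y; rewrite FP linearP. Qed.

Lemma bounded_val_comp (U W : lmodType k) (h : {linear U -> W}) F :
  bounded_val F -> bounded_val (fun s => h (F s)).
Proof. by move=> [L FL]; exists L => s Ls; rewrite FL ?linear0. Qed.

Lemma mconv_comp (U W : lmodType k) (h : {linear U -> W}) f F s :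
  h (mconv f F s) = mconv f (fun t => h (F t)) s.
Proof. by rewrite raddf_sum; apply: eq_bigr => i _; exact: linearZZ. Qed.

(** * The cobar differential with coefficients in a right module *)

Section Differential.
Variables (N : lmodType k) (act : V -> {linear N -> N}).
Hypothesis act_lin :
  forall c u v n, act (c *: u + v) n = c *: act u n + act v n.
Hypothesis actM : forall u v n, act (ideal_mul u v) n = act v (act u n).
Implicit Types (f : seq V -> k^o) (F G : seq V -> N).

(* The cobar differential with values in N; as the action composes in reverse  *)
(* order, the last argument is the one that acts on the value.                *)
Fixpoint mdiff F (s : seq V) : N :=
  if s is x :: s' then
    if s' is y :: s'' then - F (ideal_mul x y :: s'') - mdiff (sh x F) s'
    else - act x (F [::])
  else 0.

Lemma mdiff_cons2 F x y s :
  mdiff F [:: x, y & s] = - F (ideal_mul x y :: s) - mdiff (sh x F) (y :: s).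
Proof. by []. Qed.

Lemma mdiff_lin_s c F G s : mdiff (c *: F + G) s = c *: mdiff F s + mdiff G s.
Proof.
elim: s F G => [|x s IHs] F G; first by rewrite scaler0 addr0.
case: s IHs => [|y s] IHs.
  by rewrite /= -[(c *: F + G) _]/(c *: F _ + G _) linearP opprD scalerN.
rewrite !mdiff_cons2 -[sh x (c *: F + G)]/(c *: sh x F + sh x G) IHs.
rewrite -[(c *: F + G) _]/(c *: F _ + G _) scalerBr scalerN !opprD -!addrA.
by congr (_ + _); rewrite addrCA.
Qed.

Lemma mdiff_lin c F G : mdiff (c *: F + G) = c *: mdiff F + mdiff G.
Proof. by apply/funext => s; apply: mdiff_lin_s. Qed.

Lemma mdiff0 : mdiff 0 = 0.
Proof. by have := mdiff_lin (-1) 0 0; rewrite scaler0 addr0 scaleN1r addNr. Qed.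

Lemma mdiffZ c F : mdiff (c *: F) = c *: mdiff F.
Proof. by rewrite -[c *: F]addr0 mdiff_lin mdiff0 addr0. Qed.

Lemma mdiffD F G : mdiff (F + G) = mdiff F + mdiff G.
Proof. by rewrite -[F]scale1r mdiff_lin !scale1r. Qed.

Lemma mdiffN F : mdiff (- F) = - mdiff F.
Proof. by rewrite -scaleN1r mdiffZ scaleN1r. Qed.

Lemma mdiff_comp (h : {linear N -> N}) F :
  (forall v n, h (act v n) = act v (h n)) ->
  mdiff (fun s => h (F s)) = fun s => h (mdiff F s).
Proof.
move=> hact; apply/funext => s; elim: s F => [|x s IHs] F; first by rewrite linear0.
case: s IHs => [|y s] IHs; first by rewrite /= linearN hact.
by rewrite !mdiff_cons2 (IHs (sh x F)) linearB linearN.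
Qed.

Lemma sh_twist (U : lmodType k) (F : seq V -> U) x :
  sh x (twist F) = -1 *: twist (sh x F).
Proof.
apply/funext => s; rewrite -[RHS]/(-1 *: (_ *: F (x :: s))).
by rewrite /twist scalerA /= exprS.
Qed.

Lemma mdiff_twist F : mdiff (twist F) = - twist (mdiff F).
Proof.
apply/funext => s; rewrite -[RHS]/(- (_ *: mdiff F s)).
elim: s F => [|x s IHs] F; first by rewrite scaler0 oppr0.
case: s IHs => [|y s] IHs.
  by rewrite /= /twist /= !expr1 !scaleN1r scale1r opprK.
rewrite !mdiff_cons2 sh_twist mdiffZ.
rewrite -[(_ *: mdiff _) (y :: s)]/(-1 *: mdiff (twist (sh x F)) (y :: s)) IHs.
rewrite /twist /= !exprS !mulN1r !scaleNr scale1r !opprK.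
by rewrite -opprD scalerN opprK scalerDr.
Qed.

Lemma mdiffK F : mdiff (mdiff F) = 0.
Proof.
apply/funext => s; rewrite -[RHS]/(0 : N).
elim: s F => [|x [|y s] IHs] F //=; first by rewrite linear0 oppr0.
(* [E] collects the terms of [mdiff F] in which [x] is absorbed by what follows; the other terms
   form [mdiff] of the shifted cochain, to which the induction applies. *)
pose E t := if t is z :: u then F (ideal_mul x z :: u) else act x (F [::]).
rewrite -[LHS]/(- mdiff F (ideal_mul x y :: s) - mdiff (sh x (mdiff F)) (y :: s)).
have -> : sh x (mdiff F) = -1 *: (E + mdiff (sh x F)).
  apply/funext => -[|z u]; rewrite -[RHS]/(-1 *: (_ + _)).
    by rewrite scaleN1r addr0.
  by rewrite mdiff_cons2 scaleN1r opprD.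
rewrite mdiffZ mdiffD.
rewrite -[(_ *: (_ + _)) _]/(-1 *: (mdiff E (y :: s) + mdiff (mdiff _) (y :: s))).
rewrite IHs addr0 scaleN1r opprK.
case: s {IHs} => [|z s]; first by rewrite /= actM addrC subrr.
rewrite !mdiff_cons2 /=.
have -> : ideal_mul x (ideal_mul y z) = ideal_mul (ideal_mul x y) z.
  by apply: val_inj; rewrite /= mulrA.
by rewrite addNr.
Qed.

Lemma mdiff_local F s :
  (forall t, size t = (size s).-1 -> F t = 0) -> mdiff F s = 0.
Proof.
elim: s F => [|x [|y s] IHs] F F0 //; first by rewrite /= F0 // linear0 oppr0.
rewrite mdiff_cons2 F0 // oppr0 sub0r IHs ?oppr0 // => t ts.
by rewrite F0 //= ts.
Qed.

Lemma mdiff_mconv f F :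
  mdiff (mconv f F) = mconv (cobar_diff f) F + mconv (parity_twist f) (mdiff F).
Proof.
apply/funext => s; rewrite -[RHS]/(mconv _ F s + mconv _ _ s).
elim: s f => [|x s IHs] f.
  by rewrite !mconv_nil cobar_diff_nil scale0r scaler0 addr0.
case: s IHs => [|y s] IHs.
  rewrite !mconv_cons !mconv_nil /= !cobar_diff1 !cobar_diff_nil mconv_nil.
  by rewrite !scale0r scaler0 linearZ scalerN !add0r addr0 /parity_twist mul1r.
rewrite mdiff_cons2 mconv_cons.
have -> : sh x (mconv f F) = (f [::] : k) *: sh x F + mconv (sh x f) F.
  by apply/funext => t; rewrite mconv_cons.
rewrite mdiff_lin_s IHs.
rewrite [mconv (cobar_diff f) F _]mconv_cons cobar_diff_nil scale0r add0r.
rewrite [mconv (sh x (cobar_diff f)) F _]mconv_cons cobar_diff1 scale0r add0r.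
have -> : sh y (sh x (cobar_diff f)) =
    (-1 : k) *: (sh (ideal_mul x y) f + sh y (cobar_diff (sh x f))).
  by apply/funext => t; rewrite cobar_diff_cons2 scaleN1r opprD.
rewrite mconvZl mconvDl -[(-1 *: (_ + _)) s]/(-1 *: (mconv _ F s + mconv _ F s)).
rewrite [mconv (cobar_diff (sh x f)) F _]mconv_cons cobar_diff_nil scale0r add0r.
rewrite [mconv (parity_twist f) _ _]mconv_cons mdiff_cons2.
have -> : sh x (parity_twist f) = (-1 : k) *: parity_twist (sh x f).
  by apply/funext => t; rewrite /parity_twist /= exprS -mulrA.
have -> : parity_twist f [::] = f [::] by rewrite /parity_twist mul1r.
rewrite mconvZl -[(-1 *: mconv _ _) (y :: s)]/(-1 *: mconv _ _ _).
rewrite !scaleN1r scalerBr scalerN !opprD !addrA.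
by rewrite [RHS](ACl (3*1*4*2*5)).
Qed.

Lemma mdiff_pt n :
  mdiff (pt n) = fun s => if s is [:: v] then - act v n else 0.
Proof.
by apply/funext => -[|x [|y s]] //; rewrite mdiff_local // => -[].
Qed.

Lemma multilinear_val_mdiff F : multilinear_val F -> multilinear_val (mdiff F).
Proof.
move=> FP s1 s2 c x y; elim: s1 F FP => [|z s1 IHs] F FP /=.
  case: s2 => [|w s2]; first by rewrite act_lin opprD scalerN.
  have -> : sh (c *: x + y) F = c *: sh x F + sh y F.
    by apply/funext => t; apply: (FP [::]).
  rewrite mdiff_lin_s ideal_mulPl (FP [::]) /= scalerBr scalerN !opprD -!addrA.
  by congr (_ + _); rewrite addrCA.
have {}IHs := IHs _ (multilinear_val_sh z FP).
case: s1 IHs => [|w s1] /= IHs.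
  rewrite IHs ideal_mulPr (FP [::]) /= scalerBr scalerN !opprD -!addrA.
  by congr (_ + _); rewrite addrCA.
rewrite IHs -!cat_cons FP scalerBr scalerN !opprD -!addrA.
by congr (_ + _); rewrite addrCA.
Qed.

Lemma bounded_val_mdiff F : bounded_val F -> bounded_val (mdiff F).
Proof.
move=> [L FL]; exists L.+1 => s Ls; apply: mdiff_local => t ts.
by apply: FL; rewrite ts -ltnS prednK // (leq_trans _ Ls).
Qed.

End Differential.
End ModuleCochains.

(** * The total complex *)

(* N is a complex of modules with differential d; [lv i j n] means that n has   *)
(* components in levels i, ..., j only.                                         *)
Section KoszulTransfer.
Variables (k : fieldType) (A : algType k) (I : twoSidedIdeal A).
Local Notation V := (ideal_type I).
Local Notation sh x F := (fun t => F (x :: t)).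
Variables (N : lmodType k) (act : V -> {linear N -> N}).
Hypothesis act_lin :
  forall c u v n, act (c *: u + v) n = c *: act u n + act v n.
Hypothesis actM : forall u v n, act (ideal_mul u v) n = act v (act u n).
Variables (d : {linear N -> N}) (lv : nat -> nat -> N -> Prop).
Hypothesis dact : forall v n, d (act v n) = act v (d n).
Hypothesis dK : forall n, d (d n) = 0.
Hypothesis lv0 : forall i j, lv i j 0.
Hypothesis lv_lin :
  forall i j c n m, lv i j n -> lv i j m -> lv i j (c *: n + m).
Hypothesis lv_mono : forall i j i' j' n,
  (i' <= i)%N -> (j <= j')%N -> lv i j n -> lv i' j' n.
Hypothesis lv_act : forall i j v n, lv i j n -> lv i j (act v n).
Hypothesis lv_d : forall i j n, lv i j n -> lv i.+1 j.+1 (d n).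
Implicit Types (f g : seq V -> k^o) (F G : seq V -> N).
Local Notation mdiff := (mdiff act).

(** The twist by the cobar degree makes the two summands anticommute ([mdiff_twist]), so that the
    square is zero. *)
Definition total_diff F : seq V -> N := mdiff F + twist (fun s => d (F s)).
Local Notation D := total_diff.

Definition tot i j F :=
  [/\ multilinear_val F, bounded_val F & forall s, lv i j (F s)].

Lemma total_diffE F s : D F s = mdiff F s + (-1) ^+ size s *: d (F s).
Proof. by []. Qed.

Lemma total_diff_lin c F G : D (c *: F + G) = c *: D F + D G.
Proof.
rewrite /D mdiff_lin scalerDr -!addrA; congr (_ + _); rewrite addrCA.
rewrite -twist_lin; congr (_ + twist _); apply/funext => s.
exact: linearP.
Qed.

Lemma total_diff0 : D 0 = 0.
Proof. by have := total_diff_lin (-1) 0 0; rewrite scaler0 addr0 scaleN1r addNr. Qed.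

Lemma total_diffD F G : D (F + G) = D F + D G.
Proof. by rewrite -[F]scale1r total_diff_lin !scale1r. Qed.

Lemma total_diffN F : D (- F) = - D F.
Proof.
by have := total_diff_lin (-1) F 0; rewrite !scaleN1r total_diff0 !addr0.
Qed.

Lemma total_diffB F G : D (F - G) = D F - D G.
Proof. by rewrite total_diffD total_diffN. Qed.

Lemma total_diffK F : D (D F) = 0.
Proof.
rewrite /D mdiffD mdiffK // add0r mdiff_twist mdiff_comp; last by move=> *; rewrite dact.
apply/funext => s; rewrite -[LHS]/(- _ + (_ *: d (_ + _ *: _))) /twist.
by rewrite [d (_ + _)]linearD [d (_ *: _)]linearZZ dK scaler0 addr0 addNr.
Qed.

Lemma total_diff_mconv f F :
  D (mconv f F) = mconv (cobar_diff f) F + mconv (parity_twist f) (D F).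
Proof.
rewrite /D mdiff_mconv mconvDr addrA; congr (_ + _).
rewrite -twist_mconv; congr twist; apply/funext => s; exact: mconv_comp.
Qed.

Lemma total_diff_pt n s :
  D (pt n) s = match s with [::] => d n | [:: v] => - act v n | _ => 0 end.
Proof.
rewrite total_diffE mdiff_pt; case: s => [|v [|w s]] /=.
- by rewrite add0r scale1r.
- by rewrite linear0 scaler0 addr0.
- by rewrite linear0 scaler0 addr0.
Qed.

Lemma tot_lin i j c F G : tot i j F -> tot i j G -> tot i j (c *: F + G).
Proof.
move=> [F1 F2 F3] [G1 G2 G3]; split=> [||s].
- exact: multilinear_val_lin.
- exact: bounded_val_lin.
- exact: lv_lin.
Qed.

Lemma tot0 i j : tot i j 0.
Proof.
by split=> [||s]; [move=> *; rewrite /= scaler0 addr0 | exists 0%N | apply: lv0].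
Qed.

Lemma totD i j F G : tot i j F -> tot i j G -> tot i j (F + G).
Proof. by rewrite -[F]scale1r => *; apply: tot_lin => //; rewrite -[F]scale1r. Qed.

Lemma totN i j F : tot i j F -> tot i j (- F).
Proof. by move=> Ft; rewrite -[- F]addr0 -scaleN1r; apply/tot_lin/tot0. Qed.

Lemma totB i j F G : tot i j F -> tot i j G -> tot i j (F - G).
Proof. by move=> Ft Gt; apply/totD/totN. Qed.

Lemma tot_mono i j i' j' F :
  (i' <= i)%N -> (j <= j')%N -> tot i j F -> tot i' j' F.
Proof. by move=> ii jj [F1 F2 F3]; split=> // s; apply: lv_mono (F3 s). Qed.

Lemma tot_comp (h : {linear N -> N}) i j i' j' F :
  (forall n, lv i j n -> lv i' j' (h n)) -> tot i j F ->
  tot i' j' (fun s => h (F s)).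
Proof.
move=> hlv [F1 F2 F3]; split=> [||s]; last exact: hlv.
- exact: multilinear_val_comp.
- exact: bounded_val_comp.
Qed.

Lemma lvZ i j c n : lv i j n -> lv i j (c *: n).
Proof. by move=> ln; rewrite -[c *: n]addr0; apply: lv_lin. Qed.

Lemma lvD i j n m : lv i j n -> lv i j m -> lv i j (n + m).
Proof. by move=> ln lm; rewrite -[n]scale1r; apply: lv_lin. Qed.

Lemma lvN i j n : lv i j n -> lv i j (- n).
Proof. by rewrite -scaleN1r; apply: lvZ. Qed.

Lemma tot_twist i j F : tot i j F -> tot i j (twist F).
Proof.
move=> [F1 F2 F3]; split=> [||s].
- exact: multilinear_val_twist.
- exact: bounded_val_twist.
- exact: lvZ.
Qed.

Lemma lv_mdiff i j F s : (forall s, lv i j (F s)) -> lv i j (mdiff F s).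
Proof.
elim: s F => [|x [|y s] IHs] F Fl; first exact: lv0.
  by apply/lvN/lv_act.
by rewrite mdiff_cons2; apply: lvD; apply: lvN => //; apply: IHs.
Qed.

Lemma tot_mdiff i j F : tot i j F -> tot i j (mdiff F).
Proof.
move=> [F1 F2 F3]; split=> [||s].
- exact: multilinear_val_mdiff.
- exact: bounded_val_mdiff.
- exact: lv_mdiff.
Qed.

Lemma tot_pt i j n : lv i j n -> tot i j (pt n).
Proof.
move=> ln; split=> [||s].
- exact: multilinear_val_pt.
- exact: bounded_val_pt.
- by case: s.
Qed.

Lemma tot_mconv i j f F : f \in is_cochain (I := I) -> tot i j F -> tot i j (mconv f F).
Proof.
move=> /asboolP[f1 f2] [F1 F2 F3]; split=> [||s].
- exact: multilinear_val_mconv.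
- exact: bounded_val_mconv.
- by rewrite /mconv; elim/big_rec: _ => [|r x _]; [exact: lv0 | apply: lv_lin].
Qed.

Lemma tot_scalar (h : {linear N -> k^o}) i j F :
  tot i j F -> (fun s => h (F s)) \in is_cochain (I := I).
Proof.
move=> [F1 F2 _]; apply/asboolP; split.
- exact: multilinear_val_comp.
- exact: bounded_val_comp.
Qed.

Lemma tot_diff i j F : tot i j F -> tot i j.+1 (D F).
Proof.
move=> Ft; apply: totD.
  by apply: tot_mono (tot_mdiff Ft).
apply: tot_twist; apply: tot_comp Ft => n /lv_d.
exact: lv_mono.
Qed.

(* The hypotheses express that N is the cofree module Hom(A, T): ev is the      *)
(* evaluation at 1, and cof p is the map equal to p on I and to 0 at 1.         *)
Section Cofree.
Variables (T : lmodType k) (ev : {linear N -> T}) (cof : (V -> T) -> N).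
Hypothesis cof_lin :
  forall c p q, cof (fun v => c *: p v + q v) = c *: cof p + cof q.
Hypothesis ev_cof : forall p : V -> T, linear p -> ev (cof p) = 0.
Hypothesis ev_act_cof : forall (p : V -> T) v, linear p -> ev (act v (cof p)) = p v.
Hypothesis ev_inj : forall n, ev n = 0 -> (forall v, ev (act v n) = 0) -> n = 0.
Hypothesis lv_cof : forall i j (p : V -> N),
  (forall v, lv i j (p v)) -> lv i j (cof (fun v => ev (p v))).

Definition cofree_htpy F : seq V -> N :=
  fun s => cof (fun v => ev (F (rcons s v))).
Local Notation H := cofree_htpy.

Lemma linear_rcons F s : multilinear_val F -> linear (fun v => ev (F (rcons s v))).
Proof. by move=> FP c u v; rewrite -!cats1 FP linearP. Qed.

(** All terms that merge arguments are values of [cof], killed by [ev]; only the term where the last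
    argument acts survives, and it gives back [F s]. *)
Lemma ev_mdiff_htpy F s : multilinear_val F -> s != [::] ->
  ev (mdiff (H F) s) = (-1) ^+ size s *: ev (F s).
Proof.
elim: s F => [|x [|y s] IHs] F FP // _.
  by rewrite /= linearN ev_act_cof ?scaleN1r //; exact: (linear_rcons [::] FP).
rewrite mdiff_cons2 linearB linearN ev_cof ?oppr0 ?sub0r; last exact: linear_rcons.
rewrite -[X in - X]/(ev (mdiff (H (sh x F)) (y :: s))).
rewrite IHs //; last exact: multilinear_val_sh.
by rewrite [in RHS]exprS mulN1r scaleNr.
Qed.

(** Companion of [ev_mdiff_htpy] after an action. When [mdiff F] vanishes at [rcons s v], the two
    show that [mdiff (H F) s] and the signed [F s] have the same cofree coordinates. *)
Lemma ev_act_mdiff_htpy F s v : multilinear_val F -> s != [::] ->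
  ev (act v (mdiff (H F) s)) =
  ev (mdiff F (rcons s v)) + (-1) ^+ size s *: ev (act v (F s)).
Proof.
elim: s F => [|x [|y s] IHs] F FP // _.
  rewrite /= !linearN -actM ev_act_cof /=; last exact: (linear_rcons [::] FP).
  by rewrite opprK linearD linearN expr1 scaleN1r addrK.
rewrite [rcons _ _]/= !mdiff_cons2 [act v _]linearB [act v (- _)]linearN.
rewrite ![ev (_ - _)]linearB ![ev (- _)]linearN.
rewrite (ev_act_cof _ (linear_rcons (ideal_mul x y :: s) FP)).
rewrite -[act v (mdiff _ _)]/(act v (mdiff (H (sh x F)) (y :: s))).
rewrite IHs //; last exact: multilinear_val_sh.
rewrite opprD addrA /=; congr (_ + _).
by rewrite [in RHS]exprS mulN1r scaleNr.
Qed.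

Lemma tot_htpy i j F : tot i j F -> tot i j (H F).
Proof.
move=> [F1 [L FL] F3]; split=> [s1 s2 c x y||s].
- rewrite /H -cof_lin; congr cof; apply/funext => v.
  by rewrite !rcons_cat !rcons_cons F1 linearP.
- exists L => s Ls; rewrite /H (_ : (fun v => _) = fun _ => 0).
    have := cof_lin (-1) (fun=> 0) (fun=> 0).
    by rewrite scaler0 addr0 scaleN1r addNr.
  by apply/funext => v; rewrite FL ?linear0 // size_rcons ltnW.
- exact: lv_cof.
Qed.

Lemma htpy_local F L : (forall s, (L < size s)%N -> F s = 0) ->
  forall s, (L <= size s)%N -> H F s = 0.
Proof.
move=> FL s Ls; rewrite /H (_ : (fun v => _) = fun _ => 0).
  by have := cof_lin (-1) (fun=> 0) (fun=> 0); rewrite scaler0 addr0 scaleN1r addNr.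
by apply/funext => v; rewrite FL ?linear0 // size_rcons ltnS.
Qed.

(** Induction on the largest cobar degree of [F]. In that degree the condition on [D F] says that
    [F] is closed for [mdiff], so the cofree homotopy writes it as a boundary; subtracting [D] of
    this primitive lowers the bound. In degree 0 closedness is invariance. Requiring nothing of
    [D F] at the empty list allows [D F] to be a nonzero element of cobar degree 0. *)
Lemma cofree_reduce i j F : tot i j F -> (forall s, s != [::] -> D F s = 0) ->
  exists G n j', [/\ tot i j' G, lv i j' n, forall v, act v n = 0 & F = D G + pt n].
Proof.
move=> Ft; have [_ [L FL] _] := Ft.
elim: L j F FL Ft => [|L IHL] j F FL Ft DF0.
  exists 0, (F [::]), j; split; first exact: tot0.
  - by case: Ft.
  - move=> v; have := DF0 [:: v] isT; rewrite total_diffE (FL [:: v]) //.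
    by rewrite linear0 scaler0 addr0 /= => /eqP; rewrite oppr_eq0 => /eqP.
  - rewrite total_diff0 add0r; apply/funext => -[|x s] //.
    by rewrite FL.
pose G := - twist (H F).
have Gt : tot i j G by apply/totN/tot_twist/tot_htpy.
have DGt : tot i j.+1 (D G) := tot_diff Gt.
have HF0 := htpy_local FL.
have G0 s : (L < size s)%N -> G s = 0.
  by move=> Ls; rewrite /G -[LHS]/(- (_ *: H F s)) HF0 // scaler0 oppr0.
have DG s : (L < size s)%N -> D G s = F s.
  move=> Ls; rewrite total_diffE G0 // linear0 scaler0 addr0 /G mdiffN mdiff_twist.
  rewrite opprK; case: (ltnP L.+1 (size s)) => Ls1.
    rewrite FL // /twist mdiff_local ?scaler0 // => t ts.
    by apply: HF0; rewrite ts -ltnS prednK // (leq_trans _ Ls1).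
  have s0 : s != [::] by case: (s) Ls.
  have [F1 _ _] := Ft.
  have -> : F s = twist (fun t => (-1) ^+ size t *: F t) s.
    by rewrite /twist scalerA -expr2 sqrr_sign scale1r.
  rewrite /twist; congr (_ *: _); apply/eqP; rewrite -subr_eq0; apply/eqP.
  (* An element of a cofree module is determined by its evaluations at 1 before and after acting by
     each [v]. *)
  apply: ev_inj => [|v].
    by rewrite [ev _]linearB [ev (_ *: _)]linearZZ ev_mdiff_htpy // subrr.
  rewrite [act v _]linearB [act v (_ *: _)]linearZZ [ev _]linearB.
  rewrite [ev (_ *: _)]linearZZ ev_act_mdiff_htpy //.
  have := DF0 (rcons s v); rewrite total_diffE (FL (rcons s v)); last by rewrite size_rcons.
  rewrite linear0 scaler0 addr0 => ->; last by case: (s).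
  by rewrite linear0 add0r subrr.
have [|||G' [n [j' [G't nl n0 FE]]]] := IHL j.+1 (F - D G).
- by move=> s Ls; rewrite -[LHS]/(F s - D G s) DG // subrr.
- by apply: totB => //; apply: tot_mono Ft.
- by move=> s s0; rewrite total_diffB total_diffK subr0 DF0.
exists (G' + G), n, (maxn j j'); split=> //.
- by apply: totD; [apply: tot_mono G't; rewrite ?leq_maxr | apply: tot_mono Gt; rewrite ?leq_maxl].
- by apply: lv_mono nl; rewrite ?leq_maxr.
- by rewrite total_diffD addrAC -FE subrK.
Qed.

End Cofree.

Lemma mconvA f g F : mconv f (mconv g F) = mconv (conv f g) F.
Proof.
apply/funext => s; elim: s f g => [|x s IHs] f g.
  by rewrite !mconv_nil conv_nil scalerA.
rewrite [RHS]mconv_cons conv_nil.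
have -> : sh x (conv f g) = (f [::] : k) *: sh x g + conv (sh x f) g.
  by apply/funext => t; rewrite conv_cons.
rewrite mconvDl mconvZl -[(_ + _) s]/((f [::] : k) *: mconv _ F s + mconv _ F s) -IHs.
by rewrite addrA !mconv_cons scalerDr scalerA.
Qed.

Lemma tot_sub i j i' j' F : tot i j F -> (forall s, lv i' j' (F s)) -> tot i' j' F.
Proof. by move=> [F1 F2 _] F3; split. Qed.

(** * The class of degree 4 *)

Section Contraction.
Variables (kap : {linear N -> N}) (lam0 lam : {linear N -> k^o}) (iota omega : N).
Hypothesis kap_lv : forall i j n, lv i j n -> lv i.-1 j.-1 (kap n).
Hypothesis kap_lv0 : forall n, lv 0 0 n -> kap n = 0.
Hypothesis kap_htpy : forall i j n, lv i j n ->
  d (kap n) + kap (d n) = n - (lam0 n : k) *: iota - (lam n : k) *: omega.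
Hypothesis lv_iota : lv 0 0 iota.
Hypothesis lv_omega : lv 3 3 omega.
Hypothesis d_iota : d iota = 0.
Hypothesis act_iota : forall v, act v iota = 0.
Hypothesis lam0_iota : lam0 iota = 1.
Hypothesis d_omega : d omega = 0.
Hypothesis lam_omega : lam omega = 1.
Hypothesis lam_d : forall i j n, lv i j n -> lam (d n) = 0.
Hypothesis lam_act_omega : forall v, lam (act v omega) = 0.
Hypothesis lam_lv : forall n, lv 0 2 n -> lam n = 0.
Hypothesis lam0_lv : forall j n, lv 1 j n -> lam0 n = 0.

(** The multiples of [iota] form a subcomplex isomorphic to the cobar complex, because [d] and the
    action kill [iota]. *)
Definition incl f : seq V -> N := mconv f (pt iota).

Lemma inclE f s : incl f s = (f s : k) *: iota.
Proof. by rewrite /incl mconv_pt. Qed.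

Lemma incl_inj : injective incl.
Proof.
move=> f g fg; apply/funext => s.
have := congr1 (fun F => lam0 (F s)) fg.
by rewrite !inclE ![lam0 _]linearZZ lam0_iota ![_ *: _]mulr1.
Qed.

Lemma inclB f g : incl (f - g) = incl f - incl g.
Proof. by rewrite /incl -scaleN1r mconvDl mconvZl scaleN1r. Qed.

Lemma total_diff_iota : D (pt iota) = 0.
Proof. by apply/funext => s; rewrite total_diff_pt; case: s => [|v []]; rewrite ?act_iota ?oppr0. Qed.

Lemma total_diff_incl f : D (incl f) = incl (cobar_diff f).
Proof.
rewrite /incl total_diff_mconv total_diff_iota -[RHS]addr0; congr (_ + _).
by apply/funext => s; rewrite /mconv big1 // => i _; rewrite scaler0.
Qed.

Lemma tot_incl f : f \in is_cochain (I := I) -> tot 0 0 (incl f).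
Proof. by move=> fc; apply/tot_mconv/tot_pt. Qed.

(** The twist cancels the sign inside [D], leaving [d (kap (F s))] unsigned in
    [total_diff_shrink]. *)
Definition shrink F := twist (fun s => kap (F s)).

Lemma tot_shrink i j F : tot i j F -> tot i.-1 j.-1 (shrink F).
Proof. by move=> Ft; apply/tot_twist; apply: tot_comp Ft; apply: kap_lv. Qed.

Lemma total_diff_shrink F s : D (shrink F) s = mdiff (shrink F) s + d (kap (F s)).
Proof.
rewrite total_diffE [d (shrink F s)]linearZZ scalerA -expr2 sqrr_sign.
by rewrite scale1r.
Qed.

Lemma kap_d F s : kap (d (F s)) = (-1) ^+ size s *: kap (D F s - mdiff F s).
Proof.
rewrite total_diffE addrAC subrr add0r [kap (_ *: _)]linearZZ scalerA -expr2.
by rewrite sqrr_sign scale1r.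
Qed.

(** By the homotopy identity, removing [d (kap G)] and the [omega] part from [G] leaves [kap (d G)]
    and a multiple of [iota]. Up to sign, [kap (d G)] is [kap] of [D G - mdiff G]; since [mdiff]
    preserves levels and [kap] lowers them, the top level disappears. *)
Lemma descent_step j G : tot 0 j.+1 G -> (forall s, lv 0 j (kap (D G s))) ->
  tot 0 j (G - D (shrink G) - mconv (fun s => lam (G s)) (pt omega)).
Proof.
move=> Gt DGl; have Et := tot_shrink Gt.
apply: (@tot_sub 0 j.+4).
  apply: totB; first apply: totB.
  - by apply: tot_mono Gt; rewrite ?ltnS ?leqW.
  - by apply: tot_mono (tot_diff Et); rewrite ?ltnS ?leqW.
  - apply: tot_mconv; first exact: tot_scalar Gt.
    by apply: tot_mono (tot_pt lv_omega).
move=> s; rewrite -[(_ - _) s]/(G s - D (shrink G) s - mconv _ _ s).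
rewrite total_diff_shrink mconv_pt; have [_ _ Gl] := Gt.
have -> : G s - (mdiff (shrink G) s + d (kap (G s))) - (lam (G s) : k) *: omega
    = (G s - (lam0 (G s) : k) *: iota - (lam (G s) : k) *: omega) - d (kap (G s))
      + (lam0 (G s) : k) *: iota - mdiff (shrink G) s.
  by rewrite [RHS](ACl (1*6*4*3*(2*5))) /= addNr addr0 opprD !addrA.
rewrite -(kap_htpy (Gl s)) [d _ + _]addrC addrK.
apply: lvD; first apply: lvD.
- rewrite kap_d; apply: lvZ; rewrite linearB; apply: lvD => //; apply: lvN.
  by apply: (kap_lv (i := 0) (j := j.+1)); apply: lv_mdiff.
- by apply: lvZ; apply: lv_mono lv_iota.
- by apply: lvN; apply: lv_mdiff; case: Et.
Qed.

Lemma kap_lv3 n : lv 0 3 n -> lv 0 2 (kap n).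
Proof. exact: kap_lv. Qed.

Lemma tot_lam_omega G i j j' : tot i j G -> (3 <= j')%N ->
  tot 0 j' (mconv (fun s => lam (G s)) (pt omega)).
Proof.
move=> Gt j3; apply: tot_mconv; first exact: tot_scalar Gt.
exact: tot_mono (tot_pt lv_omega).
Qed.

(** Iterated [descent_step]: as long as the level reached is at least 3, the multiple of [omega] may
    be put back, so that [G] changes by a boundary only. *)
Lemma descent_to3 j G : tot 0 j G -> (forall s, lv 0 3 (D G s)) ->
  exists E j', tot 0 j' E /\ tot 0 3 (G - D E).
Proof.
elim: j G => [|j IHj] G Gt DG.
  by exists 0, 0%N; rewrite total_diff0 subr0; split; [exact: tot0 | apply: tot_mono Gt].
case: (ltnP j 3) => j3.
  exists 0, 0%N; rewrite total_diff0 subr0; split; first exact: tot0.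
  exact: tot_mono Gt.
have G1t : tot 0 j (G - D (shrink G)).
  rewrite -[_ - _](subrK (mconv (fun s => lam (G s)) (pt omega))).
  apply: totD; last exact: tot_lam_omega Gt j3.
  by apply: descent_step => // s; apply: lv_mono (kap_lv3 (DG s)) => //; apply: ltnW.
have [|E [j' [Et Gt']]] := IHj _ G1t.
  by move=> s; rewrite total_diffB total_diffK subr0.
exists (shrink G + E), (maxn j j'); split; last by rewrite total_diffD opprD addrA.
apply: totD; last by apply: tot_mono Et; rewrite ?leq_maxr.
by apply: tot_mono (tot_shrink Gt); rewrite ?leq_maxl.
Qed.

Lemma lam_total_diff_omega g s : lam (D (mconv g (pt omega)) s) = cobar_diff g s.
Proof.
rewrite total_diff_mconv -[(_ + _) s]/(mconv _ _ s + mconv _ _ s) linearD /=.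
rewrite !mconv_comp [X in _ + X](_ : _ = 0) ?addr0; last first.
  rewrite /mconv big1 // => i _; rewrite total_diff_pt.
  case: drop => [|v [|w t]]; rewrite ?d_omega ?linearN ?lam_act_omega ?linear0 ?oppr0 ?scaler0 //.
rewrite (_ : (fun t => lam (pt omega t)) = pt (1 : k^o)) ?mconv_pt.
  exact: mulr1.
by apply/funext => -[|v t]; rewrite /= ?lam_omega ?linear0.
Qed.

Lemma lam_total_diff_low R s : tot 0 2 R -> lam (D R s) = 0.
Proof.
move=> [_ _ Rl]; rewrite total_diffE linearD [lam (_ *: _)]linearZZ.
by rewrite (lam_d (Rl s)) scaler0 addr0 lam_lv //; apply: lv_mdiff.
Qed.

Lemma descent_remainder G : tot 0 3 G -> (forall s, lv 0 3 (D G s)) ->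
  tot 0 2 (G - D (shrink G) - mconv (fun s => lam (G s)) (pt omega)).
Proof. by move=> Gt DG; apply: descent_step => // s; apply: kap_lv3. Qed.

(** The coefficient of [omega] behaves as a chain map: [G] is, modulo a boundary, [lam G] times
    [omega] plus a remainder in levels at most 2, and [lam] kills [D] of that remainder since it
    kills the image of [d]. *)
Lemma lam_total_diff G s : tot 0 3 G -> (forall s, lv 0 3 (D G s)) ->
  lam (D G s) = cobar_diff (fun s => lam (G s)) s.
Proof.
move=> Gt DG; have Rt := descent_remainder Gt DG.
have := lam_total_diff_low s Rt; rewrite !total_diffB total_diffK subr0.
rewrite -[(_ - _) s]/(D G s - D _ s) linearB /= lam_total_diff_omega.
by move=> /eqP; rewrite subr_eq0 => /eqP.
Qed.

Lemma kap_iota : kap iota = 0.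
Proof. exact: kap_lv0. Qed.

Lemma lam_iota : lam iota = 0.
Proof. by apply: lam_lv; apply: lv_mono lv_iota. Qed.

Lemma kap_incl f s : kap (incl f s) = 0.
Proof. by rewrite inclE [kap _]linearZZ kap_iota scaler0. Qed.

Lemma lam_incl f s : lam (incl f s) = 0.
Proof. by rewrite inclE [lam _]linearZZ lam_iota scaler0. Qed.

Lemma lv_incl j f s : lv 0 j (incl f s).
Proof. by rewrite inclE; apply/lvZ/(lv_mono _ _ lv_iota). Qed.

Lemma low_step j R f : tot 0 j.+1 R -> (j < 2)%N -> D R = incl f ->
  exists2 R', tot 0 j R' & D R' = incl f.
Proof.
move=> Rt j2 DR; exists (R - D (shrink R)); last by rewrite total_diffB total_diffK subr0.
have := descent_step Rt; rewrite DR.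
rewrite (_ : mconv _ _ = 0) ?subr0 => [|]; last first.
  apply/funext => s; rewrite mconv_pt lam_lv ?scale0r //.
  by have [_ _ Rl] := Rt; apply: lv_mono (Rl s).
by apply=> s; rewrite kap_incl; apply: lv0.
Qed.

(** Below level 3 no [omega] obstructs the descent, so a primitive of [incl f] can be brought to
    level 0, where it must be a multiple of [iota]. *)
Lemma low_exact R f : tot 0 2 R -> D R = incl f ->
  exists2 h, h \in is_cochain (I := I) & f = cobar_diff h.
Proof.
move=> R2 DR2; have [R1 R1t DR1] := low_step R2 isT DR2.
have [R0 R0t DR0] := low_step R1t isT DR1.
exists (fun s => lam0 (R0 s)); first exact: tot_scalar R0t.
have R0E : R0 = incl (fun s => lam0 (R0 s)).
  apply/funext => s; rewrite inclE; have [_ _ R0l] := R0t.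
  have := kap_htpy (R0l s); rewrite (kap_lv0 (R0l s)) linear0 add0r.
  rewrite kap_d DR0 linearB /= kap_incl sub0r kap_lv0; last exact: lv_mdiff.
  rewrite oppr0 scaler0 lam_lv; last by apply: lv_mono (R0l s).
  by rewrite scale0r subr0 => /esym/eqP; rewrite subr_eq0 => /eqP.
by apply: incl_inj; rewrite -total_diff_incl -R0E DR0.
Qed.

(** One step of the staircase: the correction, one level lower and one cobar degree higher, whose
    twisted [d] cancels [mdiff P] ([next_diff]). *)
Definition next P : seq V -> N := - shrink (mdiff P).

Lemma tot_next i j P : tot i j P -> tot i.-1 j.-1 (next P).
Proof. by move=> Pt; apply/totN/tot_shrink/tot_mdiff. Qed.

Lemma next_local P n : (forall s, size s != n -> P s = 0) ->
  forall s, size s != n.+1 -> mdiff P s = 0.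
Proof.
move=> P0 s sn; case: s sn => [|x s] //; rewrite eqSS => sn.
by apply: mdiff_local => t ts; apply: P0; rewrite ts.
Qed.

Lemma next_size P n : (forall s, size s != n -> P s = 0) ->
  forall s, size s != n.+1 -> next P s = 0.
Proof.
move=> P0 s sn; rewrite /next -[LHS]/(- (_ *: kap (mdiff P s))).
by rewrite (next_local P0) // linear0 scaler0 oppr0.
Qed.

Lemma next_diff i P : tot i.+1 i.+1 P -> (forall s, d (mdiff P s) = 0) ->
  (forall s, lam (mdiff P s) = 0) ->
  twist (fun s => d (next P s)) = - mdiff P.
Proof.
move=> Pt dP lP; apply/funext => s; have [_ _ Pl] := tot_mdiff Pt.
have := kap_htpy (Pl s); rewrite dP lP linear0 addr0 scale0r subr0.
rewrite (@lam0_lv i.+1) ?scale0r ?subr0; last by apply: lv_mono (Pl s).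
move=> Pe; rewrite -[RHS]/(- mdiff P s) -Pe.
rewrite /twist /next -[(- shrink _) s]/(- (_ *: kap (mdiff P s))).
by rewrite linearN [d (_ *: _)]linearZZ scalerN scalerA -expr2 sqrr_sign scale1r.
Qed.

Lemma next_closed i P : tot i.+1 i.+1 P -> (forall s, d (mdiff P s) = 0) ->
  (forall s, lam (mdiff P s) = 0) -> forall s, d (mdiff (next P) s) = 0.
Proof.
move=> Pt dP lP s.
have /(congr1 (fun F => F s)) := mdiff_comp (next P) (fun v n => dact v n).
move=> <-; rewrite -[X in mdiff X]twistK (next_diff Pt dP lP).
by rewrite mdiff_twist mdiffN mdiffK // /twist -[LHS]/(- (_ *: - 0)) oppr0 scaler0 oppr0.
Qed.

(** The staircase from [omega] in level 3 down to level 0; its i-th step has i arguments and level 3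
    - i. *)
Definition yoneda1 := next (pt omega).
Definition yoneda2 := next yoneda1.
Definition yoneda3 := next yoneda2.
Definition yoneda_tail := yoneda1 + yoneda2 + yoneda3.
Definition yoneda := pt omega + yoneda_tail.
(** In level 0 no correction is left: [mdiff yoneda3] is [d]-closed, hence a multiple of [iota], and
    its coefficient is the class of degree 4. *)
Definition yoneda_class : seq V -> k^o := fun s => lam0 (mdiff yoneda3 s).

Lemma d_mdiff_omega s : d (mdiff (pt omega) s) = 0.
Proof.
rewrite mdiff_pt; case: s => [|v [|w s]]; rewrite ?linear0 //.
by rewrite linearN dact d_omega linear0 oppr0.
Qed.

Lemma lam_mdiff_omega s : lam (mdiff (pt omega) s) = 0.
Proof.
rewrite mdiff_pt; case: s => [|v [|w s]]; rewrite ?linear0 //.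
by rewrite linearN lam_act_omega oppr0.
Qed.

Lemma lam_mdiff_low i j F s : (j <= 2)%N -> tot i j F -> lam (mdiff F s) = 0.
Proof.
move=> j2 [_ _ Fl]; apply/lam_lv/lv_mdiff => {}s; exact: lv_mono (Fl s).
Qed.

Lemma tot_omega : tot 3 3 (pt omega). Proof. exact: tot_pt. Qed.
Lemma tot_yoneda1 : tot 2 2 yoneda1. Proof. exact: tot_next tot_omega. Qed.
Lemma tot_yoneda2 : tot 1 1 yoneda2. Proof. exact: tot_next tot_yoneda1. Qed.
Lemma tot_yoneda3 : tot 0 0 yoneda3. Proof. exact: tot_next tot_yoneda2. Qed.

Lemma tot_yoneda_tail : tot 0 2 yoneda_tail.
Proof.
apply: totD; first apply: totD.
- exact: tot_mono tot_yoneda1.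
- exact: tot_mono tot_yoneda2.
- exact: tot_mono tot_yoneda3.
Qed.

Lemma tot_yoneda : tot 0 3 yoneda.
Proof.
apply: totD; first exact: tot_mono tot_omega.
exact: tot_mono tot_yoneda_tail.
Qed.

Lemma yoneda_class_cochain : yoneda_class \in is_cochain (I := I).
Proof. exact: tot_scalar (tot_mdiff tot_yoneda3). Qed.

Lemma total_diff_yoneda : D yoneda = incl yoneda_class.
Proof.
have c1 := next_closed tot_omega d_mdiff_omega lam_mdiff_omega.
have l1 s : lam (mdiff yoneda1 s) = 0 by apply: lam_mdiff_low tot_yoneda1.
have c2 := next_closed tot_yoneda1 c1 l1.
have l2 s : lam (mdiff yoneda2 s) = 0 by apply: lam_mdiff_low tot_yoneda2.
have c3 := next_closed tot_yoneda2 c2 l2.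
have l3 s : lam (mdiff yoneda3 s) = 0 by apply: lam_mdiff_low tot_yoneda3.
rewrite /yoneda /yoneda_tail !total_diffD /total_diff.
rewrite (next_diff tot_omega d_mdiff_omega lam_mdiff_omega).
rewrite (next_diff tot_yoneda1 c1 l1) (next_diff tot_yoneda2 c2 l2).
have -> : (fun s => d (pt omega s)) = 0 :> (seq V -> N).
  by apply/funext => -[|v s]; rewrite /= ?d_omega ?linear0.
have -> : twist (0 : seq V -> N) = 0 by apply/funext => s; rewrite /twist scaler0.
(* Each cobar differential is paired with the twisted [d] of the next correction; only
   [mdiff yoneda3] remains. *)
rewrite addr0 !addrA [LHS](ACl (6*(1*3)*(2*5)*(4*7))) /= !subrr !addr0.
apply/funext => s; rewrite inclE; have [_ _ Pl] := tot_mdiff tot_yoneda3.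
have := kap_htpy (Pl s); rewrite c3 l3 linear0 addr0 scale0r subr0.
rewrite (kap_lv0 (Pl s)) linear0 => /esym/eqP.
by rewrite subr_eq0 => /eqP.
Qed.

Lemma size_merge_at i (s : seq V) : (i.+1 < size s)%N ->
  size (merge_at i s) = (size s).-1.
Proof.
move=> lis; rewrite /merge_at size_cat /= size_take size_drop (ltn_trans _ lis) //.
by rewrite -{2}(subnKC lis) addnS.
Qed.

Lemma cobar_diff_homog f n : (forall s, size s != n -> f s = 0) ->
  forall s, size s != n.+1 -> cobar_diff f s = 0.
Proof.
move=> fn s sn; rewrite /cobar_diff big1 // => i _; rewrite fn ?mulr0 //.
have lis : (i.+1 < size s)%N by case: (size s) i => [|m] [i /=] //; rewrite ltnS.
rewrite size_merge_at //; apply: contraNneq sn => <-.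
by rewrite prednK // (leq_trans _ lis).
Qed.

Definition component n f : seq V -> k^o := fun s => if size s == n then f s else 0.

Lemma component_cochain n f :
  f \in is_cochain (I := I) -> component n f \in is_cochain (I := I).
Proof.
move=> /asboolP[f1 [L fL]]; apply/asboolP; split; last first.
  by exists L => s Ls; rewrite /component fL // if_same.
move=> s1 s2 c x y; rewrite /component !size_cat /=.
by case: eqP => // _; rewrite scaler0 addr0.
Qed.

Lemma cobar_diff_component n f :
  cobar_diff (component n f) = component n.+1 (cobar_diff f).
Proof.
apply/funext => s; rewrite /component; case: eqP => [sn|/eqP sn]; last first.
  by apply: cobar_diff_homog sn => t /negPf tn; rewrite tn.
apply: eq_bigr => i _; rewrite size_merge_at //.
  by have -> : (size s).-1 == n by rewrite sn.
by case: (size s) i => [|m] [i /=] //; rewrite ltnS.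
Qed.

Lemma conv_component m n f g : (forall s, size s != n -> g s = 0) ->
  component (m + n)%N (conv f g) = conv (component m f) g.
Proof.
move=> g0; apply/funext => s; rewrite /component; case: eqP => sn.
  apply: eq_bigr => i _; have := cat_take_drop i s.
  case: eqP => // tm st; rewrite g0 ?mulr0 //; apply: contra_not_neq tm => dn.
  by apply/eqP; rewrite -(eqn_add2r n) -{1}dn -size_cat st sn.
rewrite /conv big1 // => i _.
case: eqP => ti; last by rewrite mul0r.
rewrite g0 ?mulr0 //; apply/eqP => dn; apply: sn.
by rewrite -[in LHS](cat_take_drop i s) size_cat ti dn.
Qed.

Lemma componentK n f : (forall s, size s != n -> f s = 0) -> component n f = f.
Proof.
by move=> f0; apply/funext => s; rewrite /component; case: eqP => // /eqP/f0.
Qed.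

Lemma component_lin n (c : k) f g :
  component n (c *: f + g) = c *: component n f + component n g.
Proof.
apply/funext => s; rewrite -[RHS]/(c *: component n f s + component n g s) /component.
by case: eqP; rewrite ?scaler0 ?addr0.
Qed.

Lemma componentD n f g : component n (f + g) = component n f + component n g.
Proof. by rewrite -[f]scale1r component_lin !scale1r. Qed.

Lemma yoneda_size s :
  [/\ size s != 1 -> yoneda1 s = 0, size s != 2 -> yoneda2 s = 0
    & size s != 3 -> yoneda3 s = 0].
Proof.
have p0 (t : seq V) : size t != 0%N -> pt omega t = 0 by case: t.
have p1 := next_size p0; have p2 := next_size p1.
by split; [apply: p1 | apply: p2 | apply: next_size p2 s].
Qed.

Lemma yoneda_class_size s : size s != 4 -> yoneda_class s = 0.
Proof.
move=> s4; rewrite /yoneda_class (next_local (n := 3)) ?linear0 // => t.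
by have [] := yoneda_size t.
Qed.

Lemma yoneda_class_closed s : cobar_diff yoneda_class s = 0.
Proof.
have e : incl (cobar_diff yoneda_class) = incl 0.
  rewrite -total_diff_incl -total_diff_yoneda total_diffK.
  by apply/funext => t; rewrite inclE scale0r.
by rewrite (incl_inj e).
Qed.

Lemma total_diff_mconv_yoneda g : (forall s, cobar_diff g s = 0) ->
  D (mconv g yoneda) = incl (conv (parity_twist g) yoneda_class).
Proof.
move=> g0; rewrite total_diff_mconv total_diff_yoneda /incl -mconvA.
rewrite (_ : mconv (cobar_diff g) _ = 0) ?add0r //.
by apply/funext => s; rewrite /mconv big1 // => i _; rewrite g0 scale0r.
Qed.

Lemma parity_twist_cocycle g : (forall s, cobar_diff g s = 0) ->
  forall s, cobar_diff (parity_twist g) s = 0.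
Proof. by move=> g0 s; rewrite cobar_diff_twist /parity_twist g0 mulr0 oppr0. Qed.

(** The coefficient [g] of [omega] in [G] is a cocycle. Subtracting [g] times [yoneda], not just [g]
    times [omega], keeps the differential a multiple of [iota] and leaves levels at most 2, where
    [low_exact] applies. *)
Lemma exact_mid3 f G : tot 0 3 G -> D G = incl f ->
  (forall s, cobar_diff (fun t => lam (G t)) s = 0) /\
  exists2 h, h \in is_cochain (I := I)
    & f = conv (parity_twist (fun s => lam (G s))) yoneda_class + cobar_diff h.
Proof.
move=> Gt DG; set g := fun s => lam (G s).
have lDG s : lv 0 3 (D G s) by rewrite DG; apply: lv_incl.
have g0 s : cobar_diff g s = 0 by rewrite -lam_total_diff // DG lam_incl.
split=> //; pose R := G - D (shrink G) - mconv g (pt omega).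
have R2t : tot 0 2 (R - mconv g yoneda_tail).
  apply: totB; first exact: (descent_remainder Gt lDG).
  by apply: tot_mconv tot_yoneda_tail; apply: tot_scalar Gt.
have RE : R - mconv g yoneda_tail = G - D (shrink G) - mconv g yoneda.
  by rewrite /R /yoneda mconvDr [- (mconv _ _ + _)]opprD [RHS]addrA.
have [|h hc fE] := @low_exact _ (f - conv (parity_twist g) yoneda_class) R2t.
  rewrite RE !total_diffB total_diffK subr0 DG total_diff_mconv_yoneda //.
  by rewrite inclB.
by exists h => //; rewrite -fE addrC subrK.
Qed.

Lemma exact_mid f j G : tot 0 j G -> D G = incl f ->
  exists g, [/\ g \in is_cochain (I := I), forall s, cobar_diff g s = 0
    & exists2 h, h \in is_cochain (I := I) & f = conv g yoneda_class + cobar_diff h].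
Proof.
move=> Gt DG; have [|E [j' [Et G3t]]] := descent_to3 Gt.
  by move=> s; rewrite DG; apply: lv_incl.
have [|g0 [h hc fE]] := @exact_mid3 f _ G3t.
  by rewrite total_diffB total_diffK subr0.
exists (parity_twist (fun s => lam ((G - D E) s))); split.
- have /asboolP[g1 g2] := @tot_scalar lam _ _ _ G3t.
  by apply/asboolP; split; [apply: multilinear_twist | apply: bounded_val_twist].
- exact: parity_twist_cocycle.
- by exists h.
Qed.

Lemma lam_yoneda s : lam (yoneda s) = pt (1 : k^o) s.
Proof.
rewrite -[yoneda s]/(pt omega s + yoneda_tail s) linearD /=.
have [_ _ /(_ s)/lam_lv->] := tot_yoneda_tail.
by rewrite addr0; case: s => [|v s]; rewrite /= ?linear0.
Qed.

(** Apply [lam] after descending to level 3: on the right only the [omega] coefficient of [yoneda]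
    survives, which is 1, and on the left [lam_total_diff] gives a coboundary. *)
Lemma exact_left g h j G : tot 0 j G -> g \in is_cochain (I := I) ->
  D G = mconv g yoneda - incl h ->
  exists2 h', h' \in is_cochain (I := I) & g = cobar_diff h'.
Proof.
move=> Gt gc DG.
have lDG s : lv 0 3 (D G s).
  rewrite DG -[(_ - _) s]/(mconv g yoneda s - incl h s); apply: lvD.
    by have [_ _] := tot_mconv gc tot_yoneda; apply.
  exact/lvN/lv_incl.
have [E [j' [Et G3t]]] := descent_to3 Gt lDG.
exists (fun s => lam ((G - D E) s)); first exact: tot_scalar G3t.
apply/funext => s; have DGE : D (G - D E) = D G by rewrite total_diffB total_diffK subr0.
rewrite -lam_total_diff // => [|t]; last by rewrite DGE.
rewrite DGE DG -[(_ - _) s]/(mconv g yoneda s - incl h s) linearB /= lam_incl subr0.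
rewrite mconv_comp (_ : (fun t => _) = pt (1 : k^o)); first by rewrite mconv_pt [RHS]mulr1.
by apply/funext => t; apply: lam_yoneda.
Qed.

(** * Classes of degree 1 and their commutation with the class of degree 4 *)

Variable gens : V -> Prop.
Hypothesis gens_ind : forall p : V -> k^o, linear p ->
  (forall v, gens v -> p v = 0) -> (forall u v, p (ideal_mul u v) = 0) ->
  forall v, p v = 0.

Section RightMultiplication.
Variables (r : {linear N -> N}) (dual : N) (phi : {linear V -> k^o}).
Hypothesis r_act : forall v n, r (act v n) = act v (r n).
Hypothesis r_d : forall n, r (d n) = d (r n).
Hypothesis r_lv : forall i j n, lv i j n -> lv i.+1 j.+1 (r n).
Hypothesis lv_dual : lv 0 0 dual.
Hypothesis d_dual : d dual = r iota.
Hypothesis act_dual : forall v, act v dual = (phi v : k) *: iota.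

Definition cochain1 : seq V -> k^o := fun s => if s is [:: v] then phi v else 0.

Lemma cochain1_cochain : cochain1 \in is_cochain (I := I).
Proof.
apply/asboolP; split; last by exists 1%N => -[|v []].
move=> [|u [|w s1]] [|v s2] c x y; rewrite /= ?linearP // ?scaler0 ?addr0 //.
Qed.

(** Acting by a product sends [dual] first to a multiple of [iota], which the second factor
    kills. *)
Lemma phiM u v : phi (ideal_mul u v) = 0.
Proof.
have /(congr1 lam0) : (phi (ideal_mul u v) : k) *: iota = 0.
  by rewrite -act_dual actM act_dual [act _ _]linearZZ act_iota scaler0.
by rewrite [lam0 _]linearZZ lam0_iota linear0 [_ *: _]mulr1.
Qed.

Lemma cochain1_closed s : cobar_diff cochain1 s = 0.
Proof.
case: s => [|u [|v s]]; rewrite ?cobar_diff_nil ?cobar_diff1 //.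
case: s => [|w s].
  by rewrite cobar_diff_cons2 cobar_diff1 /= phiM oppr0 addr0.
by rewrite (cobar_diff_homog (n := 1)) // => -[|x []].
Qed.

(** The dual generator is a homology between the class of degree 1 and the corresponding generator
    of S in level 1. *)
Lemma total_diff_dual : D (pt dual) = pt (r iota) - incl cochain1.
Proof.
apply/funext => s; rewrite -[RHS]/(pt (r iota) s - incl cochain1 s) inclE.
rewrite total_diff_pt; case: s => [|v [|w s]] /=; rewrite ?scale0r ?subr0 //.
by rewrite act_dual sub0r.
Qed.

Lemma total_diff_r F : D (fun s => r (F s)) = fun s => r (D F s).
Proof.
apply/funext => s; rewrite !total_diffE linearD [r (_ *: _)]linearZZ r_d.
by rewrite (mdiff_comp F r_act).
Qed.

(** Multiply [total_diff_dual] on the left by the cocycle [f]: modulo boundaries, right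
    multiplication by the class of degree 1 is the operator [r]. *)
Lemma incl_conv_cochain1 f : (forall s, cobar_diff f s = 0) ->
  incl (conv f cochain1) =
  (fun s => r (incl f s)) - D (mconv (parity_twist f) (pt dual)).
Proof.
move=> f0; rewrite total_diff_mconv total_diff_dual parity_twistK.
rewrite (_ : mconv (cobar_diff _) _ = 0); last first.
  apply/funext => s; rewrite /mconv big1 // => i _.
  by rewrite (parity_twist_cocycle f0) scale0r.
rewrite add0r mconvDr (_ : mconv f (- _) = - mconv f (incl cochain1)); last first.
  apply/funext => s; rewrite -[RHS]/(- mconv _ _ s) /mconv -sumrN.
  by apply: eq_bigr => i _; rewrite -[(- incl _) _]/(- incl _ _) scalerN.
rewrite (_ : (fun s => r (incl f s)) = mconv f (pt (r iota))); last first.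
  by apply/funext => s; rewrite mconv_pt inclE linearZZ.
by rewrite subKr /incl mconvA.
Qed.

Lemma parity_twist_cochain1 : parity_twist cochain1 = - cochain1.
Proof.
apply/funext => -[|v [|w s]]; rewrite /parity_twist -[RHS]/(- cochain1 _) /=.
- by rewrite mulr0 oppr0.
- by rewrite expr1 mulN1r.
- by rewrite mulr0 oppr0.
Qed.

(** The left side is the value at [v] of the degree 1 cocycle that measures the commutator in
    [yoneda_commute]. *)
Hypothesis commute_value : forall v, gens v ->
  - lam (r (kap (act v omega))) + phi v + lam (act v (kap (r omega))) = 0.

(** The commutator included through [iota] is a boundary [D G], so [exact_mid3] writes it as a
    signed g X plus a coboundary. The commutator has degree 5 and X degree 4, so only the degree 1
    part of g counts, and [commute_value] makes it vanish. *)
Lemma yoneda_commute :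
  exists2 h, h \in is_cochain (I := I)
    & conv yoneda_class cochain1 - conv cochain1 yoneda_class = cobar_diff h.
Proof.
(* The first two terms bound [yoneda_class] times the class of degree 1, by [incl_conv_cochain1];
   the last one bounds minus the opposite product, the sign being that of the parity twist. *)
pose G : seq V -> N := (fun s => r (yoneda s))
  - mconv (parity_twist yoneda_class) (pt dual) + mconv cochain1 yoneda.
have Gt : tot 0 4 G.
  apply: totD; first apply: totB.
  - apply: tot_comp tot_yoneda => n /r_lv; exact: lv_mono.
  - apply: tot_mconv; last by apply: tot_mono (tot_pt lv_dual).
    have /asboolP[x1 x2] := yoneda_class_cochain.
    by apply/asboolP; split; [apply: multilinear_twist | apply: bounded_val_twist].
  - by apply: tot_mconv cochain1_cochain _; apply: tot_mono tot_yoneda.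
set f := _ - _.
have DG : D G = incl f.
  rewrite /G total_diffD total_diffB total_diff_r total_diff_yoneda.
  rewrite (total_diff_mconv_yoneda cochain1_closed) parity_twist_cochain1 /f inclB.
  rewrite (incl_conv_cochain1 yoneda_class_closed); congr (_ + _).
  by rewrite -scaleN1r {1}/incl -mconvA mconvZl mconvA scaleN1r.
(* [r] raises the level to 4, so one descent step is needed before [exact_mid3]. *)
have G1t : tot 0 3 (G - D (shrink G)).
  rewrite -[_ - _](subrK (mconv (fun s => lam (G s)) (pt omega))).
  apply: totD; last exact: tot_lam_omega Gt _.
  by apply: descent_step => // s; rewrite DG kap_incl.
have [|gc [h hc fE]] := @exact_mid3 f _ G1t.
  by rewrite total_diffB total_diffK subr0.
move: gc fE; set g := fun s => _ => gc fE.
have X0 := yoneda_class_size.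
have yv v : yoneda [:: v] = - kap (act v omega).
  have [_ y2 y3] := yoneda_size [:: v].
  rewrite -[LHS]/(0 + (yoneda1 [:: v] + yoneda2 [:: v] + yoneda3 [:: v])).
  rewrite y2 // y3 // !addr0 add0r /yoneda1 /next.
  rewrite -[LHS]/(- ((-1) ^+ 1 *: kap (- act v omega))) expr1 scaleN1r opprK.
  by rewrite linearN.
have ynil : yoneda [::] = omega.
  have [y1 y2 y3] := yoneda_size [::].
  rewrite -[LHS]/(omega + (yoneda1 [::] + yoneda2 [::] + yoneda3 [::])).
  by rewrite y1 // y2 // y3 // !addr0.
have G0 : G [::] = r omega.
  rewrite -[LHS]/(r (yoneda [::]) - mconv _ _ [::] + mconv _ _ [::]).
  rewrite !mconv_nil scale0r addr0 /parity_twist X0 // mulr0 scale0r subr0.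
  by rewrite ynil.
have Gv v : G [:: v] = - r (kap (act v omega)) + (phi v : k) *: omega.
  rewrite -[LHS]/(r (yoneda [:: v]) - mconv _ _ [:: v] + mconv _ _ [:: v]).
  rewrite mconv_pt /parity_twist X0 // mulr0 scale0r subr0 yv linearN.
  by rewrite mconv_cons mconv_nil scale0r add0r ynil.
have g1 v : gens v -> g [:: v] = 0.
  move=> gv.
  rewrite /g -[(_ - _) _]/(G [:: v] - D (shrink G) [:: v]) total_diff_shrink.
  have [_ _ /(_ [:: v]) Gl] := Gt; have dl := lam_d (kap_lv Gl).
  rewrite -[mdiff _ _]/(- act v ((-1) ^+ 0 *: kap (G [::]))) G0 scale1r.
  rewrite [lam _]linearB [lam (_ + d _)]linearD dl addr0 [lam (- _)]linearN opprK Gv.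
  by rewrite [lam (_ + _)]linearD [lam (- _)]linearN [lam (_ *: _)]linearZZ lam_omega
    -[X in _ + X + _]/((phi v : k) * 1) mulr1 commute_value.
(* A cocycle of degree 1 vanishes on products, so vanishing on generators suffices. *)
have g1' v : g [:: v] = 0.
  have /asboolP[g_lin _] := @tot_scalar lam _ _ _ G1t.
  move: v; apply: (gens_ind (p := fun v => g [:: v])) => [c u v|v gv|u v].
  - exact: (g_lin [::]).
  - exact: g1.
  - have := gc [:: u; v]; rewrite cobar_diff_cons2 cobar_diff1 subr0 => /eqP.
    by rewrite oppr_eq0 => /eqP.
exists (component 4 h); first exact: component_cochain.
(* [g] may have parts in other degrees; they do not contribute to component 5 = 1 + 4. *)
have gX : component 5 (conv (parity_twist g) yoneda_class) = 0.
  rewrite -[5]/(1 + 4)%N (conv_component 1 (n := 4)) //; apply/funext => s.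
  rewrite /conv big1 // => i _; rewrite /component; case: eqP; rewrite ?mul0r //.
  by case: (take i s) => [|v [|w t]] //; rewrite /parity_twist g1' mulr0 mul0r.
have f5 : component 5 f = f.
  have c0 (t : seq V) : size t != 1 -> cochain1 t = 0 by case: t => [|v []].
  rewrite /f addrC -scaleN1r component_lin -{1}[5]/(1 + 4)%N -[5]/(4 + 1)%N.
  by rewrite (conv_component 1 _ X0) (conv_component 4 _ c0) !componentK.
by rewrite cobar_diff_component -f5 fE componentD gX add0r.
Qed.
End RightMultiplication.

(** * Comparison of the cohomology with S through words *)

Section WordClasses.
Variables (m : nat) (r : 'I_m -> {linear N -> N}) (dual : 'I_m -> N).
Variable phi : 'I_m -> {linear V -> k^o}.
Hypothesis r_act : forall i v n, r i (act v n) = act v (r i n).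
Hypothesis r_d : forall i n, r i (d n) = d (r i n).
Hypothesis r_lv : forall l i j n, lv i j n -> lv i.+1 j.+1 (r l n).
Hypothesis lv_dual : forall i, lv 0 0 (dual i).
Hypothesis d_dual : forall i, d (dual i) = r i iota.
Hypothesis act_dual : forall i v, act v (dual i) = (phi i v : k) *: iota.
Hypothesis commute_value : forall i v, gens v ->
  - lam (r i (kap (act v omega))) + phi i v + lam (act v (kap (r i omega))) = 0.
Hypothesis reduce : forall i j F, tot i j F ->
  (forall s, s != [::] -> D F s = 0) ->
  exists G n j', [/\ tot i j' G, lv i j' n, forall v, act v n = 0 & F = D G + pt n].
Local Notation rword := (foldl (fun n i => r i n) iota).
Hypothesis inv_words : forall j n, lv 0 j n -> (forall v, act v n = 0) ->
  exists u : free_alg k m, n = lin_ext rword u.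
Local Notation pi := (aq_pi (coboundary_ideal I)).

Lemma gen_cocycle_subproof i :
  Cochain (cochain1_cochain (phi i)) \in is_cocycle (I := I).
Proof.
rewrite unfold_in; apply/eqP/val_inj/funext => s.
exact: cochain1_closed (act_dual i) _.
Qed.

Definition gen_cocycle i := Cocycle (gen_cocycle_subproof i).

Lemma yoneda_cocycle_subproof :
  Cochain yoneda_class_cochain \in is_cocycle (I := I).
Proof.
rewrite unfold_in; apply/eqP/val_inj/funext => s; exact: yoneda_class_closed.
Qed.

Definition yoneda_cocycle := Cocycle yoneda_cocycle_subproof.
Local Notation X := yoneda_cocycle.
Local Notation fn z := (cochain_val (cocycle_val z)).
Local Notation ev := (free_eval gen_cocycle).

Lemma cocycle_closed (z : cocycle I) s : cobar_diff (fn z) s = 0.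
Proof. by case: z => f /= /eqP/(congr1 val)/(congr1 (fun f => f s)). Qed.

Lemma cocycle_cochain (z : cocycle I) : fn z \in is_cochain (I := I).
Proof. by case: z => -[]. Qed.

Lemma cocycle_of f : f \in is_cochain (I := I) -> (forall s, cobar_diff f s = 0) ->
  exists z : cocycle I, fn z = f.
Proof.
move=> fc f0; have fz : Cochain fc \in is_cocycle (I := I).
  by rewrite unfold_in; apply/eqP/val_inj/funext => s; apply: f0.
by exists (Cocycle fz).
Qed.

Lemma pi_eq (y z : cocycle I) : pi y = pi z <->
  exists2 h, h \in is_cochain (I := I) & fn y = fn z + cobar_diff h.
Proof.
split=> [/aq_piP/asboolP[h e]|[h hc e]].
  exists h; first by case: h {e}.
  have /(congr1 (@cochain_val _ _ _)) /= <- := e.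
  by apply/funext => s; rewrite -[RHS]/(_ + (_ - _)) addrC subrK.
apply/aq_piP/asboolP; exists (Cochain hc); apply/val_inj => /=.
by rewrite e; apply/funext => s; rewrite -[LHS]/(_ + _ - _) addrAC subrr add0r.
Qed.

(** Induction on words from the right end: each new letter is a right multiplication, replaced by
    the operator [r i] through [incl_conv_cochain1], and [r i] commutes with [D]. *)
Lemma incl_words u :
  exists G j, tot 0 j G /\ incl (fn (ev u)) = D G + pt (lin_ext rword u).
Proof.
elim/free_alg_ind: u => [w||c u v [G [j [Gt eG]]] [G' [j' [G't eG']]]].
- rewrite free_eval_word lin_ext_word.
  elim/last_ind: w => [|w i [G [j [Gt eG]]]].
    exists 0, 0%N; rewrite total_diff0 add0r big_nil; split; first exact: tot0.
    apply/funext => -[|v s]; rewrite inclE ?scale1r // /=.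
    by rewrite scale0r.
  rewrite big_rcons foldl_rcons /=; set f := \prod_(_ <- _) _ in eG *.
  exists ((fun s => r i (G s)) - mconv (parity_twist (fn f)) (pt (dual i))), j.+1; split.
    apply: totB; first by apply: tot_comp Gt => n /(r_lv i); apply: lv_mono.
    apply: tot_mconv; last by apply: tot_mono (tot_pt (lv_dual i)).
    have /asboolP[f1 f2] := cocycle_cochain f.
    by apply/asboolP; split; [apply: multilinear_twist | apply: bounded_val_twist].
  rewrite [LHS](incl_conv_cochain1 (d_dual i) (act_dual i) (cocycle_closed f)).
  rewrite eG total_diffB (total_diff_r (r_act i) (r_d i)) [RHS]addrAC; congr (_ + _).
  apply/funext => s; rewrite -[RHS]/(r i (D G s) + pt _ s) linearD; congr (_ + _).
  by case: s => [|v s] //=; rewrite linear0.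
- exists 0, 0%N; rewrite total_diff0 add0r !linear0; split; first exact: tot0.
  by apply/funext => -[|v s]; rewrite inclE scale0r.
- exists (c *: G + G'), (maxn j j'); split.
    by apply: tot_lin; [apply: tot_mono Gt | apply: tot_mono G't]; rewrite ?leq_maxl ?leq_maxr.
  rewrite total_diff_lin !linearP /=.
  rewrite -[incl _]/(incl (c *: fn (ev u) + fn (ev v))).
  rewrite /incl mconvDl mconvZl -!/(incl _) eG eG' scalerDr.
  rewrite addrA [LHS](ACl (1*3*(2*4))) /=; congr (_ + _).
  by apply/funext => -[|x s] //; rewrite -[LHS]/(c *: 0 + 0) scaler0 addr0.
Qed.

(** A combination of words vanishing in S has an inclusion that bounds, so [exact_mid] makes its
    class a multiple of X. *)
Lemma words_exact u : lin_ext rword u = 0 ->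
  exists g : cocycle I, pi (ev u) = pi g * pi X.
Proof.
move=> u0; have [G [j [Gt]]] := incl_words u.
rewrite u0 (_ : pt 0 = 0) ?addr0 => [e|]; last by apply/funext => -[].
have [g [gc g0 [h hc fE]]] := exact_mid Gt (esym e).
have [z ze] := cocycle_of gc g0; exists z; rewrite -rmorphM; apply/pi_eq.
by exists h; rewrite // [LHS]fE -ze.
Qed.

Lemma incl_reduce F j : tot 0 j F -> (forall s, s != [::] -> D F s = 0) ->
  exists G j' u, tot 0 j' G /\ F = D G + incl (fn (ev u)).
Proof.
move=> Ft DF; have [G [n [j' [Gt nl n0 e]]]] := reduce Ft DF.
have [u nu] := inv_words nl n0; have [G' [j'' [G't e']]] := incl_words u.
exists (G - G'), (maxn j' j''), u; split.
  by apply: totB; [apply: tot_mono Gt | apply: tot_mono G't]; rewrite ?leq_maxl ?leq_maxr.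
by rewrite e e' -nu total_diffB addrA subrK.
Qed.

(** The total cohomology is S, which the words fill; subtracting the right combination of words
    makes the inclusion bound, and [exact_mid] applies. *)
Lemma class_generated (z : cocycle I) :
  exists u (g : cocycle I), pi z = pi (ev u) + pi g * pi X.
Proof.
have [|s s0|G [j [u [Gt e]]]] := @incl_reduce (incl (fn z)) 0.
- exact/tot_incl/cocycle_cochain.
- by rewrite total_diff_incl inclE cocycle_closed scale0r.
have eG : D G = incl (fn z - fn (ev u)) by rewrite inclB e addrK.
have [g [gc g0 [h hc fE]]] := exact_mid Gt eG.
have [g' ge] := cocycle_of gc g0; exists u, g'.
rewrite -rmorphM -rmorphD; apply/pi_eq; exists h => //.
apply/funext => s; have /(congr1 (fun f => f s)) := fE.
rewrite -[(fn z - _) s]/(fn z s - fn (ev u) s).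
rewrite -[(_ + cobar_diff h) s]/(conv g yoneda_class s + cobar_diff h s).
move=> /(canRL (subrK _)) ->; rewrite -ge.
by rewrite -[RHS]/((fn (ev u)) s + conv (fn g') yoneda_class s + cobar_diff h s)
  addrC addrA.
Qed.

Lemma mul_yoneda_diff (g : cocycle I) :
  D (mconv (parity_twist (fn g)) yoneda) = incl (fn (g * X)).
Proof.
rewrite total_diff_mconv_yoneda ?parity_twistK //.
exact/parity_twist_cocycle/cocycle_closed.
Qed.

Lemma twist_cochain f :
  f \in is_cochain (I := I) -> parity_twist f \in is_cochain (I := I).
Proof.
move=> /asboolP[f1 f2].
by apply/asboolP; split; [apply: multilinear_twist | apply: bounded_val_twist].
Qed.

Lemma mul_yoneda_inj (g : cocycle I) : pi g * pi X = 0 -> pi g = 0.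
Proof.
rewrite -rmorphM -(rmorph0 pi) => /pi_eq[h hc e].
have gt : tot 0 3 (mconv (parity_twist (fn g)) yoneda).
  exact: tot_mconv (twist_cochain (cocycle_cochain g)) tot_yoneda.
(* If g X bounds [h], this difference is a cocycle of the total complex, hence cohomologous to a
   combination of words in level 0; [exact_left] then forces [g] to bound. *)
have [|s s0|G [j [u [Gt Fe]]]] := @incl_reduce (mconv (parity_twist (fn g)) yoneda - incl h) 3.
- by apply: totB => //; apply: tot_mono (tot_incl hc).
- rewrite total_diffB mul_yoneda_diff e total_diff_incl -inclB inclE.
  rewrite -[(_ + cobar_diff h - _) s]/(0 + cobar_diff h s - cobar_diff h s).
  by rewrite add0r subrr scale0r.
have [||h' h'c g'e] := @exact_left (parity_twist (fn g)) (h + (fn (ev u))) j G Gt.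
- exact/twist_cochain/cocycle_cochain.
- rewrite /incl mconvDl -!/(incl _) opprD addrA Fe; exact/esym/addrK.
apply/pi_eq; exists (- parity_twist h').
  by rewrite rpredN twist_cochain.
apply/funext => s; rewrite -[RHS]/(0 + cobar_diff (- parity_twist h') s) add0r.
rewrite -scaleN1r cobar_diffZ cobar_diff_twist mulN1r opprK -g'e.
by have /(congr1 (fun f => f s)) := parity_twistK (fn g).
Qed.

Lemma words_independent u (g : cocycle I) :
  pi (ev u) + pi g * pi X = 0 -> lin_ext rword u = 0.
Proof.
rewrite -rmorphM -rmorphD -(rmorph0 pi) => /pi_eq[h hc e].
have [G [j [Gt eG]]] := incl_words u.
pose H := incl h - mconv (parity_twist (fn g)) yoneda - G.
(* The value of [u] in S becomes a boundary of cobar degree 0. Reducing [H] modulo boundaries to an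
   included cocycle shows that [D H] is zero. *)
have DH : D H = pt (lin_ext rword u).
  rewrite !total_diffB mul_yoneda_diff total_diff_incl.
  have -> : cobar_diff h = (fn (ev u)) + (fn (g * X)).
    by rewrite [RHS]e; apply/funext => s; exact/esym/add0r.
  by rewrite /incl mconvDl -!/(incl _) addrK eG addrAC subrr add0r.
have [|s s0|G' [j' [u' [G't He]]]] := @incl_reduce H (maxn 3 j).
- apply: totB; last by apply: tot_mono Gt; rewrite ?leq_maxr.
  apply: totB; first by apply: tot_mono (tot_incl hc).
  apply: tot_mono (tot_mconv _ tot_yoneda); rewrite ?leq_maxl //.
  exact/twist_cochain/cocycle_cochain.
- by rewrite DH; case: s s0.
have /(congr1 (fun F => F [::])) := DH; rewrite /= => <-.
rewrite He total_diffD total_diffK total_diff_incl add0r inclE.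
by rewrite cocycle_closed scale0r.
Qed.

Lemma yoneda_central i : pi X * pi (gen_cocycle i) = pi (gen_cocycle i) * pi X.
Proof.
rewrite -!rmorphM; apply/pi_eq.
have [h hc e] := yoneda_commute (r_act i) (r_d i) (@r_lv i) (lv_dual i) (d_dual i)
  (act_dual i) (commute_value i).
by exists h => //; rewrite -e addrC subrK.
Qed.

Lemma gen_cocycle_size i s : size s != 1%N -> fn (gen_cocycle i) s = 0.
Proof. by case: s => [|v []]. Qed.

Theorem koszul_classes : exists (a : 'I_m -> cocycle I) (x : cocycle I),
  [/\ forall i s, size s != 1%N -> fn (a i) s = 0,
      forall s, size s != 4 -> fn x s = 0
    & [/\ forall u, lin_ext rword u = 0 ->
             exists y, pi (free_eval a u) = pi y * pi x,
          forall z, exists u y, pi z = pi (free_eval a u) + pi y * pi x,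
          forall y, pi y * pi x = 0 -> pi y = 0,
          forall u y, pi (free_eval a u) + pi y * pi x = 0 -> lin_ext rword u = 0
        & forall i, pi x * pi (a i) = pi (a i) * pi x]].
Proof.
exists gen_cocycle, yoneda_cocycle; split=> [i s|s|].
- exact: gen_cocycle_size.
- exact: yoneda_class_size.
- split; [exact: words_exact | exact: class_generated | exact: mul_yoneda_inj
         | exact: words_independent | exact: yoneda_central].
Qed.

End WordClasses.

End Contraction.

End KoszulTransfer.

(** * Recognizing a polynomial ring *)

Lemma commr_lin (k : fieldType) (T : algType k) (c : k) (x y z : T) :
  GRing.comm x z -> GRing.comm y z -> GRing.comm (c *: x + y) z.
Proof. by rewrite /GRing.comm mulrDl mulrDr -scalerAl -scalerAr => -> ->. Qed.

Lemma free_eval_comm (k : fieldType) (m : nat) (T : algType k) (g : 'I_m -> T) (z : T) :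
  (forall i, GRing.comm (g i) z) -> forall u, GRing.comm (free_eval g u) z.
Proof.
move=> gz u; elim/free_alg_ind: u => [w||c u v uz vz].
- rewrite free_eval_word; elim: w => [|i w IHw].
    by rewrite big_nil; apply/commr_sym/commr1.
  rewrite big_cons; apply/commr_sym/commrM; exact/commr_sym.
- rewrite linear0; exact/commr_sym/commr0.
- rewrite linearP; exact: commr_lin.
Qed.

Section GradedPolynomial.
Variables (k : fieldType) (S H : algType k) (sigma : {lrmorphism S -> H}) (x : H).
Variables (homS : nat -> S -> Prop) (homH : nat -> H -> Prop) (e : nat).
Hypothesis e_gt0 : (0 < e)%N.
Hypothesis x_comm : commr_rmorph sigma x.
Hypothesis sum_inj : forall c h, sigma c + h * x = 0 -> c = 0 /\ h = 0.
Hypothesis homS_sigma : forall n c, homS n c -> homH n (sigma c).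
Hypothesis homH0 : forall n, homH n 0.
Hypothesis homHD : forall n g h, homH n g -> homH n h -> homH n (g + h).
Hypothesis homHMx : forall n h, homH n h -> homH (n + e)%N (h * x).
Hypothesis homH_split : forall n h, homH n h -> exists c g,
  [/\ h = sigma c + g * x, homS n c & if (e <= n)%N then homH (n - e)%N g else g = 0].
Hypothesis homH_sum : forall h, exists (L : nat) (g : nat -> H),
  (forall n, homH n (g n)) /\ h = \sum_(n < L) g n.
Local Notation psi := (horner_morph x_comm).
Local Notation phom := (poly_homog homS e).

Lemma horner_morph_cons p c : psi (p * 'X + c%:P) = psi p * x + sigma c.
Proof. by rewrite rmorphD rmorphM /= horner_morphC horner_morphX. Qed.

(** Horner's scheme peels off one coefficient at a time, and [sum_inj] is exactly uniqueness at each
    step. *)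
Lemma horner_morph_inj : injective psi.
Proof.
suff psi0 p : psi p = 0 -> p = 0.
  move=> p q pq; apply/eqP; rewrite -subr_eq0; apply/eqP/psi0.
  by rewrite rmorphB /= pq subrr.
elim/poly_ind: p => // p c IHp.
rewrite horner_morph_cons addrC => /sum_inj[-> /IHp ->].
by rewrite mul0r addr0.
Qed.

Lemma poly_homog_cons n p c : phom n (p * 'X + c%:P) <->
  homS n c /\ (if (e <= n)%N then phom (n - e)%N p else p = 0).
Proof.
have c0 : (p * 'X + c%:P)`_0 = c by rewrite coefD coefMX coefC add0r.
have cS i : (p * 'X + c%:P)`_i.+1 = p`_i by rewrite coefD coefMX coefC addr0.
split=> [pn|[cn pn]].
  split; first by have := pn 0%N; rewrite c0 muln0 subn0.
  case: leqP => en; last first.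
    apply/polyP => i; rewrite coef0 -cS; have := pn i.+1.
    by rewrite mulnS leqNgt ltn_addr.
  move=> i; have := pn i.+1; rewrite cS mulnS.
  by rewrite -leq_subRL // subnDA.
case=> [|i]; first by rewrite c0 muln0 subn0.
rewrite cS mulnS; case: leqP pn => en pn; last first.
  by rewrite leqNgt ltn_addr // pn coef0.
by have := pn i; rewrite -leq_subRL // subnDA.
Qed.

(** Strong induction on the degree: splitting off the S-part leaves a cofactor of [x] of degree
    [n - e], which is smaller because [e] is positive. *)
Lemma homog_poly n h : homH n h -> exists2 p, phom n p & psi p = h.
Proof.
elim/ltn_ind: n h => n IHn h hn; have [c [g [-> cn gn]]] := homH_split hn.
case: leqP gn => [en gn|ne ->].
  have [|p pn <-] := IHn (n - e)%N _ g gn; first by lia.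
  exists (p * 'X + c%:P); last by rewrite horner_morph_cons addrC.
  by apply/poly_homog_cons; rewrite en.
exists (0 * 'X + c%:P); last by rewrite horner_morph_cons rmorph0 addrC.
by apply/poly_homog_cons; rewrite leqNgt ne.
Qed.

Lemma horner_morph_surj h : exists p, psi p = h.
Proof.
have [L [g [gn ->]]] := homH_sum h; elim/big_rec: _ => [|n y _ [p <-]].
  by exists 0; rewrite rmorph0.
have [p' _ <-] := homog_poly (gn n).
by exists (p' + p); rewrite rmorphD.
Qed.

Lemma poly_homog_image n p : phom n p -> homH n (psi p).
Proof.
elim/poly_ind: p n => [|p c IHp] n; first by rewrite rmorph0.
move=> /poly_homog_cons[cn pn]; rewrite horner_morph_cons; apply: homHD; last exact: homS_sigma.
case: leqP pn => [en /IHp/homHMx|_ ->]; first by rewrite subnK.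
by rewrite rmorph0 mul0r.
Qed.

Theorem graded_polynomial_iso :
  exists phi : {rmorphism H -> {poly S}},
    [/\ bijective phi, forall (c : k) h, phi (c *: h) = c%:A%:P * phi h
      & forall n h, homH n h <-> phom n (phi h)].
Proof.
have /choice[phi phiK] := horner_morph_surj.
have psiK : cancel psi phi by move=> p; apply: horner_morph_inj; rewrite phiK.
have phiB : zmod_morphism phi.
  by move=> g h; apply: horner_morph_inj; rewrite rmorphB /= !phiK.
have phiM : monoid_morphism phi.
  by split=> [|g h]; apply: horner_morph_inj; rewrite ?rmorph1 ?rmorphM /= !phiK.
pose phiZ := GRing.isZmodMorphism.Build H {poly S} phi phiB.
pose phiR := GRing.isMonoidMorphism.Build H {poly S} phi phiM.
pose phi' : {rmorphism H -> {poly S}} := HB.pack phi phiZ phiR.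
exists phi'; split=> [|c h|n h].
- by exists psi.
- apply: horner_morph_inj; rewrite rmorphM /= horner_morphC !phiK.
  by rewrite [X in X * _](rmorph_alg sigma) mulr_algl.
- split=> [/homog_poly[p pn <-]|]; first by rewrite /= psiK.
  by move/poly_homog_image; rewrite /= phiK.
Qed.

End GradedPolynomial.

(** * From the comparison with S to the graded isomorphism *)

Section PolynomialPresentation.
Variables (k : fieldType) (A : algType k) (I : twoSidedIdeal A) (m : nat).
Variables (P : relators k m) (W : lmodType k) (rw : {linear free_alg k m -> W}).
Variables (a : 'I_m -> cocycle I) (X : cocycle I) (e : nat).
Local Notation V := (ideal_type I).
Local Notation H := (cohomology I).
Local Notation S := (presented P).
Local Notation pi := (aq_pi (coboundary_ideal I)).
Local Notation piS := (aq_pi (relator_ideal P)).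
Local Notation fn z := (cochain_val (cocycle_val z)).
Local Notation ev := (free_eval a).
Hypothesis e_gt2 : (2 < e)%N.
Hypothesis a_size : forall i s, size s != 1%N -> fn (a i) s = 0.
Hypothesis X_size : forall s, size s != e -> fn X s = 0.
Hypothesis P_quadratic : forall r, r \in (P : seq _) -> word_homog 2 r.
Hypothesis P_rw : forall r, r \in (P : seq _) -> rw r = 0.
Hypothesis rw_P : forall u, rw u = 0 -> piS u = 0.
Hypothesis exact_words : forall u, rw u = 0 -> exists y, pi (ev u) = pi y * pi X.
Hypothesis generated : forall z, exists u y, pi z = pi (ev u) + pi y * pi X.
Hypothesis mulX_inj : forall y, pi y * pi X = 0 -> pi y = 0.
Hypothesis independent : forall u y, pi (ev u) + pi y * pi X = 0 -> rw u = 0.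
Hypothesis X_comm : forall i, pi X * pi (a i) = pi (a i) * pi X.

Definition homog (n : nat) (z : cocycle I) := forall s : seq V, size s != n -> fn z s = 0.

Lemma component_cocycle_subproof n (z : cocycle I) :
  Cochain (component_cochain n (cocycle_cochain z)) \in is_cocycle (I := I).
Proof.
rewrite unfold_in; apply/eqP/val_inj/funext => s /=.
by rewrite cobar_diff_component /component cocycle_closed if_same.
Qed.

Definition component_cocycle n z := Cocycle (component_cocycle_subproof n z).
Local Notation comp := component_cocycle.

Lemma cocycle_eq (y z : cocycle I) : fn y = fn z -> y = z.
Proof. by move=> yz; apply/val_inj/val_inj. Qed.

Lemma comp_homog n z : homog n z -> comp n z = z.
Proof. by move=> zn; apply: cocycle_eq; exact: componentK. Qed.

Lemma homog_comp n z : homog n (comp n z).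
Proof. by move=> s /negPf sn; rewrite /= /component sn. Qed.

Lemma comp_off n n' z : homog n' z -> n != n' -> comp n z = 0.
Proof.
move=> zn nn; apply: cocycle_eq; apply/funext => s; rewrite /= /component.
by case: eqP => // sn; rewrite zn // sn.
Qed.

Lemma comp_linear n : linear (comp n).
Proof.
move=> c y z; apply: cocycle_eq.
rewrite -[RHS]/(c *: component n (fn y) + component n (fn z)) -component_lin.
exact: erefl.
Qed.
HB.instance Definition _ n :=
  GRing.isLinear.Build k (cocycle I) (cocycle I) *:%R (comp n) (comp_linear n).

(** The differential raises the degree by one, so components of coboundaries are coboundaries; in
    degree 0 coboundaries vanish at the empty list. *)
Lemma comp_pi n y z : pi y = pi z -> pi (comp n y) = pi (comp n z).
Proof.
move=> /pi_eq[h hc yz]; apply/pi_eq; case: n => [|n].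
  exists 0; first exact: rpred0.
  apply/funext => s; rewrite -[RHS]/(component 0 (fn z) s + cobar_diff 0 s).
  have -> : cobar_diff 0 s = 0 :> k^o by rewrite /cobar_diff big1 // => i _; rewrite mulr0.
  rewrite addr0 /= yz /component; case: eqP => // /size0nil ->.
  by rewrite -[LHS]/(fn z [::] + cobar_diff h [::]) cobar_diff_nil addr0.
exists (component n h); first exact: component_cochain.
by rewrite cobar_diff_component -componentD -yz.
Qed.

Lemma homogM n n' y z : homog n y -> homog n' z -> homog (n + n') (y * z).
Proof.
move=> yn zn s sn; rewrite -[LHS]/(conv (fn y) (fn z) s) /conv big1 // => i _.
have := size_cat (take i s) (drop i s); rewrite cat_take_drop => sE.
have [ti|ti] := eqVneq (size (take i s)) n; last by rewrite yn ?mul0r.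
rewrite zn ?mulr0 //; apply: contra sn => /eqP di; by rewrite sE ti di.
Qed.

Lemma homog_lin n c y z : homog n y -> homog n z -> homog n (c *: y + z).
Proof.
move=> yn zn s sn; rewrite -[LHS]/(c *: fn y s + fn z s) yn // zn //.
by rewrite scaler0 addr0.
Qed.

Lemma homog0 n : homog n 0. Proof. by []. Qed.

Lemma homog1 : homog 0 1.
Proof. by move=> [|v s]. Qed.

Lemma homog_word w : homog (size w) (ev (word k w)).
Proof.
rewrite free_eval_word; elim: w => [|i w IHw]; first by rewrite big_nil; exact: homog1.
rewrite big_cons; exact: homogM (@a_size i) IHw.
Qed.

Lemma homog_eval n u : word_homog n u -> homog n (ev u).
Proof.
move=> un; rewrite [u]free_alg_words linear_sum big_seq; apply: big_rec => [|x z xu zn].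
  exact: homog0.
rewrite linearZZ; apply: homog_lin zn.
by rewrite -(un x) ?mcoeff_neq0 //; exact: homog_word.
Qed.

Lemma word_homog_lin n (c : k) (u v : free_alg k m) :
  word_homog n u -> word_homog n v -> word_homog n (c *: u + v).
Proof.
move=> un vn x; rewrite mcoeffD mcoeffZ.
have [u0|/un //] := eqVneq (u@_x) 0; rewrite u0 mulr0 add0r; exact: vn.
Qed.

Lemma word_homog0 n : word_homog n (0 : free_alg k m).
Proof. by move=> x; rewrite mcoeff0 eqxx. Qed.

Lemma comp_eval n u : exists2 v, word_homog n v & comp n (ev u) = ev v.
Proof.
elim/free_alg_ind: u => [w||c u v [u' u'n uE] [v' v'n vE]].
- have [<-|wn] := eqVneq (size w) n.
    exists (word k w); first exact: word_homog_word.
    exact/comp_homog/homog_word.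
  exists 0; first exact: word_homog0.
  by rewrite (comp_off (@homog_word w)) 1?eq_sym // [RHS]linear0.
- exists 0; first exact: word_homog0.
  by rewrite [ev 0]linear0 [LHS]linear0.
- exists (c *: u' + v'); first exact: word_homog_lin.
  by rewrite !linearP /= uE vE.
Qed.

Lemma comp_mulX n (y : cocycle I) :
  (e <= n)%N -> comp n (y * X) = comp (n - e)%N y * X.
Proof.
move=> en; apply: cocycle_eq; rewrite -[RHS]/(conv (component (n - e)%N (fn y)) (fn X)).
by have := conv_component (n - e)%N (fn y) X_size; rewrite subnK // => <-.
Qed.

Lemma comp_mulX0 n (y : cocycle I) : (n < e)%N -> comp n (y * X) = 0.
Proof.
move=> ne; apply: cocycle_eq; apply/funext => s.
rewrite -[LHS]/(component n (conv (fn y) (fn X)) s) /component.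
case: eqP => // sn; rewrite /conv big1 // => i _; rewrite X_size ?mulr0 //.
by rewrite size_drop neq_ltn (leq_ltn_trans (leq_subr _ _)) // sn.
Qed.

Lemma eval_pi u : free_eval (fun i => pi (a i)) u = pi (ev u).
Proof.
elim/free_alg_ind: u => [w||c u v uE vE].
- by rewrite !free_eval_word rmorph_prod.
- by rewrite !linear0.
- by rewrite !linearP /= uE vE.
Qed.

(** The value of a relation is a multiple of X. Its component of degree 2 is the value itself,
    whereas multiples of X have none because [e] exceeds 2. *)
Lemma relation_holds r : r \in (P : seq _) -> free_eval (fun i => pi (a i)) r = 0.
Proof.
move=> rP; have [y ry] := exact_words (P_rw rP).
rewrite eval_pi -(comp_homog (homog_eval (P_quadratic rP))).
rewrite (@comp_pi 2 _ (y * X)) ?comp_mulX0 ?rmorph0 //.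
by rewrite ry rmorphM.
Qed.

Local Notation sigma := (pres_eval relation_holds).

Lemma sigma_pi u : sigma (piS u) = pi (ev u).
Proof. by rewrite pres_eval_pi eval_pi. Qed.

Lemma X_commutes : commr_rmorph sigma (pi X).
Proof.
move=> x; rewrite -[x]aq_reprK pres_eval_pi; apply/commr_sym/free_eval_comm => i.
exact/commr_sym/X_comm.
Qed.

Lemma class_sum_inj c h : sigma c + h * pi X = 0 -> c = 0 /\ h = 0.
Proof.
rewrite -[h]aq_reprK -[c]aq_reprK sigma_pi => ch.
have c0 := rw_P (independent ch); move: ch.
by rewrite -sigma_pi c0 (raddf0 sigma) add0r => /mulX_inj.
Qed.

(** Take the component of degree [n] of a decomposition given by [generated]: components of words
    are words, and those of multiples of X are multiples of X. *)
Lemma cohom_homog_split n (h : H) : cohom_homog n h -> exists c g,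
  [/\ h = sigma c + g * pi X, pres_homog n c
    & if (e <= n)%N then cohom_homog (n - e)%N g else g = 0].
Proof.
move=> [z zn <-]; have [u [y zE]] := generated z.
have [v vn vE] := comp_eval n u.
have {}zE : pi z = sigma (piS v) + pi (comp n (y * X)).
  rewrite -{1}(comp_homog zn) sigma_pi -vE -rmorphD -linearD; apply: comp_pi.
  by rewrite rmorphD rmorphM.
exists (piS v); rewrite zE; case: leqP => en.
  exists (pi (comp (n - e)%N y)); split; [|by exists v |].
    by rewrite comp_mulX // rmorphM.
  by exists (comp (n - e)%N y) => //; exact: homog_comp.
exists 0; split; [| by exists v | by []].
by rewrite comp_mulX0 // rmorph0 mul0r.
Qed.

Lemma cohom_homog_sum (h : H) : exists (L : nat) (g : nat -> H),
  (forall n, cohom_homog n (g n)) /\ h = \sum_(n < L) g n.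
Proof.
rewrite -[h]aq_reprK; move: (repr h) => z.
have /asboolP[_ [L zL]] := cocycle_cochain z.
exists L.+1, (fun n => pi (comp n z)); split=> [n|].
  by exists (comp n z) => //; exact: homog_comp.
rewrite -rmorph_sum; congr pi.
apply: cocycle_eq; apply/funext => s.
have evS (J : seq nat) : fn (\sum_(n <- J) comp n z) s = \sum_(n <- J) fn (comp n z) s.
  by elim/big_rec2: _ => // i x y _ <-.
rewrite -(big_mkord xpredT (fun n => comp n z)) evS /= /component.
have [sL|sL] := ltnP (size s) L.+1; last first.
  by rewrite zL // big1_seq // => i; rewrite if_same.
rewrite (bigD1_seq (size s)) ?mem_index_iota ?iota_uniq //= eqxx big1 ?addr0 // => i.
by rewrite eq_sym => /negPf ->.
Qed.

Theorem polynomial_presentation :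
  exists phi : {rmorphism H -> {poly S}},
    [/\ bijective phi, forall (c : k) x, phi (c *: x) = c%:A%:P * phi x
      & forall n x, cohom_homog n x <-> poly_homog (@pres_homog _ _ P) e n (phi x)].
Proof.
apply: (@graded_polynomial_iso k S H sigma (pi X) (@pres_homog _ _ P) (@cohom_homog _ _ I) e).
- exact: ltnW (ltnW e_gt2).
- exact: X_commutes.
- exact: class_sum_inj.
- move=> n c [u un <-]; exists (ev u); [exact: homog_eval | exact/esym/sigma_pi].
- by move=> n; exists 0; rewrite ?rmorph0.
- move=> n g h [y yn <-] [z zn <-]; exists (y + z); last exact: rmorphD.
  by rewrite -[y]scale1r; apply: homog_lin.
- move=> n h [z zn <-]; exists (z * X); last exact: rmorphM.
  exact: homogM zn X_size.
- exact: cohom_homog_split.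
- exact: cohom_homog_sum.
Qed.

End PolynomialPresentation.

(** * Linear maps given by sparse integer tables *)

(* Matrices with twelve columns are handled through their flattened coordinates *)
(* 12 * row + column, so that linear maps with integer coefficients become      *)
(* sparse integer tables, whose identities are decided by computation.          *)
Definition sparse := seq (nat * int).

Definition coef (s : sparse) (q : nat) : int :=
  foldr (fun x a => if x.1 == q then x.2 + a else a) 0 s.

Definition same_coef (m : nat) (s t : sparse) : bool :=
  all (fun q => coef s q == coef t q) (iota 0 (12 * m)).

Definition table_vec (A : seq sparse) (s : sparse) : sparse :=
  flatten [seq [seq (p.1, x.2 * p.2) | p <- nth [::] A x.1] | x <- s].

Definition table_comp (B A : seq sparse) : seq sparse := [seq table_vec B s | s <- A].

Definition table_add (m : nat) (A B : seq sparse) : seq sparse :=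
  mkseq (fun q => nth [::] A q ++ nth [::] B q) (12 * m).

Definition table_id (m : nat) : seq sparse := mkseq (fun q => [:: (q, 1)]) (12 * m).

Definition table_eq (m : nat) (A B : seq sparse) : bool :=
  all (fun q => same_coef m (nth [::] A q) (nth [::] B q)) (iota 0 (12 * m)).

(** The table of right multiplication of m x 12 matrices by the 12 x 12 matrix with flattened
    coordinates [s] ([mulmx_vec]). *)
Definition table_mulr (m : nat) (s : sparse) : seq sparse :=
  mkseq (fun q => [seq ((12 * (q %/ 12) + p.1 %% 12)%N, p.2)
                  | p <- s & (p.1 %/ 12 == q %% 12)%N]) (12 * m).

Lemma eq_flat (r r' l l' : nat) : (l < 12)%N -> (l' < 12)%N ->
  (12 * r + l == 12 * r' + l')%N = (r == r') && (l == l').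
Proof. by move=> l12 l'12; lia. Qed.

Section Tables.
Variables (k : fieldType) (m : nat).
Local Notation M := 'M[k]_(m, 12).

Definition coord_mx (q : nat) : M := \matrix_(r, l) (12 * r + l == q)%N%:R.

Definition vec (s : sparse) : M := \sum_(x <- s) x.2%:~R *: coord_mx x.1.

Definition table_fun (A : seq sparse) (n : M) : M :=
  \sum_(r < m) \sum_(l < 12) n r l *: vec (nth [::] A (12 * r + l)).

Fact table_fun_linear A : linear (table_fun A).
Proof.
move=> c n p; rewrite /table_fun scaler_sumr -big_split; apply: eq_bigr => r _.
rewrite scaler_sumr -big_split; apply: eq_bigr => l _ /=.
by rewrite !mxE scalerDl scalerA.
Qed.
HB.instance Definition _ A :=
  GRing.isLinear.Build k M M *:%R (table_fun A) (table_fun_linear A).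

Lemma mx_coord (n : M) : n = \sum_(r < m) \sum_(l < 12) n r l *: coord_mx (12 * r + l).
Proof.
apply/matrixP => i j; rewrite summxE (bigD1 i) //= summxE (bigD1 j) //=.
rewrite !mxE eqxx mulr1 !big1 ?addr0 // => [r ri|l lj].
  rewrite summxE big1 // => l _; rewrite !mxE eq_flat //.
  by rewrite eq_sym (negPf ri : (r == i :> nat) = false) mulr0.
by rewrite !mxE eq_flat // eqxx eq_sym (negPf lj : (l == j :> nat) = false) mulr0.
Qed.

Lemma vec_nil : vec [::] = 0.
Proof. exact: big_nil. Qed.

Lemma vec_cat s t : vec (s ++ t) = vec s + vec t.
Proof. exact: big_cat. Qed.

Lemma vecE s r l : vec s r l = (coef s (12 * r + l))%:~R.
Proof.
elim: s => [|x s IHs]; first by rewrite vec_nil mxE.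
rewrite /vec big_cons -/(vec s) !mxE IHs /= eq_sym.
by case: eqP => _; rewrite ?mulr0 ?add0r // mulr1 intrD.
Qed.

Lemma vec_same s t : same_coef m s t -> vec s = vec t.
Proof.
move=> /allP st; apply/matrixP => r l; rewrite !vecE; congr (_%:~R); apply/eqP/st.
by rewrite mem_iota add0n; have := ltn_ord r; have := ltn_ord l; lia.
Qed.

Lemma table_fun_coord A q : (size A <= 12 * m)%N ->
  table_fun A (coord_mx q) = vec (nth [::] A q).
Proof.
move=> sA; case: (ltnP q (12 * m)) => qm; last first.
  rewrite nth_default ?vec_nil ?(leq_trans sA) // (_ : coord_mx q = 0) ?linear0 //.
  apply/matrixP => r l; rewrite !mxE; case: eqP => // e.
  by have := ltn_ord r; have := ltn_ord l; lia.
have rm : (q %/ 12 < m)%N by lia.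
have lm : (q %% 12 < 12)%N by lia.
rewrite /table_fun (bigD1 (Ordinal rm)) //= (bigD1 (Ordinal lm)) //= mxE /=.
have qE : (12 * (q %/ 12) + q %% 12)%N = q by lia.
rewrite {1}qE eqxx scale1r !big1 ?addr0 ?qE // => [r ri|l lj].
  rewrite big1 // => l _; rewrite mxE -{1}qE eq_flat //.
  by rewrite (negPf ri : (r == q %/ 12 :> nat)%N = false) scale0r.
by rewrite mxE -{2}qE eq_flat // (negPf lj : (l == q %% 12 :> nat)%N = false) andbF scale0r.
Qed.

Lemma table_fun_vec A s : (size A <= 12 * m)%N ->
  table_fun A (vec s) = vec (table_vec A s).
Proof.
move=> sA; elim: s => [|x s IHs]; first by rewrite vec_nil linear0.
rewrite /vec big_cons -/(vec s) linearP /= IHs [table_vec _ _]/= -/(vec _) vec_cat.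
congr (_ + _); rewrite table_fun_coord // /vec big_map scaler_sumr.
by apply: eq_bigr => p _; rewrite scalerA intrM.
Qed.

Lemma table_fun_comp B A n : (size B <= 12 * m)%N ->
  table_fun B (table_fun A n) = table_fun (table_comp B A) n.
Proof.
move=> sB; rewrite [table_fun A n]/table_fun linear_sum; apply: eq_bigr => r _.
rewrite linear_sum; apply: eq_bigr => l _; rewrite linearZ /= table_fun_vec //.
congr (_ *: vec _); case: (ltnP (12 * r + l) (size A)) => rA.
  by rewrite (nth_map [::]).
by rewrite !nth_default ?size_map.
Qed.

Lemma table_fun_add A B n :
  table_fun (table_add m A B) n = table_fun A n + table_fun B n.
Proof.
rewrite /table_fun -big_split; apply: eq_bigr => r _.
rewrite -big_split; apply: eq_bigr => l _ /=.
rewrite nth_mkseq ?vec_cat ?scalerDr //.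
by have := ltn_ord r; have := ltn_ord l; lia.
Qed.

Lemma table_fun_id n : table_fun (table_id m) n = n.
Proof.
rewrite [RHS]mx_coord; apply: eq_bigr => r _; apply: eq_bigr => l _.
rewrite nth_mkseq; last by have := ltn_ord r; have := ltn_ord l; lia.
by rewrite /vec big_seq1 scale1r.
Qed.

Lemma table_fun_eq A B n : table_eq m A B -> table_fun A n = table_fun B n.
Proof.
move=> /allP AB; apply: eq_bigr => r _; apply: eq_bigr => l _; congr (_ *: _).
apply/vec_same/AB; rewrite mem_iota add0n.
by have := ltn_ord r; have := ltn_ord l; lia.
Qed.

End Tables.

Lemma size_table_mulr m s : size (table_mulr m s) = (12 * m)%N.
Proof. exact: size_mkseq. Qed.

Lemma coord_mulmx (k : fieldType) (m r l : nat) (s : sparse) :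
  (r < m)%N -> (l < 12)%N ->
  coord_mx k m (12 * r + l) *m vec k 12 s
    = vec k m (nth [::] (table_mulr m s) (12 * r + l)).
Proof.
move=> rm lm; rewrite nth_mkseq; last by lia.
rewrite (_ : (12 * r + l) %/ 12 = r)%N; last by lia.
rewrite (_ : (12 * r + l) %% 12 = l)%N; last by lia.
elim: s => [|x s IHs]; first by rewrite /= !vec_nil mulmx0.
rewrite /vec big_cons -/(vec _ _ s) mulmxDr -scalemxAr IHs /=.
have cE : coord_mx k m (12 * r + l) *m coord_mx k 12 x.1 =
    if (x.1 %/ 12 == l)%N then coord_mx k m (12 * r + x.1 %% 12) else 0.
  apply/matrixP => i j; rewrite !mxE (bigD1 (Ordinal lm)) //= !mxE big1 => [|p pl].
    rewrite addr0 eq_flat // eqxx andbT -natrM mulnb.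
    have -> : (12 * l + j == x.1)%N = (x.1 %/ 12 == l)%N && (j == x.1 %% 12 :> nat)%N.
      by have := ltn_ord j; lia.
    case: (_ %/ _ == _)%N; last by rewrite mxE andbF.
    by rewrite mxE eq_flat ?ltn_mod // eq_sym.
  by rewrite !mxE eq_flat // (negPf pl : (p == l :> nat) = false) andbF mul0r.
rewrite cE; case: ifP => _; last by rewrite scaler0 add0r.
by rewrite /vec big_cons.
Qed.

Lemma mulmx_vec (k : fieldType) (m : nat) (n : 'M[k]_(m, 12)) (s : sparse) :
  n *m vec k 12 s = table_fun (table_mulr m s) n.
Proof.
rewrite {1}[n]mx_coord mulmx_suml; apply: eq_bigr => r _.
rewrite mulmx_suml; apply: eq_bigr => l _.
by rewrite -scalemxAl coord_mulmx.
Qed.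

(** * The Fomin-Kirillov algebra *)

(* Left multiplication by the generator x in the basis 1, a, b, c, ab, bc, ba,  *)
(* cb, aba, abc, bcb, abcb: the pair (12 * i + j, z) means that the i-th basis  *)
(* element has coefficient z in the product of x and the j-th one.              *)
Definition left_table (x : nat) : sparse := nth [::]
  [:: [:: (12%N, 1); (50%N, 1); (75%N, -1); (87%N, -1); (102%N, 1); (103%N, -1); (113%N, 1); (142%N, 1)];
      [:: (24%N, 1); (63%N, 1); (73%N, 1); (100%N, 1); (127%N, 1); (141%N, -1)];
      [:: (36%N, 1); (49%N, -1); (61%N, -1); (86%N, 1); (114%N, 1); (124%N, -1); (125%N, 1); (140%N, 1)]] x.

Definition left_column (x l : nat) : sparse :=
  [seq ((p.1 %/ 12)%N, p.2) | p <- left_table x & (p.1 %% 12 == l)%N].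

(** * The multiplication table of B from its relations *)

Section FKRelations.
Variables (R : nzRingType) (a b c : R).
Hypotheses (aa : a * a = 0) (bb : b * b = 0) (cc : c * c = 0).
Hypotheses (ca : c * a = - (a * b) - b * c) (ac : a * c = - (b * a) - c * b).

(** Reduce the overlap caa in two ways: it is 0 by [aa], and expanding ca twice gives bab - aba. The
    next lemma treats the overlap acc similarly. *)
Lemma fk_bab : b * a * b = a * b * a.
Proof.
have : c * a * a = b * a * b - a * b * a.
  rewrite ca mulrBl mulNr -[b * c * a]mulrA ca mulrBr mulrN !mulrA bb mul0r.
  by rewrite subr0 opprK addrC.
by rewrite -mulrA aa mulr0 => /esym/eqP; rewrite subr_eq0 => /eqP.
Qed.

Lemma fk_cbc : c * b * c = b * c * b.
Proof.
have : a * c * c = b * c * b - c * b * c.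
  rewrite ac mulrBl mulNr -[b * a * c]mulrA ac mulrBr mulrN !mulrA bb mul0r.
  by rewrite oppr0 sub0r opprK.
by rewrite -mulrA cc mulr0 => /esym/eqP; rewrite subr_eq0 => /eqP.
Qed.

Lemma fk_cba : c * b * a = a * b * c.
Proof.
have -> : c * b = - (a * c) - b * a by rewrite ac opprB opprK addrK.
rewrite mulrBl mulNr -[a * c * a]mulrA -[b * a * a]mulrA aa mulr0 subr0 ca.
by rewrite mulrBr mulrN mulrA aa mul0r oppr0 sub0r opprK mulrA.
Qed.

Lemma fk_acb : a * c * b = - (a * b * a).
Proof. by rewrite ac mulrBl mulNr fk_bab -[c * b * b]mulrA bb mulr0 subr0. Qed.

Lemma fk_cab : c * a * b = - (b * c * b).
Proof. by rewrite ca mulrBl mulNr -[a * b * b]mulrA bb mulr0 oppr0 sub0r. Qed.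

Lemma fk_babc : b * a * b * c = - (a * b * c * b).
Proof.
rewrite fk_bab -[a * b * a * c]mulrA ac mulrBr mulrN !mulrA.
by rewrite -[a * b * b]mulrA bb mulr0 mul0r oppr0 sub0r.
Qed.

Lemma fk_caba : c * a * b * a = a * b * c * b.
Proof.
by rewrite fk_cab mulNr -!mulrA [c * (b * a)]mulrA fk_cba !mulrA fk_babc opprK.
Qed.

Lemma fk_baba : b * a * b * a = 0.
Proof. by rewrite fk_bab -[a * b * a * a]mulrA aa mulr0. Qed.

Lemma fk_cbcb : c * b * c * b = 0.
Proof. by rewrite fk_cbc -[b * c * b * b]mulrA bb mulr0. Qed.

Lemma fk_babcb : b * a * b * c * b = 0.
Proof. by rewrite fk_babc mulNr -[a * b * c * b * b]mulrA bb mulr0 oppr0. Qed.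

Lemma fk_cabc : c * a * b * c = 0.
Proof.
rewrite fk_cab mulNr -[b * c * b * c]mulrA -!mulrA [c * (b * c)]mulrA fk_cbc !mulrA.
by rewrite bb !mul0r oppr0.
Qed.

Definition fk_base (l : nat) : R :=
  nth 0 [:: 1; a; b; c; a * b; b * c; b * a; c * b; a * b * a; a * b * c;
         b * c * b; a * b * c * b] l.

Lemma fk_mul_base (x l : nat) : (x < 3)%N -> (l < 12)%N ->
  nth 0 [:: a; b; c] x * fk_base l =
  \sum_(p <- left_column x l) p.2%:~R * fk_base p.1.
Proof.
case: x => [|[|[|//]]] _;
  (case: l => [|[|[|[|[|[|[|[|[|[|[|[|//]]]]]]]]]]]] _).
(* Evaluate the table column so that the sum unfolds; the products not settled by the squares are
   the identities above. *)
all: match goal with |- context [left_column ?x ?l] =>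
    let s := eval vm_compute in (left_column x l) in
    change (left_column x l) with s end.
all: rewrite !(big_cons, big_nil) /=.
all: rewrite /fk_base /=.
all: rewrite ?mulr1 ?mulrA ?addr0 ?mulN1r ?mul1r.
all: rewrite ?aa ?bb ?cc ?mul0r ?mulNr.
all: try reflexivity.
- exact: ac.
- exact: fk_acb.
- exact: fk_bab.
- exact: fk_baba.
- exact: fk_babc.
- exact: fk_babcb.
- exact: ca.
- exact: fk_cab.
- exact: fk_cbc.
- exact: fk_cba.
- exact: fk_caba.
- exact: fk_cabc.
- exact: fk_cbcb.
- by rewrite fk_cabc mul0r.
Qed.

End FKRelations.

Lemma vec_column (k : fieldType) (W : lmodType k) (e : nat -> W) (s : sparse) (l : 'I_12) :
  all (fun p => p.1 < 144)%N s ->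
  \sum_(l' < 12) vec k 12 s l' l *: e l' =
  \sum_(p <- s | (p.1 %% 12 == l)%N) p.2%:~R *: e (p.1 %/ 12)%N.
Proof.
elim: s => [_|p s IHs /= /andP[p144 s144]].
  by rewrite big_nil big1 // => l' _; rewrite vec_nil mxE scale0r.
have p12 : (p.1 %/ 12 < 12)%N by lia.
rewrite big_cons -IHs // /vec big_cons.
under eq_bigr => l' _ do rewrite mxE scalerDl.
rewrite big_split /= (bigD1 (Ordinal p12)) //= big1 => [|l' l'p]; last first.
  rewrite !mxE (_ : (12 * l' + l == p.1)%N = false) ?mulr0 ?scale0r //.
  apply/negP => /eqP e'; move/eqP: l'p; apply; apply: val_inj => /=.
  by have := ltn_ord l; lia.
rewrite addr0 !mxE (_ : (12 * (p.1 %/ 12) + l == p.1)%N = (p.1 %% 12 == l)%N); last first.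
  by have := ltn_ord l; lia.
by case: eqP => _; rewrite ?mulr1 // mulr0 scale0r add0r.
Qed.

Definition fk_mx (k : fieldType) (i : 'I_3) : 'M[k]_12 := vec k 12 (left_table i).

Section FKDecomposition.
Variables (k : fieldType) (R : algType k) (g : 'I_3 -> R).
Local Notation i0 := (@Ordinal 3 0 isT).
Local Notation i1 := (@Ordinal 3 1 isT).
Local Notation i2 := (@Ordinal 3 2 isT).
Hypothesis g_rel : [/\ g i0 * g i0 = 0, g i1 * g i1 = 0, g i2 * g i2 = 0,
  g i2 * g i0 = - (g i0 * g i1) - g i1 * g i2
  & g i0 * g i2 = - (g i1 * g i0) - g i2 * g i1].
Hypothesis g_ind : forall Q : R -> Prop, Q 1 -> Q 0 ->
    (forall i u, Q u -> Q (g i * u)) ->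
    (forall c u v, Q u -> Q v -> Q (c *: u + v)) -> forall u, Q u.
Variable rho : {lrmorphism R -> 'M[k]_12}.
Hypothesis rho_gen : forall i, rho (g i) = fk_mx k i.
Local Notation e := (fk_base (g i0) (g i1) (g i2)).

Lemma fk_gen_base (x : 'I_3) (l : 'I_12) :
  g x * e l = \sum_(l' < 12) fk_mx k x l' l *: e l'.
Proof.
have [aa bb cc ca ac] := g_rel.
have := fk_mul_base aa bb cc ca ac (ltn_ord x) (ltn_ord l).
have -> : nth 0 [:: g i0; g i1; g i2] x = g x.
  by case: x => [[|[|[|//]]] p] /=; congr g; apply: val_inj.
rewrite /left_column big_map big_filter /= => ->; rewrite vec_column; last first.
  by case: x => [[|[|[|//]]] p].
by apply: eq_bigr => p _; rewrite -[in RHS]mulr_algl -in_algE rmorph_int.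
Qed.

(** The first column of the left regular representation is the image of 1, that is, the coordinates
    of [u]; induction on left multiplication by generators. *)
Lemma fk_base_decomposition (u : R) : u = \sum_(l < 12) rho u l 0 *: e l.
Proof.
elim/g_ind: u => [||i u IHu|c u v IHu IHv].
- rewrite rmorph1 (bigD1 ord0) //= mxE scale1r big1 ?addr0 // => l l0.
  by rewrite mxE (negPf l0) scale0r.
- by rewrite rmorph0 big1 // => l _; rewrite mxE scale0r.
- rewrite {1}IHu mulr_sumr rmorphM /= rho_gen.
  under eq_bigr => l _ do rewrite -scalerAr fk_gen_base scaler_sumr.
  rewrite exchange_big; apply: eq_bigr => l' _ /=.
  rewrite -[fk_mx k i * _]/(fk_mx k i *m _) mxE scaler_suml; apply: eq_bigr => l _.
  by rewrite scalerA mulrC.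
- rewrite {1}IHu {1}IHv scaler_sumr -big_split; apply: eq_bigr => l _ /=.
  by rewrite linearP !mxE scalerDl scalerA.
Qed.

(** This makes the twelve spanning monomials independent: each is a word of length at most 4, whose
    matrix is computed. *)
Lemma rho_base (l l' : 'I_12) : rho (e l) l' 0 = (l' == l)%:R.
Proof.
have mE s i : vec k 12 s * rho (g i) = vec k 12 (table_vec (table_mulr 12 (left_table i)) s).
  by rewrite rho_gen -[LHS]/(_ *m _) mulmx_vec table_fun_vec // size_table_mulr.
pose M t (i : 'I_3) := table_vec (table_mulr 12 (left_table i)) t.
have gE i : rho (g i) = vec k 12 (left_table i) by rewrite rho_gen.
have g2 i j : rho (g i * g j) = vec k 12 (M (left_table i) j).
  by rewrite rmorphM /= [rho (g i)]gE mE.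
have g3 i j h : rho (g i * g j * g h) = vec k 12 (M (M (left_table i) j) h).
  by rewrite rmorphM /= g2 mE.
have g4 i j h t : rho (g i * g j * g h * g t) = vec k 12 (M (M (M (left_table i) j) h) t).
  by rewrite rmorphM /= g3 mE.
have [->|l0] := eqVneq l ord0; first by rewrite -[e _]/(1 : R) rmorph1 mxE.
have [s es /allP/(_ l')] : exists2 s, rho (e l) = vec k 12 s &
    all (fun l' => coef s (12 * l')%N == (l' == l)%:Z) (iota 0 12).
  case: l l0 => [[|[|[|[|[|[|[|[|[|[|[|[|//]]]]]]]]]]]] p] // _;
  (eexists; [first [exact: gE | exact: g2 | exact: g3 | exact: g4] | by vm_compute]).
rewrite mem_iota ltn_ord => /(_ isT)/eqP; rewrite es vecE addn0 => ->.
by rewrite -val_eqE; case: eqP.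
Qed.

End FKDecomposition.

(** * The regular representation of B *)

Section FKAlgebra.
Variable k : fieldType.
Local Notation B := (fk_alg k).
Local Notation fk_rel := (Relators (fk_relations_aug k)).
Local Notation pi := (aq_pi (relator_ideal fk_rel)).
Local Notation i0 := (@Ordinal 3 0 isT).
Local Notation i1 := (@Ordinal 3 1 isT).
Local Notation i2 := (@Ordinal 3 2 isT).
Local Notation V := (ideal_type (fk_aug_ideal k)).

Definition fk_gen (i : 'I_3) : B := pi (free_var k i).

Lemma fk_gen_rel : [/\ fk_gen i0 * fk_gen i0 = 0, fk_gen i1 * fk_gen i1 = 0,
  fk_gen i2 * fk_gen i2 = 0,
  fk_gen i2 * fk_gen i0 = - (fk_gen i0 * fk_gen i1) - fk_gen i1 * fk_gen i2
  & fk_gen i0 * fk_gen i2 = - (fk_gen i1 * fk_gen i0) - fk_gen i2 * fk_gen i1].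
Proof.
have rel n : (n < 5)%N -> pi (nth 0 (fk_relations k) n) = 0.
  by move=> n5; apply: (@pi_relator _ _ fk_rel); apply: mem_nth.
split; rewrite /fk_gen.
- rewrite -(rmorphM pi); exact: (rel 0%N).
- rewrite -(rmorphM pi); exact: (rel 1%N).
- rewrite -(rmorphM pi); exact: (rel 2%N).
- apply/eqP; rewrite -opprD -addr_eq0 addrC -!(rmorphM pi) -!(rmorphD pi); apply/eqP.
  exact: (rel 3%N).
- apply/eqP; rewrite -opprD -addr_eq0 addrC -!(rmorphM pi) -!(rmorphD pi); apply/eqP.
  exact: (rel 4%N).
Qed.

Local Notation fk_mx := (fk_mx k).

Lemma fk_mxM i j : fk_mx i * fk_mx j =
  vec k 12 (table_vec (table_mulr 12 (left_table j)) (left_table i)).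
Proof.
by rewrite -[LHS]/(_ *m _) mulmx_vec table_fun_vec // size_table_mulr.
Qed.

Lemma fk_mx_rel r : r \in fk_relations k -> free_eval fk_mx r = 0.
Proof.
have mM i j : free_eval fk_mx (free_var k i * free_var k j) =
    vec k 12 (table_vec (table_mulr 12 (left_table j)) (left_table i)).
  by rewrite rmorphM /= !free_eval_var fk_mxM.
have mD i j i' j' i'' j'' : free_eval fk_mx (free_var k i * free_var k j
      + free_var k i' * free_var k j' + free_var k i'' * free_var k j'') =
    vec k 12 (table_vec (table_mulr 12 (left_table j)) (left_table i)
      ++ table_vec (table_mulr 12 (left_table j')) (left_table i')
      ++ table_vec (table_mulr 12 (left_table j'')) (left_table i'')).
  rewrite !vec_cat addrA.
  apply: etrans (rmorphD (free_eval fk_mx) _ _) _; congr (_ + _); last exact: mM.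
  apply: etrans (rmorphD (free_eval fk_mx) _ _) _; congr (_ + _); exact: mM.
move=> /(nthP 0)[n n5 <-].
case: n n5 => [|[|[|[|[|//]]]]] _.
- rewrite -[nth _ _ _]/(free_var k i0 * free_var k i0) mM -(vec_nil k 12).
  by apply: vec_same; vm_compute.
- rewrite -[nth _ _ _]/(free_var k i1 * free_var k i1) mM -(vec_nil k 12).
  by apply: vec_same; vm_compute.
- rewrite -[nth _ _ _]/(free_var k i2 * free_var k i2) mM -(vec_nil k 12).
  by apply: vec_same; vm_compute.
- rewrite [LHS](mD i0 i1 i1 i2 i2 i0) -(vec_nil k 12).
  by apply: vec_same; vm_compute.
- rewrite [LHS](mD i1 i0 i2 i1 i0 i2) -(vec_nil k 12).
  by apply: vec_same; vm_compute.
Qed.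

Definition rho : {lrmorphism B -> 'M[k]_12} := pres_eval (P := fk_rel) fk_mx_rel.

Lemma rho_gen i : rho (fk_gen i) = fk_mx i.
Proof. by rewrite /rho /= pres_eval_pi free_eval_var. Qed.

Definition fk_basis : nat -> B := fk_base (fk_gen i0) (fk_gen i1) (fk_gen i2).

Lemma fk_word_ind (Q : B -> Prop) : Q 1 -> Q 0 ->
    (forall i u, Q u -> Q (fk_gen i * u)) ->
    (forall c u v, Q u -> Q v -> Q (c *: u + v)) ->
  forall u, Q u.
Proof.
move=> Q1 Q0 Qg Ql; apply: pres_ind => // w.
elim: w => [|i w IHw]; first by rewrite word_nil rmorph1.
by rewrite word_cons rmorphM; apply: Qg.
Qed.

Lemma fk_decomposition (u : B) : u = \sum_(l < 12) rho u l 0 *: fk_basis l.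
Proof.
exact: (fk_base_decomposition fk_gen_rel fk_word_ind rho_gen).
Qed.

Definition basis_deg (l : nat) : nat := nth 0%N [:: 0; 1; 1; 1; 2; 2; 2; 2; 3; 3; 3; 4]%N l.

Lemma fk_mx_deg i (l' l : 'I_12) : fk_mx i l' l != 0 -> basis_deg l' = (basis_deg l).+1.
Proof.
rewrite vecE => c0; apply/eqP; move: c0; apply: contraTT => h.
have /allP := (isT : all (fun x => all (fun l' => all (fun l =>
  (coef (left_table x) (12 * l' + l) == 0) || (basis_deg l' == (basis_deg l).+1))
  (iota 0 12)) (iota 0 12)) (iota 0 3)).
move=> /(_ i); rewrite mem_iota ltn_ord => /(_ isT)/allP/(_ l').
rewrite mem_iota ltn_ord => /(_ isT)/allP/(_ l).
rewrite mem_iota ltn_ord => /(_ isT); rewrite (negPf h) orbF => /eqP->.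
by rewrite negbK.
Qed.

Lemma rho_word_deg w (l' l : 'I_12) :
  rho (pi (word k w)) l' l != 0 -> basis_deg l' = (basis_deg l + size w)%N.
Proof.
elim: w l' => [|i w IHw] l'.
  rewrite word_nil !rmorph1 mxE addn0; case: (l' =P l) => [->//|_].
  by rewrite eqxx.
rewrite word_cons !rmorphM /= rho_gen -[fk_mx i * _]/(fk_mx i *m _) mxE.
case: (pickP (fun j => fk_mx i l' j * rho (pi (word k w)) j l != 0)) => [j /=|h].
  rewrite mulf_eq0 negb_or => /andP[/fk_mx_deg-> /IHw->] _.
  by rewrite addnS.
by rewrite big1 ?eqxx // => j _; apply/eqP; rewrite -[_ == 0]negbK h.
Qed.

(** A word acts by raising the degree of basis elements by its length, and the augmentation ideal
    involves only nonempty words. *)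
Lemma rho_aug (v : V) (l' l : 'I_12) :
  (basis_deg l' <= basis_deg l)%N -> rho (val v) l' l = 0.
Proof.
case: v => v /= /asboolP[u /eqP u0 <-] ll.
have piZ c w : rho (pi (c *: w)) = c *: rho (pi w).
  by rewrite [pi _](linearZZ pi) (linearZZ rho).
rewrite [u]free_alg_words !raddf_sum summxE big1 // => m _ /=.
rewrite piZ mxE.
have [m0|m0] := eqVneq (m : seq _) [::].
  suff -> : u@_m = 0 by rewrite mul0r.
  by rewrite -u0; congr (_@__); apply/eqP; rewrite fmP m0 [mone]fmoneE.
apply/eqP; rewrite mulf_eq0; apply/orP; right; apply/negPn/negP => /rho_word_deg e.
by move: ll; rewrite e -{2}[basis_deg l]addn0 leq_add2l leqn0 size_eq0 (negPf m0).
Qed.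

End FKAlgebra.

(** * Tables of the Koszul complex *)

(* Right multiplication, with the conventions of left_table.                    *)
Definition right_table (x : nat) : sparse := nth [::]
  [:: [:: (12%N, 1); (51%N, -1); (63%N, -1); (74%N, 1); (100%N, 1); (101%N,
   -1); (115%N, 1); (142%N, -1)]; [:: (24%N, 1); (49%N, 1); (87%N, 1);
   (102%N, 1); (125%N, 1); (141%N, 1)]; [:: (36%N, 1); (62%N, 1); (73%N,
   -1); (85%N, -1); (112%N, 1); (126%N, -1); (127%N, 1); (140%N, -1)]] x.

(* As right_table x squares to 0, it has a contracting homotopy; this is one.   *)
Definition right_inv_table (x : nat) : sparse := nth [::]
  [:: [:: (1%N, 1); (30%N, 1); (40%N, -1); (68%N, -1); (93%N, 1); (131%N,
   -1)]; [:: (2%N, 1); (16%N, 1); (17%N, -1); (42%N, -1); (43%N, 1); (58%N,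
   1); (70%N, 1); (80%N, 1); (92%N, 1); (119%N, 1)]; [:: (3%N, 1); (19%N,
   -1); (29%N, 1); (57%N, 1); (82%N, -1); (107%N, -1)]] x.

(* The contracting homotopy from level t to level t - 1, for t = 1, 2, 3, found *)
(* by solving linear systems; in higher levels there is a uniform one.          *)
Definition low_kap1 : seq (nat * sparse) :=
  [:: (0%N, [:: (1%N, 1); (13%N, 1); (25%N, 1); (37%N, 1)]); (12%N, [::
   (2%N, 1); (14%N, 1); (26%N, 1); (38%N, 1)]); (13%N, [:: (4%N, 1); (16%N,
   1); (28%N, 1); (40%N, 1)]); (15%N, [:: (6%N, -1); (7%N, 1); (18%N, -1);
   (19%N, 1); (30%N, -1); (31%N, 1); (42%N, -1); (43%N, 1)]); (18%N, [::
   (8%N, 1); (20%N, 1); (32%N, 1); (44%N, 1)]); (24%N, [:: (3%N, 1); (15%N,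
   1); (27%N, 1); (39%N, 1)]); (25%N, [:: (6%N, -1); (18%N, -1); (30%N, -1);
   (42%N, -1)]); (26%N, [:: (5%N, 1); (17%N, 1); (29%N, 1); (41%N, 1)]);
   (28%N, [:: (9%N, 1); (21%N, 1); (33%N, 1); (45%N, 1)]); (31%N, [:: (10%N,
   1); (22%N, 1); (34%N, 1); (46%N, 1)]); (32%N, [:: (11%N, -1); (23%N, -1);
   (35%N, -1); (47%N, -1)])].

Definition low_kap2 : seq (nat * sparse) :=
  [:: (0%N, [:: (1%N, 1); (37%N, 1)]); (12%N, [:: (14%N, 1); (50%N, 1)]);
   (15%N, [:: (4%N, 1); (19%N, 1); (40%N, 1); (55%N, 1)]); (24%N, [:: (27%N,
   1); (63%N, 1)]); (25%N, [:: (16%N, -1); (17%N, 1); (30%N, -1); (52%N,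
   -1); (53%N, 1); (66%N, -1)]); (26%N, [:: (6%N, -1); (7%N, 1); (29%N, 1);
   (42%N, -1); (43%N, 1); (65%N, 1)]); (28%N, [:: (8%N, -1); (22%N, -1);
   (33%N, 1); (44%N, -1); (58%N, -1); (69%N, 1)]); (31%N, [:: (9%N, -1);
   (20%N, 1); (34%N, 1); (45%N, -1); (56%N, 1); (70%N, 1)]); (48%N, [::
   (2%N, 1); (38%N, 1)]); (49%N, [:: (4%N, 1); (40%N, 1)]); (50%N, [::
   (16%N, -1); (17%N, 1); (52%N, -1); (53%N, 1)]); (51%N, [:: (6%N, -1);
   (7%N, 1); (42%N, -1); (43%N, 1)]); (54%N, [:: (8%N, 1); (44%N, 1)]);
   (55%N, [:: (8%N, 1); (22%N, 1); (44%N, 1); (58%N, 1)]); (60%N, [:: (3%N,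
   1); (39%N, 1)]); (61%N, [:: (6%N, -1); (42%N, -1)]); (62%N, [:: (5%N, 1);
   (41%N, 1)]); (63%N, [:: (16%N, -1); (52%N, -1)]); (64%N, [:: (9%N, 1);
   (45%N, 1)]); (65%N, [:: (9%N, 1); (20%N, -1); (45%N, 1); (56%N, -1)]);
   (66%N, [:: (10%N, -1); (21%N, 1); (46%N, -1); (57%N, 1)]); (67%N, [::
   (21%N, 1); (57%N, 1)]); (68%N, [:: (11%N, -1); (47%N, -1)]); (69%N, [::
   (35%N, 1); (71%N, 1)]); (70%N, [:: (23%N, -1); (59%N, -1)])].

Definition low_kap3 : seq (nat * sparse) :=
  [:: (0%N, [:: (1%N, 1); (13%N, -1)]); (2%N, [:: (6%N, 1); (18%N, -1)]);
   (3%N, [:: (5%N, -1); (17%N, 1)]); (5%N, [:: (8%N, -1); (32%N, 1)]); (7%N,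
   [:: (9%N, 1); (21%N, -1)]); (12%N, [:: (2%N, -1); (14%N, 1)]); (13%N, [::
   (4%N, -1); (5%N, 1); (16%N, 1); (17%N, -1)]); (15%N, [:: (7%N, -1);
   (19%N, 1)]); (16%N, [:: (10%N, -1); (22%N, 1)]); (17%N, [:: (10%N, -1);
   (22%N, 1)]); (18%N, [:: (20%N, 1); (32%N, -1)]); (19%N, [:: (20%N, 1);
   (32%N, -1)]); (21%N, [:: (11%N, -1); (23%N, 1)]); (24%N, [:: (3%N, -1);
   (27%N, 1)]); (25%N, [:: (18%N, 1); (30%N, -1)]); (26%N, [:: (17%N, -1);
   (29%N, 1)]); (28%N, [:: (21%N, -1); (33%N, 1)]); (30%N, [:: (10%N, 1);
   (34%N, -1)]); (32%N, [:: (11%N, 1); (35%N, -1)]); (36%N, [:: (13%N, 1);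
   (37%N, 1)]); (38%N, [:: (18%N, 1); (42%N, 1)]); (39%N, [:: (4%N, -1);
   (5%N, 1); (17%N, -1); (40%N, -1)]); (41%N, [:: (32%N, -1); (44%N, -1)]);
   (43%N, [:: (21%N, 1); (45%N, 1)]); (46%N, [:: (11%N, -1); (47%N, -1)]);
   (48%N, [:: (2%N, 1); (38%N, 1)]); (50%N, [:: (52%N, -1); (53%N, 1)]);
   (51%N, [:: (7%N, 1); (43%N, 1)]); (53%N, [:: (10%N, 1); (46%N, 1); (57%N,
   -1)]); (55%N, [:: (32%N, 1); (44%N, 1); (58%N, 1)]); (58%N, [:: (71%N,
   -1)]); (60%N, [:: (3%N, 1); (39%N, 1)]); (62%N, [:: (4%N, -1); (5%N, 1);
   (40%N, -1); (41%N, 1)]); (63%N, [:: (52%N, -1)]); (65%N, [:: (56%N,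
   -1)]); (67%N, [:: (57%N, 1)]); (70%N, [:: (59%N, -1)])].

(* The complex is S (x) B^*, where S, with basis the rack monoid of the three  *)
(* reflections of S_3, is embedded into k[x]^3 x k[S_3 x N]; a level is a      *)
(* 6 x 12 matrix. Row r < 3 is the power of the r-th generator, row 3 + i the  *)
(* reflection x |-> i - x or the rotation x |-> x + i, according to parity;    *)
(* in both cases left multiplication by the reflection x sends i to x - i.     *)
Definition assoc_table (s : seq (nat * sparse)) : seq sparse :=
  mkseq (fun q => flatten [seq p.2 | p <- s & p.1 == q]) 72.

Definition koszul_table : seq sparse :=
  mkseq (fun q => let r := (q %/ 12)%N in
    if (r < 3)%N then [seq ((12 * r + p.1 %% 12)%N, p.2)
                      | p <- right_table r & (p.1 %/ 12 == q %% 12)%N]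
    else flatten [seq [seq ((12 * (3 + (x + 6 - r) %% 3) + p.1 %% 12)%N, p.2)
                      | p <- right_table x & (p.1 %/ 12 == q %% 12)%N]
                 | x <- iota 0 3]) 72.

(** On the power of a generator, the homotopy of right multiplication by it is used; on the S_3
    part, that of the first generator together with left multiplication by its reflection, which is
    its own inverse. *)
Definition generic_kap : seq sparse :=
  mkseq (fun q => let r := (q %/ 12)%N in
    let r' := if (r < 3)%N then r else (3 + (6 - r) %% 3)%N in
    [seq ((12 * r' + p.1 %% 12)%N, p.2)
    | p <- right_inv_table (if (r < 3)%N then r else 0) & (p.1 %/ 12 == q %% 12)%N]) 72.

Definition kap_table (t : nat) : seq sparse :=
  match t with
  | 0 => [::]
  | 1 => assoc_table low_kap1
  | 2 => assoc_table low_kap2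
  | 3 => assoc_table low_kap3
  | _ => generic_kap
  end.

(* In levels 0, 1, 2 the algebra S has dimension 1, 3, 5 and is a proper       *)
(* subspace, cut out as the image of this projection.                          *)
Definition constraint_table (t : nat) : seq sparse :=
  match t with
  | 0 => mkseq (fun q => if (q < 12)%N then
           [:: (q, 1); ((12 + q)%N, 1); ((24 + q)%N, 1); ((36 + q)%N, 1)] else [::]) 72
  | 1 => mkseq (fun q => if (q < 36)%N then [:: (q, 1); ((36 + q)%N, 1)] else [::]) 72
  | 2 => mkseq (fun q => if (q < 36)%N then [:: (q, 1); ((36 + q %% 12)%N, 1)]
                         else if (q < 48)%N then [::] else [:: (q, 1)]) 72
  | _ => table_id 6
  end.

(** Right multiplication by a generator of S; [b] tells that the level is odd, so that rows from 3
    on are reflections, and reflection i times reflection x is rotation i - x. A power of a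
    generator is killed by the other generators. *)
Definition rmul_table (b : bool) (x : nat) : seq sparse :=
  mkseq (fun q => let r := (q %/ 12)%N in
    if (r < 3)%N then (if r == x then [:: (q, 1)] else [::])
    else [:: ((12 * (3 + (if b then r - x else r + x) %% 3) + q %% 12)%N, 1)]) 72.

Definition lam_table : seq sparse :=
  assoc_table [:: (10%N, [:: (10%N, 1)]); (21%N, [:: (10%N, -1)]);
                  (32%N, [:: (10%N, 1)]); (46%N, [:: (10%N, -1)])].

Definition iota_vec : sparse := [:: (0%N, 1); (12%N, 1); (24%N, 1); (36%N, 1)].

Definition dual_vec (i : nat) : sparse :=
  [:: ((1 + i)%N, 1); ((13 + i)%N, 1); ((25 + i)%N, 1); ((37 + i)%N, 1)].

Lemma koszul_tableK : table_eq 6 (table_comp koszul_table koszul_table) [::].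
Proof. by vm_compute. Qed.

Lemma koszul_table_comm (x : 'I_3) : table_eq 6
  (table_comp koszul_table (table_mulr 6 (left_table x)))
  (table_comp (table_mulr 6 (left_table x)) koszul_table).
Proof. by case: x => [[|[|[|//]]] p]; vm_compute. Qed.

Lemma rmul_table_comm b (i x : 'I_3) : table_eq 6
  (table_comp (rmul_table b i) (table_mulr 6 (left_table x)))
  (table_comp (table_mulr 6 (left_table x)) (rmul_table b i)).
Proof. by case: b i x => [] [[|[|[|//]]] p] [[|[|[|//]]] p']; vm_compute. Qed.

Lemma constraint_table_comm t (x : 'I_3) : table_eq 6
  (table_comp (constraint_table t) (table_mulr 6 (left_table x)))
  (table_comp (table_mulr 6 (left_table x)) (constraint_table t)).
Proof. by case: t x => [|[|[|t]]] [[|[|[|//]]] p]; vm_compute. Qed.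

Lemma koszul_constraint t : table_eq 6
  (table_comp (constraint_table t.+1) (table_comp koszul_table (constraint_table t)))
  (table_comp koszul_table (constraint_table t)).
Proof. by case: t => [|[|[|t]]]; vm_compute. Qed.

Lemma kap_constraint t : table_eq 6
  (table_comp (constraint_table t) (table_comp (kap_table t.+1) (constraint_table t.+1)))
  (table_comp (kap_table t.+1) (constraint_table t.+1)).
Proof. by case: t => [|[|[|t]]]; vm_compute. Qed.

Lemma rmul_constraint b (i : 'I_3) t : odd t = b -> table_eq 6
  (table_comp (constraint_table t.+1) (table_comp (rmul_table b i) (constraint_table t)))
  (table_comp (rmul_table b i) (constraint_table t)).
Proof.
case: t => [|[|[|t]]] tb; [rewrite -tb | rewrite -tb | rewrite -tb | case: b {tb}];
  by case: i => [[|[|[|//]]] p]; vm_compute.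
Qed.

Lemma rmul_koszul b (i : 'I_3) : table_eq 6
  (table_comp (rmul_table (~~ b) i) koszul_table)
  (table_comp koszul_table (rmul_table b i)).
Proof. by case: b i => [] [[|[|[|//]]] p]; vm_compute. Qed.

(** The projection onto the d-cohomology: the one-entry table reads coordinate 0 only, which is
    [fk_lam0]. *)
Definition htpy_defect (t : nat) : seq sparse :=
  match t with 0 => [:: iota_vec] | 3 => lam_table | _ => [::] end.

Lemma kap_table_htpy t : table_eq 6
  (table_comp (table_add 6 (table_add 6 (table_comp koszul_table (kap_table t))
     (table_comp (kap_table t.+1) koszul_table)) (htpy_defect t)) (constraint_table t))
  (constraint_table t).
Proof. by case: t => [|[|[|[|t]]]]; vm_compute. Qed.

Lemma lam_table_koszul :
  table_eq 6 (table_comp lam_table (table_comp koszul_table (constraint_table 2))) [::].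
Proof. by vm_compute. Qed.

(** The left factor is the projection on coordinate 10, so [lam_table] takes values in the line of
    omega. *)
Lemma lam_table_image :
  table_eq 6 (table_comp (rcons (nseq 10 [::]) [:: (10%N, 1)]) lam_table) lam_table.
Proof. by vm_compute. Qed.

Lemma commute_table (i u : 'I_3) :
  - coef (table_vec lam_table (table_vec (rmul_table false i) (table_vec (kap_table 3)
      (table_vec (table_mulr 6 (left_table u)) [:: (10%N, 1)])))) 10
  + coef (left_table u) (12 * i.+1)
  + coef (table_vec lam_table (table_vec (table_mulr 6 (left_table u))
      (table_vec (kap_table 4) (table_vec (rmul_table true i) [:: (10%N, 1)])))) 10 = 0.
Proof. by case: i u => [[|[|[|//]]] p] [[|[|[|//]]] p']; vm_compute. Qed.

Lemma koszul_dual (i : 'I_3) : same_coef 6 (table_vec koszul_table (dual_vec i))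
  (table_vec (rmul_table false i) iota_vec).
Proof. by case: i => [[|[|[|//]]] p]; vm_compute. Qed.

Lemma constraint_rows t :
  all (fun r => all (fun l => all (fun r' => all (fun l' =>
    coef (nth [::] (constraint_table t) (12 * r' + l')) (12 * r + l) ==
    if l == l' then coef (nth [::] (constraint_table t) (12 * r')) (12 * r) else 0)
  (iota 0 12)) (iota 0 6)) (iota 0 12)) (iota 0 6).
Proof. by case: t => [|[|[|t]]]; vm_compute. Qed.

Lemma table_fun_single (k : fieldType) (m : nat) (n : 'M[k]_(m, 12)) (r : 'I_m)
    (l : 'I_12) (s : sparse) :
  table_fun (rcons (nseq (12 * r + l) [::]) s) n = n r l *: vec k m s.
Proof.
rewrite /table_fun (bigD1 r) //= (bigD1 l) //= nth_rcons size_nseq ltnn eqxx.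
have nth0 (r' : 'I_m) (l' : 'I_12) : ((r', l') != (r, l)) ->
    nth [::] (rcons (nseq (12 * r + l) [::]) s) (12 * r' + l') = [::].
  move=> rl; rewrite nth_rcons size_nseq nth_nseq if_same eq_flat //.
  by move: rl; rewrite xpair_eqE -!val_eqE => /negPf ->; rewrite if_same.
rewrite !big1 ?addr0 // => [r' rr|l' ll].
  by rewrite big1 // => l' _; rewrite nth0 ?vec_nil ?scaler0 // xpair_eqE negb_and rr.
by rewrite nth0 ?vec_nil ?scaler0 // xpair_eqE negb_and ll orbT.
Qed.

Lemma table_fun_nil (k : fieldType) (m : nat) (n : 'M[k]_(m, 12)) :
  table_fun [::] n = 0.
Proof.
rewrite /table_fun big1 // => r _; rewrite big1 // => l _.
by rewrite nth_nil vec_nil scaler0.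
Qed.

Lemma table_fun_entry (k : fieldType) (m : nat) (A : seq sparse)
    (n : 'M[k]_(m, 12)) r l :
  table_fun A n r l = \sum_(r' < m) \sum_(l' < 12)
    n r' l' * (coef (nth [::] A (12 * r' + l')) (12 * r + l))%:~R.
Proof.
rewrite summxE; apply: eq_bigr => r' _; rewrite summxE; apply: eq_bigr => l' _.
by rewrite mxE vecE.
Qed.

(** * The Koszul complex *)

Section KoszulComplex.
Variable k : fieldType.
Local Notation B := (fk_alg k).
Local Notation V := (ideal_type (fk_aug_ideal k)).
Local Notation M := 'M[k]_(6, 12).
Local Notation N := (nat -> M).
Local Notation rho := (rho k).
Local Notation l10 := (@Ordinal 12 10 isT).

(** Reduces B-linearity to three table identities, one for each generator. *)
Lemma table_fun_rho (A : seq sparse) (n : M) (u : B) : (size A <= 72)%N ->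
  (forall x : 'I_3, table_eq 6 (table_comp A (table_mulr 6 (left_table x)))
                             (table_comp (table_mulr 6 (left_table x)) A)) ->
  table_fun A (n *m rho u) = table_fun A n *m rho u.
Proof.
move=> sA Ac; elim/fk_word_ind: u n => [|||] => [n|n|i u IHu n|c u v IHu IHv n].
- by rewrite rmorph1 !mulmx1.
- by rewrite rmorph0 !mulmx0 linear0.
- rewrite rmorphM /= rho_gen -[fk_mx k i * _]/(fk_mx k i *m _) !mulmxA IHu.
  rewrite !mulmx_vec !table_fun_comp ?size_table_mulr //.
  by rewrite (table_fun_eq _ (Ac i)).
- by rewrite linearP /= !mulmxDr -!scalemxAr linearP /= IHu IHv.
Qed.

Definition fk_act (v : V) (n : N) : N := fun j => n j *m rho (val v).

Fact fk_act_linear v : linear (fk_act v).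
Proof. by move=> c n p; apply/funext => j; rewrite /fk_act mulmxDl -scalemxAl. Qed.
HB.instance Definition _ v := GRing.isLinear.Build k N N *:%R (fk_act v) (fk_act_linear v).

Definition fk_d (n : N) : N :=
  fun j => if j is j'.+1 then table_fun koszul_table (n j') else 0.

Fact fk_d_linear : linear fk_d.
Proof.
move=> c n p; apply/funext => -[|j]; rewrite -[RHS]/(c *: fk_d n _ + fk_d p _) /=.
  by rewrite scaler0 addr0.
exact: linearP.
Qed.
HB.instance Definition _ := GRing.isLinear.Build k N N *:%R fk_d fk_d_linear.

Definition fk_kap (n : N) : N := fun j => table_fun (kap_table j.+1) (n j.+1).

Fact fk_kap_linear : linear fk_kap.
Proof. by move=> c n p; apply/funext => j; apply: linearP. Qed.
HB.instance Definition _ := GRing.isLinear.Build k N N *:%R fk_kap fk_kap_linear.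

Definition fk_lam0 (n : N) : k^o := n 0%N ord0 ord0.

Fact fk_lam0_linear : linear fk_lam0.
Proof. by move=> c n p; rewrite /fk_lam0 !mxE. Qed.
HB.instance Definition _ := GRing.isLinear.Build k N k^o *:%R fk_lam0 fk_lam0_linear.

Definition fk_lam (n : N) : k^o := table_fun lam_table (n 3) ord0 l10.

Fact fk_lam_linear : linear fk_lam.
Proof.
move=> c n p; rewrite /fk_lam -[(c *: n + p) 3]/(c *: n 3 + p 3) linearP.
by rewrite !mxE.
Qed.
HB.instance Definition _ := GRing.isLinear.Build k N k^o *:%R fk_lam fk_lam_linear.

Definition at_level (t : nat) (m : M) : N := fun j => if j == t then m else 0.

Definition fk_iota : N := at_level 0 (vec k 6 iota_vec).
(** Row 0, column 10: since aaa and abb have the same image in S_3, this is (aaa - abb) tensored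
    with the dual basis vector of bcb. *)
Definition fk_omega : N := at_level 3 (coord_mx k 6 10).

Definition fk_rmul (i : 'I_3) (n : N) : N :=
  fun j => if j is j'.+1 then table_fun (rmul_table (odd j') i) (n j') else 0.

Fact fk_rmul_linear i : linear (fk_rmul i).
Proof.
move=> c n p; apply/funext => -[|j]; rewrite -[RHS]/(c *: fk_rmul i n _ + fk_rmul i p _) /=.
  by rewrite scaler0 addr0.
exact: linearP.
Qed.
HB.instance Definition _ i := GRing.isLinear.Build k N N *:%R (fk_rmul i) (fk_rmul_linear i).

Definition fk_dual (i : 'I_3) : N := at_level 0 (vec k 6 (dual_vec i)).

Definition fk_phi (i : 'I_3) (v : V) : k^o := rho (val v) (lift ord0 (widen_ord (isT : 3 <= 11)%N i)) ord0.

Fact fk_phi_linear i : linear (fk_phi i).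
Proof. by move=> c u v; rewrite /fk_phi /= linearP !mxE. Qed.
HB.instance Definition _ i := GRing.isLinear.Build k V k^o *:%R (fk_phi i) (fk_phi_linear i).

(** The first clause confines each level to the subspace S (x) B^* of the 6 x 12 matrices; the
    homotopy identity is available only there. *)
Definition fk_lv (i j : nat) (n : N) : Prop :=
  [/\ forall t, table_fun (constraint_table t) (n t) = n t,
      forall t, (t < i)%N -> n t = 0 & forall t, (j < t)%N -> n t = 0].

Lemma size_constraint_table t : size (constraint_table t) = 72.
Proof. by case: t => [|[|[|t]]]; rewrite size_mkseq. Qed.

Lemma size_kap_table t : (size (kap_table t) <= 72)%N.
Proof. by case: t => [|[|[|[|t]]]]; rewrite ?size_mkseq. Qed.

Lemma fk_act_lin c u v n : fk_act (c *: u + v) n = c *: fk_act u n + fk_act v n.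
Proof.
apply/funext => j; rewrite -[RHS]/(c *: fk_act u n j + fk_act v n j) /fk_act.
by rewrite /= linearP /= mulmxDr -scalemxAr.
Qed.

Lemma fk_actM u v n : fk_act (ideal_mul u v) n = fk_act v (fk_act u n).
Proof.
by apply/funext => j; rewrite /fk_act /= rmorphM /= -[_ * _]/(_ *m _) mulmxA.
Qed.

Lemma fk_d_act v n : fk_d (fk_act v n) = fk_act v (fk_d n).
Proof.
apply/funext => -[|j]; rewrite /fk_act /= ?mul0mx //.
by apply: table_fun_rho => [|x]; [rewrite size_mkseq | exact: koszul_table_comm].
Qed.

Lemma fk_dK n : fk_d (fk_d n) = 0.
Proof.
apply/funext => -[|[|j]] //=; first exact: linear0.
rewrite table_fun_comp ?size_mkseq // (table_fun_eq _ koszul_tableK).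
by rewrite table_fun_nil.
Qed.

Lemma fk_lv0 i j : fk_lv i j 0.
Proof. by split=> // t; exact: linear0. Qed.

Lemma fk_lv_lin i j c n p : fk_lv i j n -> fk_lv i j p -> fk_lv i j (c *: n + p).
Proof.
move=> [n1 n2 n3] [p1 p2 p3]; split=> t.
- by rewrite -[(c *: n + p) t]/(c *: n t + p t) linearP /= n1 p1.
- by move=> ti; rewrite -[LHS]/(c *: n t + p t) n2 // p2 // scaler0 addr0.
- by move=> ti; rewrite -[LHS]/(c *: n t + p t) n3 // p3 // scaler0 addr0.
Qed.

Lemma fk_lv_mono i j i' j' n :
  (i' <= i)%N -> (j <= j')%N -> fk_lv i j n -> fk_lv i' j' n.
Proof.
move=> ii jj [n1 n2 n3]; split=> // t tj; first by apply: n2; apply: leq_trans ii.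
by apply: n3; apply: leq_ltn_trans tj.
Qed.

Lemma fk_lv_act i j v n : fk_lv i j n -> fk_lv i j (fk_act v n).
Proof.
move=> [n1 n2 n3]; split=> t; rewrite /fk_act.
- rewrite table_fun_rho ?n1 ?size_constraint_table // => x.
  exact: constraint_table_comm.
- by move=> ti; rewrite n2 // mul0mx.
- by move=> ti; rewrite n3 // mul0mx.
Qed.

Lemma constraint_preserved t (A : seq sparse) (m : M) t' : (size A <= 72)%N ->
  table_eq 6 (table_comp (constraint_table t') (table_comp A (constraint_table t)))
             (table_comp A (constraint_table t)) ->
  table_fun (constraint_table t) m = m ->
  table_fun (constraint_table t') (table_fun A m) = table_fun A m.
Proof.
move=> sA Ae me; rewrite -me [table_fun A _]table_fun_comp //.
by rewrite table_fun_comp ?size_constraint_table // (table_fun_eq _ Ae).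
Qed.

Lemma fk_lv_d i j n : fk_lv i j n -> fk_lv i.+1 j.+1 (fk_d n).
Proof.
move=> [n1 n2 n3]; split=> -[|t] //.
- exact: linear0.
- by apply: (constraint_preserved _ (koszul_constraint t) (n1 t)); rewrite size_mkseq.
- by rewrite ltnS => ti; rewrite /= n2 // linear0.
- by rewrite ltnS => ti; rewrite /= n3 // linear0.
Qed.

Lemma fk_kap_lv i j n : fk_lv i j n -> fk_lv i.-1 j.-1 (fk_kap n).
Proof.
move=> [n1 n2 n3]; split=> t; rewrite /fk_kap.
- exact: (constraint_preserved (size_kap_table _) (kap_constraint t) (n1 t.+1)).
- by move=> ti; rewrite n2 ?linear0 //; lia.
- by move=> ti; rewrite n3 ?linear0 //; lia.
Qed.

Lemma fk_kap_lv0 n : fk_lv 0 0 n -> fk_kap n = 0.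
Proof. by move=> [_ _ n3]; apply/funext => t; rewrite /fk_kap n3 // linear0. Qed.

Lemma fk_lam_table (m : M) : table_fun lam_table m =
  (table_fun lam_table m ord0 l10) *: coord_mx k 6 10.
Proof.
have e := table_fun_single (table_fun lam_table m) ord0 l10 [:: (10%N, 1)].
rewrite /vec big_seq1 scale1r in e; rewrite -{}e.
rewrite [RHS]table_fun_comp; last by rewrite size_rcons size_nseq.
by apply/esym/table_fun_eq; exact: lam_table_image.
Qed.

Lemma fk_kap_htpy i j n : fk_lv i j n -> fk_d (fk_kap n) + fk_kap (fk_d n) =
  n - (fk_lam0 n : k) *: fk_iota - (fk_lam n : k) *: fk_omega.
Proof.
move=> [n1 _ _]; apply/funext => t.
rewrite -[RHS]/(n t - (fk_lam0 n : k) *: fk_iota t - (fk_lam n : k) *: fk_omega t).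
(* This also covers t = 0, where [kap_table 0] is empty. *)
have dE : fk_d (fk_kap n) t =
    table_fun koszul_table (table_fun (kap_table t) (n t)).
  by case: t => [|t] //=; rewrite table_fun_nil linear0.
rewrite -[LHS]/(fk_d (fk_kap n) t + fk_kap (fk_d n) t) dE /fk_kap /=.
have := table_fun_eq (n t) (kap_table_htpy t).
rewrite -table_fun_comp ?size_mkseq // n1 !table_fun_add.
rewrite -!table_fun_comp ?size_kap_table ?size_mkseq // => e.
suff h : table_fun (htpy_defect t) (n t) =
    (fk_lam0 n : k) *: fk_iota t + (fk_lam n : k) *: fk_omega t.
  by rewrite (canRL (addrK _) e) h opprD addrA.
rewrite /fk_iota /fk_omega /at_level; case: t {dE e} => [|[|[|[|t]]]] /=.
- rewrite scaler0 addr0.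
  exact: (table_fun_single (n 0%N) (ord0 : 'I_6) (ord0 : 'I_12) iota_vec).
all: rewrite ?scaler0 ?addr0 ?add0r.
- by rewrite table_fun_nil.
- by rewrite table_fun_nil.
- exact: fk_lam_table.
- by rewrite table_fun_nil.
Qed.

Lemma fk_lv_at_level t m : table_fun (constraint_table t) m = m ->
  fk_lv t t (at_level t m).
Proof.
move=> me; split=> j; rewrite /at_level.
- by case: eqP => [->|_] //; exact: linear0.
- by move=> jt; rewrite ltn_eqF.
- by move=> jt; rewrite gtn_eqF.
Qed.

Lemma table_fun_fixed (A : seq sparse) s : (size A <= 72)%N ->
  same_coef 6 (table_vec A s) s -> table_fun A (vec k 6 s) = vec k 6 s.
Proof. by move=> sA e; rewrite table_fun_vec //; apply: vec_same. Qed.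

Lemma fk_lv_iota : fk_lv 0 0 fk_iota.
Proof. by apply/fk_lv_at_level/table_fun_fixed; vm_compute. Qed.

Lemma coord10 : coord_mx k 6 10 = vec k 6 [:: (10%N, 1)].
Proof. by rewrite /vec big_seq1 scale1r. Qed.

Lemma fk_lv_omega : fk_lv 3 3 fk_omega.
Proof. by apply: fk_lv_at_level; apply: table_fun_id. Qed.

Lemma fk_d_at_level t m : fk_d (at_level t m) = at_level t.+1 (table_fun koszul_table m).
Proof.
apply/funext => -[|j] //=; rewrite /at_level eqSS; case: eqP => _ //.
exact: linear0.
Qed.

Lemma fk_d_iota : fk_d fk_iota = 0.
Proof.
rewrite fk_d_at_level table_fun_vec ?size_mkseq // (@vec_same _ _ _ [::]).
  by apply/funext => j; rewrite /at_level vec_nil if_same.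
by vm_compute.
Qed.

Lemma fk_d_omega : fk_d fk_omega = 0.
Proof.
rewrite /fk_omega coord10 fk_d_at_level table_fun_vec ?size_mkseq // (@vec_same _ _ _ [::]).
  by apply/funext => j; rewrite /at_level vec_nil if_same.
by vm_compute.
Qed.

Lemma fk_lam0_iota : fk_lam0 fk_iota = 1.
Proof. by rewrite /fk_lam0 vecE. Qed.

Lemma fk_lam_omega : fk_lam fk_omega = 1.
Proof.
rewrite /fk_lam [fk_omega 3]coord10 table_fun_vec ?size_mkseq // vecE.
by rewrite (_ : coef _ _ = 1) //; vm_compute.
Qed.

Lemma fk_lam_d i j n : fk_lv i j n -> fk_lam (fk_d n) = 0.
Proof.
move=> [n1 _ _]; rewrite /fk_lam /= -n1 !table_fun_comp ?size_mkseq //.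
by rewrite (table_fun_eq _ lam_table_koszul) table_fun_nil mxE.
Qed.

Lemma fk_lam_lv n : fk_lv 0 2 n -> fk_lam n = 0.
Proof. by move=> [_ _ n3]; rewrite /fk_lam n3 // linear0 mxE. Qed.

Lemma fk_lam0_lv j n : fk_lv 1 j n -> fk_lam0 n = 0.
Proof. by move=> [_ n2 _]; rewrite /fk_lam0 n2 // mxE. Qed.

Lemma coord_mulmx_rho (r : 'I_6) (l : 'I_12) (u : B) (i : 'I_6) (j : 'I_12) :
  (coord_mx k 6 (12 * r + l) *m rho u) i j = (r == i)%:R * rho u l j.
Proof.
rewrite mxE (bigD1 l) //= mxE eq_flat // eqxx andbT big1 => [|l' ll].
  by rewrite addr0 eq_sym.
by rewrite mxE eq_flat // (negPf ll : (l' == l :> nat) = false) andbF mul0r.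
Qed.

(** [fk_iota] lives in the column of 1, and row 0 of [rho (val v)] vanishes since [v] strictly
    raises degrees. *)
Lemma fk_act_iota v : fk_act v fk_iota = 0.
Proof.
apply/funext => t; rewrite /fk_act /fk_iota /at_level; case: eqP => [_|_]; last exact: mul0mx.
apply/matrixP => i j; rewrite mxE [RHS]mxE big1 // => l _; rewrite vecE.
have [l0|l0] := eqVneq l ord0; first by rewrite l0 rho_aug // mulr0.
suff -> : coef iota_vec (12 * i + l) = 0 by rewrite mul0r.
have /allP := (isT : all (fun r => all (fun l => coef iota_vec (12 * r + l) == 0)
  (iota 1 11)) (iota 0 6)).
move=> /(_ i); rewrite mem_iota ltn_ord => /(_ isT)/allP/(_ l).
by rewrite mem_iota ltn_ord lt0n l0 => /(_ isT)/eqP.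
Qed.

Lemma fk_lam_act_omega v : fk_lam (fk_act v fk_omega) = 0.
Proof.
rewrite /fk_lam /fk_act [fk_omega 3]/(coord_mx k 6 (12 * (ord0 : 'I_6) + l10)).
rewrite table_fun_entry big1 // => r _; rewrite big1 // => l _.
rewrite coord_mulmx_rho; case: eqP => [<-|]; rewrite ?mul0r // mul1r.
have [->|ll] := eqVneq l l10; first by rewrite rho_aug // mul0r.
have /allP/(_ l) := (isT : all (fun l =>
  (l == 10) || (coef (nth [::] lam_table (12 * 0 + l)) (12 * 0 + 10) == 0)) (iota 0 12)).
rewrite mem_iota ltn_ord => /(_ isT)/predU1P[l1|/eqP->]; last by rewrite mulr0.
by move/eqP: ll; case; apply: val_inj.
Qed.

Lemma fk_r_act i v n : fk_rmul i (fk_act v n) = fk_act v (fk_rmul i n).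
Proof.
apply/funext => -[|j]; rewrite /fk_act /= ?mul0mx //.
by apply: table_fun_rho => [|x]; [rewrite size_mkseq | exact: rmul_table_comm].
Qed.

Lemma fk_r_d i n : fk_rmul i (fk_d n) = fk_d (fk_rmul i n).
Proof.
apply/funext => -[|[|j]] /=; rewrite ?linear0 //.
by rewrite !table_fun_comp ?size_mkseq // (table_fun_eq _ (rmul_koszul _ i)).
Qed.

Lemma fk_r_lv l i j n : fk_lv i j n -> fk_lv i.+1 j.+1 (fk_rmul l n).
Proof.
move=> [n1 n2 n3]; split=> -[|t] //.
- exact: linear0.
- apply: (constraint_preserved _ (rmul_constraint l (erefl (odd t))) (n1 t)).
  by rewrite size_mkseq.
- by rewrite ltnS => ti; rewrite /= n2 // linear0.
- by rewrite ltnS => ti; rewrite /= n3 // linear0.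
Qed.

Lemma fk_r_at_level i t m :
  fk_rmul i (at_level t m) = at_level t.+1 (table_fun (rmul_table (odd t) i) m).
Proof.
apply/funext => -[|j] //=; rewrite /at_level eqSS; case: eqP => [->|_] //.
exact: linear0.
Qed.

Lemma fk_lv_dual i : fk_lv 0 0 (fk_dual i).
Proof.
by apply/fk_lv_at_level/table_fun_fixed => //; case: i => [[|[|[|//]]] p]; vm_compute.
Qed.

Lemma fk_d_dual i : fk_d (fk_dual i) = fk_rmul i fk_iota.
Proof.
rewrite fk_d_at_level fk_r_at_level !table_fun_vec ?size_mkseq //.
by rewrite (vec_same _ (koszul_dual i)).
Qed.

Lemma coef_iota_vec (r : 'I_6) (l : 'I_12) :
  coef iota_vec (12 * r + l) = ((r < 4) && (l == ord0))%N%:Z.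
Proof.
have /allP := (isT : all (fun r => all (fun l =>
  coef iota_vec (12 * r + l) == ((r < 4) && (l == 0))%N%:Z) (iota 0 12)) (iota 0 6)).
move=> /(_ r); rewrite mem_iota ltn_ord => /(_ isT)/allP/(_ l).
by rewrite mem_iota ltn_ord => /(_ isT)/eqP.
Qed.

Lemma coef_dual_vec (i : 'I_3) (r : 'I_6) (l : 'I_12) :
  coef (dual_vec i) (12 * r + l) = ((r < 4) && (l == i.+1 :> nat))%N%:Z.
Proof.
have /allP := (isT : all (fun i => all (fun r => all (fun l =>
  coef (dual_vec i) (12 * r + l) == ((r < 4) && (l == i.+1))%N%:Z) (iota 0 12))
  (iota 0 6)) (iota 0 3)).
move=> /(_ i); rewrite mem_iota ltn_ord => /(_ isT)/allP/(_ r).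
rewrite mem_iota ltn_ord => /(_ isT)/allP/(_ l).
by rewrite mem_iota ltn_ord => /(_ isT)/eqP.
Qed.

Lemma fk_act_dual i v : fk_act v (fk_dual i) = (fk_phi i v : k) *: fk_iota.
Proof.
apply/funext => t; rewrite -[RHS]/((fk_phi i v : k) *: fk_iota t).
rewrite /fk_act /fk_dual /fk_iota /at_level.
case: eqP => [_|_]; last by rewrite mul0mx scaler0.
apply/matrixP => r l; rewrite !mxE vecE coef_iota_vec.
set li := lift ord0 (widen_ord (isT : 3 <= 11)%N i).
have li_l (l' : 'I_12) : (l' == i.+1 :> nat)%N = (l' == li) by rewrite -val_eqE.
rewrite (bigD1 li) //= big1 => [|l' ll]; last first.
  by rewrite vecE coef_dual_vec li_l (negPf ll) andbF mul0r.
rewrite vecE coef_dual_vec li_l eqxx andbT addr0 mulrC.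
have [l0|l0] := eqVneq l ord0; first by rewrite l0 andbT.
rewrite andbF mulr0 rho_aug ?mul0r //.
have : basis_deg li = 1%N by case: (i) @li {li_l} => [[|[|[|//]]] p].
move=> ->; move: l0; case: (l) => [[|[|[|[|[|[|[|[|[|[|[|[|//]]]]]]]]]]]] p] //.
Qed.

Lemma commute_table_field (i u : 'I_3) :
  - (coef (table_vec lam_table (table_vec (rmul_table false i) (table_vec (kap_table 3)
      (table_vec (table_mulr 6 (left_table u)) [:: (10%N, 1)])))) 10)%:~R
  + (coef (left_table u) (12 * i.+1))%:~R
  + (coef (table_vec lam_table (table_vec (table_mulr 6 (left_table u))
      (table_vec (kap_table 4) (table_vec (rmul_table true i) [:: (10%N, 1)])))) 10)%:~R
  = 0 :> k.
Proof. by rewrite -mulrNz -!intrD commute_table. Qed.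

Definition is_fk_gen (v : V) := exists u, val v = fk_gen k u.

Lemma fk_commute_value (i : 'I_3) (v : V) : is_fk_gen v ->
  - fk_lam (fk_rmul i (fk_kap (fk_act v fk_omega))) + fk_phi i v
  + fk_lam (fk_act v (fk_kap (fk_rmul i fk_omega))) = 0.
Proof.
move=> [u vu].
have -> : fk_lam (fk_rmul i (fk_kap (fk_act v fk_omega))) =
    table_fun lam_table (table_fun (rmul_table false i) (table_fun (kap_table 3)
      (coord_mx k 6 10 *m rho (val v)))) ord0 l10 by [].
have -> : fk_lam (fk_act v (fk_kap (fk_rmul i fk_omega))) =
    table_fun lam_table (table_fun (kap_table 4) (table_fun (rmul_table true i)
      (coord_mx k 6 10)) *m rho (val v)) ord0 l10 by [].
rewrite /fk_phi vu rho_gen.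
have sM : (size (table_mulr 6 (left_table u)) <= 72)%N by rewrite size_table_mulr.
have sR c : (size (rmul_table c i) <= 72)%N by rewrite size_mkseq.
have sL : (size lam_table <= 72)%N by rewrite size_mkseq.
have tv A s : (size A <= 72)%N -> table_fun A (vec k 6 s) = vec k 6 (table_vec A s).
  by move=> sA; rewrite table_fun_vec.
rewrite coord10 ![_ *m fk_mx k u]mulmx_vec (tv _ _ sM) (tv _ _ (size_kap_table 3)).
rewrite (tv _ _ (sR false)) (tv _ _ (sR true)) (tv _ _ (size_kap_table 4)) (tv _ _ sM).
rewrite !(tv _ _ sL) !vecE -(commute_table_field i u).
by congr (_ + (coef _ _)%:~R + _); rewrite addn0.
Qed.

Definition fk_ev (n : N) : nat -> 'cV[k]_6 := fun j => col ord0 (n j).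

Fact fk_ev_linear : linear fk_ev.
Proof.
move=> c n p; apply/funext => j.
by rewrite -[RHS]/(c *: fk_ev n j + fk_ev p j) /fk_ev linearP.
Qed.
HB.instance Definition _ :=
  GRing.isLinear.Build k N (nat -> 'cV[k]_6) *:%R fk_ev fk_ev_linear.

(** At l = 0 the basis element is 1, outside the augmentation ideal, and the default value 0 gives
    [fk_cof] the value 0 at 1. *)
Definition basis_elt (l : nat) : V := insubd (0 : V) (fk_basis k l).

Definition fk_cof (p : V -> nat -> 'cV[k]_6) : N :=
  fun j => \matrix_(r, l) p (basis_elt l) j r ord0.

Lemma fk_gen_aug i : fk_gen k i \in fk_aug_ideal k.
Proof. by apply/asboolP; exists (free_var k i) => //; exact: free_var_aug. Qed.

Lemma fk_basis_aug (l : nat) : (0 < l < 12)%N -> fk_basis k l \in fk_aug_ideal k.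
Proof.
case: l => [|[|[|[|[|[|[|[|[|[|[|[|//]]]]]]]]]]]] // _;
  first [exact: fk_gen_aug | apply: Defs.idealMr; exact: fk_gen_aug].
Qed.

Lemma basis_elt0 : basis_elt 0 = 0.
Proof. by rewrite /basis_elt /insubd insubN // ideal1. Qed.

Lemma val_basis_elt (l : nat) : (0 < l < 12)%N -> val (basis_elt l) = fk_basis k l.
Proof. by move=> l0; rewrite insubdK //; apply: fk_basis_aug. Qed.

Lemma basis_elt_decomposition (v : V) :
  v = \sum_(l < 12) rho (val v) l ord0 *: basis_elt l.
Proof.
apply: val_inj; rewrite {1}[val v]fk_decomposition raddf_sum; apply: eq_bigr => l _ /=.
have [->|l0] := eqVneq l ord0.
  by rewrite (rho_aug v (isT : (basis_deg (ord0 : 'I_12) <= basis_deg (ord0 : 'I_12))%N))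
    !scale0r.
rewrite -[ideal_val (basis_elt l)]/(val (basis_elt l)) val_basis_elt ?ltn_ord ?andbT //.
by rewrite lt0n.
Qed.

End KoszulComplex.

(** * The levels of K as cofree modules *)

Section KoszulCofree.
Variable k : fieldType.
Local Notation i0 := (@Ordinal 3 0 isT).
Local Notation i1 := (@Ordinal 3 1 isT).
Local Notation i2 := (@Ordinal 3 2 isT).
Local Notation V := (ideal_type (fk_aug_ideal k)).
Local Notation N := (nat -> 'M[k]_(6, 12)).
Local Notation rho := (rho k).

Lemma rho_basis (l l' : 'I_12) : rho (fk_basis k l) l' 0 = (l' == l)%:R.
Proof. exact: (rho_base (@rho_gen k)). Qed.

Lemma linear_at0 (U W : lmodType k) (p : U -> W) : linear p -> p 0 = 0.
Proof.
move=> pl; have := pl (-1) 0 0; rewrite scaler0 addr0 => ->.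
by rewrite scaleN1r addNr.
Qed.

Lemma linear_sum_scale (U W : lmodType k) (p : U -> W) m (c : 'I_m -> k) (u : 'I_m -> U) :
  linear p -> p (\sum_i c i *: u i) = \sum_i c i *: p (u i).
Proof.
move=> pl; elim/big_rec2: _ => [|i x y _ <-]; first exact: linear_at0.
exact: pl.
Qed.

Lemma linear_basis (W : lmodType k) (p : V -> W) (v : V) : linear p ->
  p v = \sum_(l < 12) rho (val v) l ord0 *: p (basis_elt k l).
Proof. by move=> pl; rewrite {1}[v]basis_elt_decomposition linear_sum_scale. Qed.

Lemma fk_cof_lin (c : k) (p q : V -> nat -> 'cV[k]_6) :
  fk_cof (fun v => c *: p v + q v) = c *: fk_cof p + fk_cof q.
Proof.
apply/funext => j; rewrite -[RHS]/(c *: fk_cof p j + fk_cof q j).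
by apply/matrixP => r l; rewrite !mxE.
Qed.

Lemma fk_ev_cof (p : V -> nat -> 'cV[k]_6) : linear p -> fk_ev (fk_cof p) = 0.
Proof.
move=> pl; apply/funext => j; apply/matrixP => r c; rewrite !mxE basis_elt0.
by rewrite (linear_at0 pl) [LHS]mxE.
Qed.

Lemma fk_ev_act_cof (p : V -> nat -> 'cV[k]_6) v : linear p ->
  fk_ev (fk_act v (fk_cof p)) = p v.
Proof.
move=> pl; apply/funext => j; apply/matrixP => r c; rewrite ord1 !mxE.
have -> : p v j r 0 = \sum_(l < 12) rho (val v) l ord0 * p (basis_elt k l) j r 0.
  have ql : linear (fun v => p v j r 0 : k^o).
    by move=> e x y; rewrite pl !mxE.
  exact: (linear_basis v ql).
by apply: eq_bigr => l _; rewrite mxE mulrC.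
Qed.

(** Rows are functionals on B; acting by a basis element and evaluating at 1 reads the corresponding
    column. *)
Lemma mx_cols0 (m : 'M[k]_(6, 12)) : col ord0 m = 0 ->
  (forall v : V, col ord0 (m *m rho (val v)) = 0) -> m = 0.
Proof.
move=> m0 mv; apply/matrixP => r l; rewrite [RHS]mxE.
have [->|l0] := eqVneq l ord0.
  by have /matrixP/(_ r 0) := m0; rewrite !mxE.
have /matrixP/(_ r 0) := mv (basis_elt k l).
rewrite val_basis_elt ?ltn_ord ?andbT ?lt0n // mxE [X in _ = X -> _]mxE mxE.
rewrite (bigD1 l) //= rho_basis eqxx mulr1 big1 ?addr0 // => l' ll.
by rewrite rho_basis (negPf ll) mulr0.
Qed.

Lemma fk_ev_inj (n : N) :
  fk_ev n = 0 -> (forall v, fk_ev (fk_act v n) = 0) -> n = 0.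
Proof.
move=> n0 nv; apply/funext => j; apply: mx_cols0.
  by have := congr1 (fun F => F j) n0.
by move=> v; have := congr1 (fun F => F j) (nv v).
Qed.

Lemma constraint_entry t (m : 'M[k]_(6, 12)) r l :
  table_fun (constraint_table t) m r l =
    \sum_(r' < 6) m r' l * (coef (nth [::] (constraint_table t) (12 * r')) (12 * r))%:~R.
Proof.
rewrite table_fun_entry; apply: eq_bigr => r' _; rewrite (bigD1 l) //=.
have cE (l' : 'I_12) : coef (nth [::] (constraint_table t) (12 * r' + l')) (12 * r + l) =
    if l == l' then coef (nth [::] (constraint_table t) (12 * r')) (12 * r) else 0.
  have /allP/(_ r) := constraint_rows t; rewrite mem_iota ltn_ord => /(_ isT)/allP/(_ l).
  rewrite mem_iota ltn_ord => /(_ isT)/allP/(_ r').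
  rewrite mem_iota ltn_ord => /(_ isT)/allP/(_ l').
  by rewrite mem_iota ltn_ord => /(_ isT)/eqP.
rewrite cE eqxx big1 ?addr0 // => l' ll.
by rewrite cE eq_sym (negPf ll) mulr0.
Qed.

(** The constraints of S involve rows only, so they may be checked column by column. *)
Lemma fk_lv_cof i j (p : V -> N) :
  (forall v, fk_lv i j (p v)) -> fk_lv i j (fk_cof (fun v => fk_ev (p v))).
Proof.
move=> pl; split=> t; last first.
- move=> tj; apply/matrixP => r l; rewrite !mxE.
  by have [_ _ p3] := pl (basis_elt k l); rewrite p3 // mxE.
- move=> ti; apply/matrixP => r l; rewrite !mxE.
  by have [_ p2 _] := pl (basis_elt k l); rewrite p2 // mxE.
apply/matrixP => r l; rewrite constraint_entry [RHS]mxE.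
have [p1 _ _] := pl (basis_elt k l); have /matrixP/(_ r ord0) := p1 t.
rewrite constraint_entry !mxE => <-; apply: eq_bigr => r' _; by rewrite !mxE.
Qed.

Lemma basis_elt_mul (l : nat) : (3 < l < 12)%N ->
  exists u w : V, basis_elt k l = ideal_mul u w.
Proof.
move=> l3; suff [x [y [xI yI e]]] : exists x y, [/\ x \in fk_aug_ideal k,
    y \in fk_aug_ideal k & fk_basis k l = x * y].
  exists (IdealElt xI), (IdealElt yI); apply: val_inj.
  rewrite (@val_basis_elt k l) ?e //.
  by case/andP: l3 => l3 ->; rewrite (leq_trans _ l3).
have gI := fk_gen_aug k; have mI x y : y \in fk_aug_ideal k -> x * y \in fk_aug_ideal k.
  exact: Defs.idealMr.
case: l l3 => [|[|[|[|[|[|[|[|[|[|[|[|l]]]]]]]]]]]] // _;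
  pose a := fk_gen k i0; pose b := fk_gen k i1; pose c := fk_gen k i2.
- by exists a, b; split; [exact: gI | exact: gI | reflexivity].
- by exists b, c; split; [exact: gI | exact: gI | reflexivity].
- by exists b, a; split; [exact: gI | exact: gI | reflexivity].
- by exists c, b; split; [exact: gI | exact: gI | reflexivity].
- by exists (a * b), a; split; [exact/mI/gI | exact: gI | reflexivity].
- by exists (a * b), c; split; [exact/mI/gI | exact: gI | reflexivity].
- by exists (b * c), b; split; [exact/mI/gI | exact: gI | reflexivity].
- by exists (a * b * c), b; split; [exact/mI/gI | exact: gI | reflexivity].
Qed.

Lemma fk_gens_ind (p : V -> k^o) : linear p ->
  (forall v, is_fk_gen v -> p v = 0) -> (forall u v, p (ideal_mul u v) = 0) ->
  forall v, p v = 0.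
Proof.
move=> pl pg pm v; rewrite (linear_basis v pl) big1 // => l _.
suff -> : p (basis_elt k l) = 0 by rewrite scaler0.
have [l0|l0] := posnP l; first by rewrite l0 basis_elt0 (linear_at0 pl).
case: (ltnP 3 l) => l3.
  by have [|u [w ->]] := @basis_elt_mul l; rewrite ?l3 ?ltn_ord.
apply: pg; rewrite /is_fk_gen val_basis_elt ?l0 ?ltn_ord //.
case: l l0 l3 => [[|[|[|[|l]]]] p12] //= _ _; eexists; reflexivity.
Qed.

End KoszulCofree.

(** * Words in the rack monoid *)

Local Notation i0 := (@Ordinal 3 0 isT).
Local Notation i1 := (@Ordinal 3 1 isT).
Local Notation i2 := (@Ordinal 3 2 isT).

(* The product in S_3 of the reflections of a word: by parity of the length,   *)
(* the index of a reflection or of a rotation.                                 *)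
Fixpoint wval (w : seq 'I_3) : nat :=
  if w is x :: w' then ((x + 3 - wval w') %% 3)%N else 0%N.

Lemma wval_lt3 w : (wval w < 3)%N.
Proof. by case: w => //= x w; rewrite ltn_mod. Qed.

Lemma wval_rcons w (x : 'I_3) : wval (rcons w x) =
  ((if odd (size w) then 3 + wval w - x else 3 + wval w + x) %% 3)%N.
Proof.
have x3 := ltn_ord x; elim: w => [|y w IHw] /=; first by lia.
rewrite IHw; have := wval_lt3 w; have := ltn_ord y.
by case: odd => /=; lia.
Qed.

(* Words representing the elements of length n + 3 of the rack monoid that are *)
(* not powers of a generator.                                                  *)
Fixpoint mixed_word (n g : nat) : seq 'I_3 :=
  if n is n'.+1 then i0 :: mixed_word n' ((3 - g) %% 3)
  else i0 :: nth [::] [:: [:: i1; i1]; [:: i0; i1]; [:: i1; i0]] g.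

Lemma size_mixed_word n g : (g < 3)%N -> size (mixed_word n g) = n.+3.
Proof.
elim: n g => [|n IHn] g g3 /=; first by case: g g3 => [|[|[|]]].
by rewrite IHn // ltn_mod.
Qed.

Lemma wval_mixed_word n g : (g < 3)%N -> wval (mixed_word n g) = g.
Proof.
elim: n g => [|n IHn] g g3 /=; first by case: g g3 => [|[|[|]]].
by rewrite IHn ?ltn_mod //; lia.
Qed.

Definition pure (x : 'I_3) (w : seq 'I_3) : bool := all (pred1 x) w.

Lemma mixed_word_pure n g x : (g < 3)%N -> pure x (mixed_word n g) = false.
Proof.
elim: n g => [|n IHn] g g3 /=; last by rewrite -/(pure _ _) IHn ?ltn_mod ?andbF.
by rewrite /pure; case: g g3 x => [|[|[|//]]] _ [[|[|[|//]]] p].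
Qed.

Lemma pure_nseq x w : pure x w = (w == nseq (size w) x).
Proof. exact/all_pred1P/eqP. Qed.

(** * Normal form of words that are not powers of a generator *)

Section RackMonoid.
Variables (R : nzRingType) (g : 'I_3 -> R).
Hypotheses (ca : g i2 * g i0 = g i0 * g i1) (bc : g i1 * g i2 = g i0 * g i1).
Hypotheses (ba : g i1 * g i0 = g i0 * g i2) (cb : g i2 * g i1 = g i0 * g i2).
Local Notation P w := (\prod_(i <- w) g i).

Lemma mixed_mul3 (y p q : 'I_3) : ~~ ((y == p) && (p == q)) ->
  P [:: y; p; q] = P (mixed_word 0 (wval [:: y; p; q])).
Proof.
rewrite !big_cons big_nil mulr1.
have bab : g i1 * (g i0 * g i1) = g i0 * (g i1 * g i0).
  by rewrite mulrA ba -mulrA cb -ba.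
have bba : g i1 * (g i1 * g i0) = g i0 * (g i1 * g i1).
  by rewrite ba -cb mulrA bc mulrA.
have cab : g i2 * (g i0 * g i1) = g i0 * (g i1 * g i1) by rewrite mulrA ca mulrA.
have cba : g i2 * (g i1 * g i0) = g i0 * (g i0 * g i1).
  by rewrite mulrA cb -mulrA ca.
have cbb : g i2 * (g i1 * g i1) = g i0 * (g i1 * g i0) by rewrite mulrA cb -mulrA cb -ba.
have baa : g i1 * (g i0 * g i0) = g i0 * (g i0 * g i1) by rewrite mulrA ba -mulrA ca.
have caa : g i2 * (g i0 * g i0) = g i0 * (g i1 * g i0) by rewrite mulrA ca mulrA.
have acc : g i0 * (g i2 * g i2) = g i0 * (g i1 * g i1) by rewrite mulrA -ba -mulrA -ba bba.
have bcc : g i1 * (g i2 * g i2) = g i0 * (g i0 * g i1) by rewrite mulrA bc -mulrA bc.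
have F := (bab, bba, cab, cba, cbb, baa, caa, acc, bcc).
case: y p q => [[|[|[|//]]] hy] [[|[|[|//]]] hp] [[|[|[|//]]] hq] //= _;
  rewrite !big_cons big_nil mulr1;
  rewrite ?(bool_irrelevance hy isT) ?(bool_irrelevance hp isT) ?(bool_irrelevance hq isT).
all: have cb' : g i2 * g i1 = g i1 * g i0 by rewrite cb ba.
all: by rewrite ?ca ?bc ?cb' -?ba ?F.
Qed.

Lemma mixed_cons (n h : nat) (y : 'I_3) : (h < 3)%N ->
  g y * P (mixed_word n h) = P (mixed_word n.+1 ((y + 3 - h) %% 3)).
Proof.
elim: n h y => [|n IHn] h y h3.
  have M3 y' p q : ~~ ((y' == p) && (p == q)) ->
      g i0 * P [:: y'; p; q] = P (mixed_word 1 ((3 - wval [:: y'; p; q]) %% 3)).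
    move/mixed_mul3 ->; move: (wval _) (wval_lt3 [:: y'; p; q]) => v v3.
    rewrite [mixed_word 1 _]/= [in RHS]big_cons.
    by congr (_ * P (mixed_word 0 _)); lia.
  have W x p q : P [:: x; p; q] = g x * (g p * g q) by rewrite !big_cons big_nil mulr1.
  case: y => [[|[|[|//]]] hy]; rewrite ?(bool_irrelevance hy isT).
  - rewrite [mixed_word 1 _]/= [in RHS]big_cons; congr (_ * P (mixed_word 0 _)).
    by case: h h3 => [|[|[|]]].
  - case: h h3 => [|[|[|//]]] _; rewrite [mixed_word 0 _]/= W mulrA ba -mulrA -W M3 //.
  - case: h h3 => [|[|[|//]]] _; rewrite [mixed_word 0 _]/= W; last first.
    + by rewrite mulrA ca -mulrA -W M3.
    + by rewrite mulrA ca -mulrA -W M3.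
    rewrite mulrA ca -bc -mulrA -W mixed_mul3 // W mulrA ba -mulrA -W M3 //.
have h'3 : ((3 - h) %% 3 < 3)%N by rewrite ltn_mod.
rewrite [mixed_word n.+1 h]/= big_cons.
have aE (h' : nat) : (h' < 3)%N -> g i0 * P (mixed_word n.+1 h') = P (mixed_word n.+2 ((3 - h') %% 3)).
  move=> h'lt; rewrite [in RHS]/= big_cons; congr (_ * P (mixed_word n.+1 _)); lia.
case: y => [[|[|[|//]]] hy]; rewrite ?(bool_irrelevance hy isT).
- rewrite -[g i0 * P _](big_cons _ _ i0 (mixed_word n _) xpredT) -/(mixed_word n.+1 h).
  by rewrite aE // add0n.
- rewrite mulrA ba -mulrA IHn // aE ?ltn_mod //; congr (P (mixed_word _ _)) => /=; lia.
- rewrite mulrA ca -mulrA IHn // aE ?ltn_mod //; congr (P (mixed_word _ _)) => /=; lia.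
Qed.

(** Moves [x] to the front of y x, so that a word whose tail is a power of [x] acquires a mixed
    tail. *)
Lemma braid2 (y x : 'I_3) : y != x ->
  exists t : 'I_3, [/\ t != x, g y * g x = g x * g t & ((t + y) %% 3 = (x + x) %% 3)%N].
Proof.
case: y x => [[|[|[|//]]] hy] [[|[|[|//]]] hx] // _;
  rewrite ?(bool_irrelevance hy isT) ?(bool_irrelevance hx isT).
- by exists i2; split=> //; rewrite bc.
- by exists i1; split=> //; rewrite cb.
- by exists i2; split=> //; rewrite ba.
- by exists i0; split=> //; rewrite bc ca.
- by exists i1; split=> //; rewrite ca.
- by exists i0; split=> //; rewrite cb ba.
Qed.

(** Induction on the length: a mixed tail is put in normal form and absorbs the first letter by
    [mixed_cons]; a tail that is a power is first made mixed by [braid2]. *)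
Lemma mixed_word_eq n w : size w = n.+3 -> (forall x, ~~ pure x w) ->
  P w = P (mixed_word n (wval w)).
Proof.
elim: n w => [|n IHn] [|y w] // [sw] m.
  case: w sw m => [|p [|q [|//]]] // _ m; apply: mixed_mul3.
  by apply: contra (m y) => /andP[/eqP <- /eqP <-]; rewrite /pure /= eqxx.
have [/existsP[x px]|/existsPn w_mixed] := boolP [exists x, pure x w]; last first.
  rewrite big_cons (IHn _ sw w_mixed) mixed_cons ?wval_lt3 //.
have yx : y != x by apply: contra (m x) => /eqP ->; rewrite /= eqxx.
have [t [tx yxE tE]] := braid2 yx.
have wE : w = x :: nseq n.+2 x by apply/eqP; rewrite -[_ :: _]/(nseq n.+3 x) -sw -pure_nseq.
rewrite wE big_cons (big_cons _ _ x (nseq n.+2 x)) mulrA yxE -mulrA -(big_cons _ _ t (nseq n.+2 x) xpredT) IHn; first last.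
- move=> z; apply: contra tx => /andP[/eqP -> /andP[/eqP -> _]]; exact: eqxx.
- by rewrite /= size_nseq.
rewrite mixed_cons ?wval_lt3 //; congr (P (mixed_word _ _)).
have := wval_lt3 (nseq n.+2 x); have := ltn_ord x; have := ltn_ord y; have := ltn_ord t.
move: tE; rewrite [wval (t :: _)]/= [wval (y :: _)]/=; move: (wval _) => v; lia.
Qed.

End RackMonoid.

(* For t = 2 and g = 0, and for t < 2, there is no such element and the value *)
(* is irrelevant.                                                              *)
Definition mixed_canon (t g : nat) : seq 'I_3 :=
  if t is n.+3 then mixed_word n g else if g == 1%N then [:: i1; i0] else [:: i0; i1].

Definition mixed_exists (t g : nat) : bool := (2 < t)%N || ((t == 2) && (0 < g)%N).

Lemma mixed_canonP t g : (g < 3)%N -> mixed_exists t g ->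
  [/\ size (mixed_canon t g) = t, wval (mixed_canon t g) = g
    & forall x, pure x (mixed_canon t g) = false].
Proof.
case: t => [|[|[|n]]] // g3 => [|_]; last first.
  by split=> [||x]; [exact: size_mixed_word | exact: wval_mixed_word | exact: mixed_word_pure].
by case: g g3 => [|[|[|g]]] // _ _; split=> // -[[|[|[|x]]]].
Qed.

Lemma mixed_canon_eq (R : nzRingType) (g : 'I_3 -> R) w :
    g i2 * g i0 = g i0 * g i1 -> g i1 * g i2 = g i0 * g i1 ->
    g i1 * g i0 = g i0 * g i2 -> g i2 * g i1 = g i0 * g i2 ->
    w != [::] -> (forall x, ~~ pure x w) ->
  \prod_(i <- w) g i = \prod_(i <- mixed_canon (size w) (wval w)) g i.
Proof.
move=> ca bc ba cb; case: w => [|x [|y [|z w]]] // _ m; last exact: mixed_word_eq.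
  by have := m x; rewrite /pure /= eqxx.
case: x y m => [[|[|[|//]]] hx] [[|[|[|//]]] hy] // m;
  try (by [have := m i0 | have := m i1 | have := m i2]);
  rewrite /= !big_cons big_nil !mulr1;
  rewrite ?(bool_irrelevance hx isT) ?(bool_irrelevance hy isT).
- by [].
- by rewrite ba.
- by [].
- by rewrite bc.
- by rewrite ca.
- by rewrite cb ba.
Qed.

(** * Invariants of the Koszul complex *)

Section BraidedWords.
Variable k : fieldType.
Local Notation M := 'M[k]_(6, 12).
Local Notation N := (nat -> M).
Local Notation rword := (foldl (fun n i => @fk_rmul k i n) (fk_iota k)).

(** Coordinates of a word in the embedding of S: which generators it is a power of, and its image in
    S_3, all in column 0. *)
Definition word_vec (p0 p1 p2 : bool) (g : nat) : sparse :=
  [:: (0%N, p0%N%:Z); (12%N, p1%N%:Z); (24%N, p2%N%:Z); ((12 * (3 + g))%N, 1)].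

Lemma word_vec_rmul b p0 p1 p2 g (x : 'I_3) : (g < 3)%N -> same_coef 6
  (table_vec (rmul_table b x) (word_vec p0 p1 p2 g))
  (word_vec (p0 && (x == i0)) (p1 && (x == i1)) (p2 && (x == i2))
     ((if b then 3 + g - x else 3 + g + x) %% 3)%N).
Proof.
by case: b p0 p1 p2 g x => [] [] [] [] [|[|[|g]]] [[|[|[|x]]] hx] // _; vm_compute.
Qed.

Lemma pure_rcons x w y : pure x (rcons w y) = pure x w && (y == x).
Proof. by rewrite /pure all_rcons /= andbC. Qed.

Lemma rword_vec w : rword w =
  at_level (size w) (vec k 6 (word_vec (pure i0 w) (pure i1 w) (pure i2 w) (wval w))).
Proof.
elim/last_ind: w => [|w x IHw]; first by [].
rewrite foldl_rcons IHw fk_r_at_level size_rcons table_fun_vec; last by rewrite size_mkseq.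
rewrite (vec_same _ (word_vec_rmul _ _ _ _ _ (wval_lt3 w))) wval_rcons.
by rewrite !pure_rcons.
Qed.

Definition word_coord (w : seq 'I_3) (r : nat) : bool :=
  nth (wval w == r - 3)%N [:: pure i0 w; pure i1 w; pure i2 w] r.

Lemma coef_word_vec p0 p1 p2 g (r : 'I_6) (l : 'I_12) : (g < 3)%N ->
  coef (word_vec p0 p1 p2 g) (12 * r + l) =
  ((l == ord0) && nth (g == r - 3)%N [:: p0; p1; p2] r)%N%:Z.
Proof.
have /allP C : all (fun g => all (fun r => all (fun l =>
    coef (word_vec p0 p1 p2 g) (12 * r + l) ==
    ((l == 0)%N && nth (g == r - 3)%N [:: p0; p1; p2] r)%N%:Z) (iota 0 12))
    (iota 0 6)) (iota 0 3) by case: p0 p1 p2 => [] [] []; vm_compute.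
move=> g3; have := C g; rewrite mem_iota g3 => /(_ isT)/allP/(_ r).
rewrite mem_iota ltn_ord => /(_ isT)/allP/(_ l).
by rewrite mem_iota ltn_ord => /(_ isT)/eqP.
Qed.

Lemma rword_entry w t r l :
  rword w t r l = [&& t == size w, l == ord0 & word_coord w r]%:R.
Proof.
rewrite rword_vec /at_level; case: eqP => [_|_]; last by rewrite mxE.
by rewrite vecE coef_word_vec ?wval_lt3.
Qed.

Lemma sum_rows (U : nmodType) (f : 'I_6 -> U) : \sum_(r < 6) f r =
  \sum_(x < 3) f (widen_ord (isT : 3 <= 6)%N x) + \sum_(g < 3) f (inord (3 + g)).
Proof.
rewrite -[LHS]/(\sum_(r < 3 + 3) f r) big_split_ord; congr (_ + _);
  apply: eq_bigr => x _; congr f; apply: val_inj => //=.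
by rewrite inordK // (ltn_add2l 3 x 3).
Qed.

(* The row of g, minus the contribution of the powers of the generators, whose *)
(* coordinates are not only in the first three rows.                           *)
Definition mixed_coef (t : nat) (m : M) (g : nat) : k :=
  m (inord (3 + g)) ord0 -
  \sum_(x < 3) m (widen_ord (isT : 3 <= 6)%N x) ord0 * (wval (nseq t x) == g)%:R.

Fact mixed_coef_linear t g : scalar (fun m => mixed_coef t m g).
Proof.
move=> c m p; rewrite /mixed_coef !mxE mulrBr mulr_sumr.
rewrite (eq_bigr (fun x => c * (m (widen_ord (isT : 3 <= 6)%N x) ord0 * (wval (nseq t x) == g)%:R) +
  p (widen_ord (isT : 3 <= 6)%N x) ord0 * (wval (nseq t x) == g)%:R)); last first.
  by move=> x _; rewrite !mxE mulrDl mulrA.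
by rewrite big_split /= opprD addrACA.
Qed.

Section LevelComb.
Variables (W : lmodType k) (phi : seq 'I_3 -> W).

(** Inverse of the embedding in level [t]: it reads a combination of normal-form words off column 0
    and applies [phi] to them. *)
Definition level_comb (t : nat) (m : M) : W :=
  if t is 0 then m ord0 ord0 *: phi [::] else
  \sum_(x < 3) m (widen_ord (isT : 3 <= 6)%N x) ord0 *: phi (nseq t x) +
  \sum_(g < 3) mixed_coef t m g *: phi (mixed_canon t g).

Fact level_comb_linear t : linear (level_comb t).
Proof.
move=> c m p; case: t => [|t]; rewrite /level_comb.
  by rewrite !mxE scalerDl scalerA.
rewrite scalerDr !scaler_sumr addrACA; congr (_ + _); rewrite -big_split.
  by apply: eq_bigr => x _; rewrite /= !mxE scalerDl scalerA.
by apply: eq_bigr => g _; rewrite /= mixed_coef_linear scalerDl scalerA.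
Qed.
HB.instance Definition _ t :=
  GRing.isLinear.Build k M W *:%R (level_comb t) (level_comb_linear t).

End LevelComb.

Lemma linear_level_comb (W W' : lmodType k) (h : {linear W -> W'}) phi psi t m :
  (forall w, h (phi w) = psi w) -> h (level_comb phi t m) = level_comb psi t m.
Proof.
move=> hE; case: t => [|t]; rewrite /level_comb.
  by rewrite linearZZ hE.
rewrite linearD !linear_sum; apply: (congr2 +%R); apply: eq_bigr => x _;
  by rewrite linearZZ hE.
Qed.

Lemma pure_pure t (x y : 'I_3) : (0 < t)%N -> pure y (nseq t x) = (x == y).
Proof. by move=> t0; rewrite /pure all_nseq /= eqn0Ngt t0. Qed.

(** Where no mixed element exists, the constraint forces the row of g to be the contribution of the
    powers alone; hence the placeholder words of [mixed_canon] get coefficient 0. *)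
Lemma constraint_mixed t (m : M) g : (0 < t)%N -> (g < 3)%N -> ~~ mixed_exists t g ->
  table_fun (constraint_table t) m = m -> mixed_coef t m g = 0.
Proof.
move=> t0 g3 tg me; rewrite /mixed_coef -[in X in X - _]me constraint_entry.
have G6 : (3 + g < 6)%N by rewrite (ltn_add2l 3 g 3).
rewrite (inordK G6) sum_rows.
have C (r : 'I_6) : coef (nth [::] (constraint_table t) (12 * r)) (12 * (3 + g)) =
    ((r < 3)%N && ((t == 2) || (r == g :> nat)))%N%:Z.
  have [T G] : (t < 3)%N /\ (3 + g < 6)%N by split; [move: tg; rewrite /mixed_exists; lia | lia].
  case: t t0 tg T {me} => [|[|[|t]]] // _; case: g g3 G G6 => [|[|[|g]]] // _ _ _ _ _;
    by case: r => [[|[|[|[|[|[|r]]]]]] hr].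
rewrite [X in _ + X - _]big1 ?addr0 => [|r _]; last first.
  by rewrite C inordK ?(ltn_add2l 3 r 3) // mulr0.
apply/eqP; rewrite subr_eq0; apply/eqP/eq_bigr => x _; rewrite C.
rewrite (ltn_ord x : widen_ord (isT : 3 <= 6)%N x < 3)%N /=.
congr (_ * (nat_of_bool _)%:R); case: t t0 tg {me C} => [|[|[|t]]] // _ tg.
  by rewrite [wval _]/= subn0 modnDr modn_small.
case: g g3 tg {G6} => // _ _; rewrite [wval _]/=; have := ltn_ord x; lia.
Qed.

Lemma level_combK t (m : M) : table_fun (constraint_table t) m = m ->
  (forall r l, l != ord0 -> m r l = 0) ->
  level_comb (fun w => rword w) t m = at_level t m.
Proof.
move=> me m0; apply/funext => j; apply/matrixP => r l.
have ev c (n : N) : (c *: n) j r l = c * n j r l by rewrite -[(c *: n) j]/(c *: n j) mxE.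
have evD (n p : N) : (n + p) j r l = n j r l + p j r l.
  by rewrite -[(n + p) j]/(n j + p j) mxE.
have evS (I : finType) (f : I -> N) : (\sum_i f i) j r l = \sum_i f i j r l.
  by elim/big_rec2: _ => [|i x y _ <-]; [rewrite [LHS]mxE | rewrite evD].
case: t me => [|t] me; rewrite /level_comb.
  rewrite ev rword_entry /at_level /=; case: eqP => [_|_]; last by rewrite mulr0 mxE.
  have [->|l0] := eqVneq l ord0; last by rewrite mulr0 m0.
  rewrite -[in RHS]me constraint_entry.
  have C (r' q : 'I_6) : coef (nth [::] (constraint_table 0) (12 * r')) (12 * q) =
      ((r' == ord0) && word_coord [::] q)%N%:Z.
    by case: r' q => [[|[|[|[|[|[|a]]]]]] ha] [[|[|[|[|[|[|b]]]]]] hb].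
  rewrite (eq_bigr _ (fun q _ => congr1 (fun c => m q ord0 * c%:~R) (C q r))).
  rewrite (bigD1 ord0) //= big1 ?addr0 // => q q0.
  by rewrite (negPf q0) mulr0.
have T0 : (0 < t.+1)%N by []; move: t.+1 T0 me => T T0 me; rewrite evD !evS.
have pE x : (m (widen_ord (isT : 3 <= 6)%N x) ord0 *: rword (nseq T x)) j r l =
    m (widen_ord (isT : 3 <= 6)%N x) ord0 *
    [&& j == T, l == ord0 & if (r < 3)%N then x == r :> nat else wval (nseq T x) == (r - 3)%N]%:R.
  rewrite ev rword_entry size_nseq; congr (_ * [&& _, _ & _]%:R).
  rewrite /word_coord !pure_pure // -!val_eqE.
  by case: (r) => [[|[|[|[|[|[|r']]]]]] hr].
have cE (g : 'I_3) : (mixed_coef T m g *: rword (mixed_canon T g)) j r l =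
    mixed_coef T m g * [&& j == T, l == ord0 & r == (3 + g)%N :> nat]%:R.
  have [tg|/constraint_mixed -> //] := boolP (mixed_exists T g); last by rewrite scale0r mul0r [LHS]mxE.
  have [sE wE nE] := mixed_canonP (ltn_ord g) tg.
  rewrite ev rword_entry sE /word_coord wE !nE; congr (_ * [&& _, _ & _]%:R).
  by case: (r) (g) => [[|[|[|[|[|[|r']]]]]] hr] [[|[|[|g']]] hg].
rewrite (eq_bigr _ (fun x _ => pE x)) (eq_bigr _ (fun g _ => cE g)) /at_level {pE cE}.
case: eqP => [_|_] /=; last first.
  by rewrite !big1 ?addr0 ?mxE // => x _; rewrite mulr0.
have [->|l0] := eqVneq l ord0; last first.
  by rewrite !big1 ?addr0 ?m0 // => x _; rewrite mulr0.
have [r3|r3] := ltnP r 3.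
  rewrite (bigD1 (Ordinal r3)) //= eqxx mulr1 !big1 ?addr0 => [|g _|x xr].
  - by congr (m _ _); apply: val_inj.
  - by rewrite (negPf (_ : r != 3 + g :> nat)%N) ?mulr0 //; lia.
  - by rewrite (negPf (_ : x != r :> nat)%N) ?mulr0.
have r6 : (r - 3 < 3)%N by have := ltn_ord r; lia.
rewrite addrC (bigD1 (Ordinal r6)) //= subnKC // eqxx mulr1 big1 => [|g gr].
  rewrite addr0 /mixed_coef subrK subnKC //; congr (m _ _); exact: inord_val.
rewrite (negPf (_ : r != 3 + g :> nat)%N) ?mulr0 //.
by apply: contra gr => /eqP re; rewrite -val_eqE /= re addKn.
Qed.

Lemma mulmx_rho_basis (m : M) r (l : 'I_12) : (m *m rho k (fk_basis k l)) r ord0 = m r l.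
Proof.
rewrite mxE (bigD1 l) //= rho_basis eqxx mulr1 big1 ?addr0 // => l' ll.
by rewrite rho_basis (negPf ll) mulr0.
Qed.

(** Invariance kills every column except that of 1, leaving an element of S in each level, which
    [level_combK] writes with words. *)
Lemma invariant_words j (n : N) : fk_lv 0 j n -> (forall v, fk_act v n = 0) ->
  exists u : free_alg k 3, n = lin_ext (fun w => rword w) u.
Proof.
move=> [n1 _ n3] n0; exists (\sum_(t < j.+1) level_comb (@word k 3) t (n t)).
rewrite linear_sum (eq_bigr (fun t : 'I_j.+1 => at_level t (n t))) => [|t _].
  apply/funext => t; have -> : (\sum_(i < j.+1) at_level i (n i)) t =
      \sum_(i < j.+1) at_level i (n i) t.
    by elim/big_rec2: _ => // i x y _ <-.
  have [tj|tj] := ltnP t j.+1.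
    rewrite (bigD1 (Ordinal tj)) //= {1}/at_level eqxx big1 ?addr0 // => i it.
    by rewrite /at_level eq_sym (negPf (it : i != t :> nat)).
  rewrite n3 // big1 // => i _; rewrite /at_level; case: eqP => // ti.
  by have := ltn_ord i; rewrite -ti ltnNge tj.
rewrite (linear_level_comb _ _ (lin_ext_word _)) level_combK // => r l l0.
have := congr1 (fun p : N => p t r ord0) (n0 (basis_elt k l)).
rewrite /fk_act val_basis_elt ?ltn_ord ?andbT ?lt0n // mulmx_rho_basis => ->.
by rewrite mxE.
Qed.

Local Notation pi := (aq_pi (relator_ideal (Relators (braided_sym_relations_aug k)))).

Lemma braided_relation (x y z : 'I_3) : uniq [:: x; y; z] ->
  pi (free_var k x) * pi (free_var k y) = pi (free_var k z) * pi (free_var k x).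
Proof.
move=> xyz; have s_inj : injective (tnth [tuple x; y; z]) by apply/tuple_uniqP.
have [sx sy sz] : [/\ perm s_inj i0 = x, perm s_inj i1 = y & perm s_inj i2 = z].
  by rewrite !permE.
have r_in : free_var k x * free_var k y - free_var k z * free_var k x
    \in braided_sym_relations k.
  rewrite -[in free_var k x]sx -[in free_var k y]sy -[in free_var k z]sz.
  exact: (image_f (fun s : 'S_3 => free_var k (s i0) * free_var k (s i1)
       - free_var k (s i2) * free_var k (s i0))).
have r0 := @pi_relator _ _ (Relators (braided_sym_relations_aug k)) _ r_in.
apply/eqP; rewrite -subr_eq0; apply/eqP; apply: etrans r0; apply: esym.
apply: etrans (rmorphB pi _ _) _; apply: (congr2 (fun u v => u - v)); exact: (rmorphM pi).
Qed.

Lemma level_comb_rword (W : lmodType k) (phi : seq 'I_3 -> W) w :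
    (w != [::] -> (forall x, ~~ pure x w) -> phi w = phi (mixed_canon (size w) (wval w))) ->
  level_comb phi (size w) (rword w (size w)) = phi w.
Proof.
move=> phiE; case sw : (size w) => [|t'].
  by rewrite (size0nil sw) /level_comb rword_entry scale1r.
rewrite /level_comb.
have T0 : (0 < t'.+1)%N by []; move: t'.+1 T0 sw => {t'} t t0 sw.
have sizeE : t == size w by rewrite sw.
have [/existsP[x px]|/existsPn mixed] := boolP [exists x, pure x w].
  have wE : w = nseq t x by move: px; rewrite pure_nseq sw => /eqP.
  have mE y : rword w t (widen_ord (isT : 3 <= 6)%N y) ord0 = (y == x)%:R.
    rewrite rword_entry sizeE /= /word_coord wE !pure_pure //.
    by rewrite -!val_eqE; case: y x {px wE} => [[|[|[|y]]] hy] [[|[|[|x]]] hx].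
  rewrite (bigD1 x) //= mE eqxx scale1r -wE !big1 ?addr0 // => [g _|y yx].
    rewrite /mixed_coef (bigD1 x) //= mE eqxx mul1r big1 => [|y yx]; last first.
      by rewrite mE (negPf yx) mul0r.
    rewrite addr0 rword_entry sizeE /= /word_coord inordK ?(ltn_add2l 3 g 3) //=.
    by rewrite addKn -wE nth_nil subrr scale0r.
  by rewrite mE (negPf yx) scale0r.
have mE y : rword w t (widen_ord (isT : 3 <= 6)%N y) ord0 = 0.
  rewrite rword_entry sizeE /= /word_coord !(negPf (mixed _)).
  by case: y => [[|[|[|y]]] hy].
have w3 := wval_lt3 w.
rewrite big1 ?add0r => [|y _]; last by rewrite mE scale0r.
have cE (g : 'I_3) : mixed_coef t (rword w t) g = (wval w == g)%:R.
  rewrite /mixed_coef big1 ?subr0 => [|y _]; last by rewrite mE mul0r.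
  rewrite rword_entry sizeE /= /word_coord inordK ?(ltn_add2l 3 g 3) //=.
  by rewrite addKn nth_nil.
rewrite (eq_bigr _ (fun (g : 'I_3) _ => congr1 (fun c => c *: phi (mixed_canon t g)) (cE g))).
rewrite (bigD1 (Ordinal w3)) //= eqxx scale1r big1 ?addr0 => [|g gw]; last first.
  by rewrite eq_sym (negPf (gw : g != wval w :> nat)) scale0r.
rewrite phiE ?sw //; by case: (w) sw t0 => // <-.
Qed.

Lemma pi_level_comb w :
  level_comb (fun w => pi (word k w)) (size w) (rword w (size w)) = pi (word k w).
Proof.
apply: level_comb_rword => w0 mixed.
have piE v : pi (word k v) = \prod_(i <- v) pi (free_var k i) by exact: (rmorph_prod pi).
rewrite (piE w) (piE (mixed_canon _ _)).
have br x y z := @braided_relation x y z.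
exact: (@mixed_canon_eq _ (fun i => pi (free_var k i)) w (esym (br i0 i1 i2 isT))
  (br i1 i2 i0 isT) (esym (br i0 i2 i1 isT)) (br i2 i1 i0 isT) w0 mixed).
Qed.

(** If [h] depends on a word only through its normal form, then [h u] is recovered level by level
    from the coordinates of [u]. With [h] the projection to S this is faithfulness of the
    embedding. *)
Lemma linear_rword_eq0 (W : lmodType k) (h : {linear free_alg k 3 -> W}) u :
    (forall w, level_comb (fun w => h (word k w)) (size w) (rword w (size w)) = h (word k w)) ->
  lin_ext (fun w => rword w) u = 0 -> h u = 0.
Proof.
move=> hw; pose E u : N := lin_ext (fun w => rword w) u.
(* Stating the formula for all large bounds lets the bounds of two summands be merged. *)
have [L uL] : exists L, forall L', (L <= L')%N -> h u =
  \sum_(t < L') level_comb (fun w => h (word k w)) t (E u t).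
  elim/free_alg_ind: u => [w||c u v [L uL] [L' vL]].
  - exists (size w).+1 => L wL; rewrite /E lin_ext_word.
    rewrite (bigD1 (Ordinal wL)) //= hw big1 ?addr0 // => t tw.
    have -> : rword w t = 0; last exact: linear0.
    apply/matrixP => r l.
    by rewrite rword_entry (negPf (tw : t != size w :> nat)) mxE.
  - exists 0%N => L _; rewrite linear0 big1 // => t _.
    rewrite [E 0]linear0; exact: linear0.
  - exists (maxn L L') => L2; rewrite geq_max => /andP[L2L L2L'].
    rewrite [h (_ + _)]linearP (uL _ L2L) (vL _ L2L') scaler_sumr -big_split.
    apply: eq_bigr => t _; rewrite [E (_ + _)]linearP.
    exact: (esym (level_comb_linear _ _ c (E u t) (E v t))).
move=> u0; rewrite (uL L) // [E u]u0 big1 // => t _; exact: linear0.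
Qed.

Lemma lin_ext_rword_eq0 u : lin_ext (fun w => rword w) u = 0 -> pi u = 0.
Proof. exact: linear_rword_eq0 pi_level_comb. Qed.

Lemma braided_relation_rword r : r \in braided_sym_relations k ->
  lin_ext (fun w => rword w) r = 0.
Proof.
move=> /imageP[s _ ->].
rewrite -[X in lin_ext _ (X - _)]word_pair -[X in lin_ext _ (_ - X)]word_pair.
apply: (etrans (linearB (lin_ext (fun w => rword w)) _ _)).
apply: (etrans (congr2 (fun n p : N => n - p) (lin_ext_word _ _) (lin_ext_word _ _))).
apply/eqP; rewrite subr_eq0; apply/eqP.
apply/funext => t; apply/matrixP => r' l.
rewrite !rword_entry; congr [&& _, _ & _]%:R.
have : uniq [:: s i0; s i1; s i2] by rewrite /= !inE !(inj_eq perm_inj).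
case: (s i0) (s i1) (s i2) => [[|[|[|x]]] hx] [[|[|[|y]]] hy] [[|[|[|z]]] hz] // _;
  by case: r' => [[|[|[|[|[|[|r']]]]]] hr'].
Qed.

End BraidedWords.

Lemma braided_relation_homog (k : fieldType) r :
  r \in braided_sym_relations k -> word_homog 2 r.
Proof.
move=> /imageP[s _ ->] m.
rewrite -[X in X - _]word_pair -[X in _ - X]word_pair mcoeffB !mcoeff_word.
rewrite -[fdeg m]/(size (m : seq 'I_3)).
case: ([:: s i0; s i1] =P m :> seq _) => [<- //|_].
case: ([:: s i2; s i0] =P m :> seq _) => [<- //|_].
by rewrite subrr eqxx.
Qed.

(** * Application to the explicit complex K *)

Theorem theorem4p17 (k : fieldType) (char0 : [pchar k] =i pred0) :
  exists phi : {rmorphism fk_cohomology k -> {poly braided_sym k}},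
    [/\ bijective phi,
        forall (c : k) (e : fk_cohomology k),
          phi (c *: e) = c%:A%:P * phi e
      & forall (n : nat) (e : fk_cohomology k),
          fk_cohom_homog n e <->
          poly_homog (@braided_sym_homog k) 4 n (phi e)].
Proof.
pose N : lmodType k := nat -> 'M[k]_(6, 12).
pose act (v : ideal_type (fk_aug_ideal k)) : {linear N -> N} := @fk_act k v.
pose d : {linear N -> N} := @fk_d k.
pose lam : {linear N -> k^o} := @fk_lam k.
pose kap : {linear N -> N} := @fk_kap k.
pose r (i : 'I_3) : {linear N -> N} := @fk_rmul k i.
pose phi (i : 'I_3) : {linear ideal_type (fk_aug_ideal k) -> k^o} := @fk_phi k i.
have reduce := @cofree_reduce k _ _ N act (@fk_act_lin k) (@fk_actM k) d (@fk_lv k)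
  (@fk_d_act k) (@fk_dK k) (@fk_lv0 k) (@fk_lv_lin k) (@fk_lv_mono k) (@fk_lv_act k)
  (@fk_lv_d k) _ (@fk_ev k) (@fk_cof k) (@fk_cof_lin k) (@fk_ev_cof k)
  (@fk_ev_act_cof k) (@fk_ev_inj k) (@fk_lv_cof k).
have [a [x [a1 x4 [exact_words gen x_inj indep x_comm]]]] :=
  @koszul_classes k _ _ N act (@fk_act_lin k) (@fk_actM k) d (@fk_lv k)
  (@fk_d_act k) (@fk_dK k) (@fk_lv0 k) (@fk_lv_lin k) (@fk_lv_mono k) (@fk_lv_act k)
  (@fk_lv_d k) kap (@fk_lam0 k) lam (fk_iota k) (fk_omega k) (@fk_kap_lv k) (@fk_kap_lv0 k)
  (@fk_kap_htpy k) (@fk_lv_iota k) (@fk_lv_omega k) (@fk_d_iota k) (@fk_act_iota k)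
  (@fk_lam0_iota k) (@fk_d_omega k) (@fk_lam_omega k) (@fk_lam_d k) (@fk_lam_act_omega k)
  (@fk_lam_lv k) (@fk_lam0_lv k) (@is_fk_gen k) (@fk_gens_ind k) 3 r (@fk_dual k) phi
  (@fk_r_act k) (@fk_r_d k) (@fk_r_lv k) (@fk_lv_dual k) (@fk_d_dual k) (@fk_act_dual k)
  (@fk_commute_value k) reduce (@invariant_words k).
pose rw : {linear free_alg k 3 -> N} := lin_ext (foldl (fun n i => r i n) (fk_iota k)).
exact: (@polynomial_presentation k _ _ 3 (Relators (braided_sym_relations_aug k)) N rw
  a x 4 isT a1 x4 (@braided_relation_homog k) (@braided_relation_rword k)
  (@lin_ext_rword_eq0 k) exact_words gen x_inj indep x_comm).
Qed.
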